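(* Let $d\ge2$. Consider the device-to-device network model in which the devices are deployed according to a stationary Poisson-Poisson cluster process $\Psi$ on $\mathbb{R}^d$ with parameters $\lambda_\Phi\in(0,\infty)$, $\mu\in(0,\infty)$ and diffuse offspring distribution $Q$, each device transmits with probability $p\in(0,1)$, the path-loss function is $\ell$, the noise constant is $N\ge0$ and the SINR threshold is $\theta>0$ (all as specified in the context). Then the coverage probability $\mathsf{CP}(\theta)$ is given by $$\mathsf{CP}(\theta)=(1-p)p\mu\int_{\mathbb{R}^d}\bigl(I_{1,\theta}(t)+I_{2,\theta}(t)\bigr)\,Q^-(\mathrm{d}t),$$ where $Q^-(B)=Q(-B)$ with $-B=\{-x:x\in B\}$, and $$I_{1,\theta}(t)=\int_{\mathbb{R}^d}e^{-\theta N/\ell(\|y\|)}\,C_\theta(y,t)\,E_\theta(y)\,Q(\mathrm{d}y-t),$$ $$I_{2,\theta}(t)=\lambda_\Phi\int_{\mathbb{R}^d}\int_{\mathbb{R}^d}e^{-\theta N/\ell(\|y\|)}\,C_\theta(y,t)\,C_\theta(y,x)\,E_\theta(y)\,Q(\mathrm{d}y-x)\,\mathrm{d}x,$$ $$E_\theta(y)=\exp\biggl(-\lambda_\Phi\int_{\mathbb{R}^d}\bigl[1-C_\theta(y,w)\bigr]\,\mathrm{d}w\biggr),$$ $$C_\theta(y,x)=\exp\biggl(-p\mu\biggl[1-\int_{\|z\|>\|y\|}\Bigl(1+\theta\,\frac{\ell(\|z\|)}{\ell(\|y\|)}\Bigr)^{-1}Q(\mathrm{d}z-x)\biggr]\b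iggr).$$
   Context: Notation: $Q(\mathrm{d}y-x)$ denotes integration in $y$ against the translated measure $B\mapsto Q(B-x)$, with $B-x=\{b-x:b\in B\}$. $\mathbf 1$ denotes an indicator, $\|\cdot\|$ the Euclidean norm, and $S_t\eta(B)=\eta(B+t)$ for a measure $\eta$. In the integrals over $y$ above, the integrand is read as $0$ where $\ell(\|y\|)=0$. Poisson-Poisson cluster process (PPCP): $\Phi=\sum_{n=1}^\infty\delta_{X_n}$ is a homogeneous Poisson point process on $\mathbb{R}^d$ with intensity $\lambda_\Phi\in(0,\infty)$ (parent process). $\Psi_n=\sum_{k=1}^{\kappa_n}\delta_{Y_{n,k}}$, $n\in\mathbb{N}$, are mutually independent Poisson point processes on $\mathbb{R}^d$, independent of $\Phi$, each with intensity measure $\mu Q$, where $\mu\in(0,\infty)$ and $Q$ is a probability distribution on $\mathbb{R}^d$ that is diffuse ($Q(\{x\})=0$ for all $x$). The PPCP is $\Psi=\sum_{n=1}^\infty S_{-X_n}\Psi_n=\sum_{n=1}^\infty\sum_{k=1}^{\kappa_n}\delta_{X_n+Y_{n,k}}$; it is simple and stationary with intensity $\lambda_\Psi=\lambda_\Phi\mu$. Palm distribution: $\mathbb{P}_\Psi^0$ is the Palm probability of $\Psi$ (i.e. given a point of $\Psi$ at the origin) and $\Psi^!=\Psi-\delta_0$ is the reduced Palm version. Its law is given by $\mathbb{E}_\Psi^0[F(\Psi^!)]=\lambda_\Psi^{-1}\,\mathbb{E}\bigl[\int_{[0,1]^d}F(S_y\Psi-\delta_0)\,\Psi(\mathrm{d}y)\bigr]$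 for nonnegative measurable $F$. Device-to-device network: the points of $\Psi$ are wireless devices. Each device is, independently of everything else, in transmission mode with probability $p\in(0,1)$ and in receiving mode with probability $1-p$. The typical device is the one at the origin under $\mathbb{P}_\Psi^0$. Let $\Psi_{\mathsf{Tx}}=\sum_{m=1}^\infty\delta_{Y'_m}$ be the point process of the transmitting devices other than the typical one, so under $\mathbb{P}_\Psi^0$ it is obtained from $\Psi^!$ by independently keeping each point with probability $p$. The fading variables $H_m$, $m\in\mathbb{N}$, are mutually independent, exponentially distributed with unit mean, and independent of $\Psi_{\mathsf{Tx}}$. The path-loss function $\ell:(0,\infty)\to[0,\infty)$ is measurable with $\int_\epsilon^\infty\ell(r)r^{d-1}\,\mathrm{d}r<\infty$ for every $\epsilon>0$. $N\ge0$ is a constant (noise). The signal-to-interference-plus-noise ratio is $$\mathsf{SINR}_m=\frac{H_m\,\ell(\|Y'_m\|)}{\sum_{j\ge1,\,j\ne m}H_j\,\ell(\|Y'_j\|)+N},$$ read as $0$ when $\ell(\|Y'_m\|)=0$ or when the denominator is infinite. Coverage probability: a receiving device communicates with its nearest transmitting device, and the message is decoded if the typical device is in receiving mode and the SINR exceeds the threshold $\theta>0$. Thus $$\mathsf{CP}(\theta)=(1-p)\sum_{m=1}^\infty\mathbb{P}_\Psi^0\bigl(\mathsf{SINR}_m>\theta,\ \|Y'_m\|<\|Y'_j\|\text{ for all }j\in\mathbb{N},\ j\ne m\bigr).$$ *)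

(* Defs.v *)
From HB Require Import structures.
From mathcomp Require Import all_boot all_order all_algebra.
From mathcomp Require Import finmap.
From mathcomp Require Import all_classical all_reals all_analysis.
From mathcomp Require Import measurable_realfun.

Set Implicit Arguments.
Unset Strict Implicit.
Unset Printing Implicit Defensive.

Import Order.TTheory GRing.Theory Num.Theory.
Import numFieldNormedType.Exports.

Local Open Scope classical_set_scope.
Local Open Scope ring_scope.

(* Product sigma-algebra on row vectors; over a realType it is the Borel
   sigma-algebra of R^n. *)
Definition measure_rV_display : measure_display -> measure_display.
Proof. exact. Qed.

Section measurable_rV.
Context {d} {T : sigmaRingType d}.
Variable n : nat.

Let coord : 'I_n -> 'rV[T]_n -> T := fun i x => x ord0 i.

Let rV_set0 : g_sigma_preimage coord set0.
Proof. exact: sigma_algebra0. Qed.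

Let rV_setC A : g_sigma_preimage coord A -> g_sigma_preimage coord (~` A).
Proof. exact: sigma_algebraC. Qed.

Let rV_bigcup (F : _^nat) : (forall i, g_sigma_preimage coord (F i)) ->
  g_sigma_preimage coord (\bigcup_i (F i)).
Proof. exact: sigma_algebra_bigcup. Qed.

HB.instance Definition _ := @isMeasurable.Build (measure_rV_display d)
  'rV[T]_n (g_sigma_preimage coord) rV_set0 rV_setC rV_bigcup.

End measurable_rV.

(* The norm `|x| of the library on 'rV[R]_n is the sup norm. *)
Definition enorm (R : realType) n (x : 'rV[R]_n) : R :=
  Num.sqrt (\sum_(i < n) x ord0 i ^+ 2).

(* Lebesgue measure on R^n, by iterated products; 1 + n reduces to n.+1. *)
Fixpoint lebesgue_rV (R : realType) n : set 'rV[R]_n -> \bar R :=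
  match n with
  | 0 => \d_(0 : 'rV[R]_0)
  | m.+1 => pushforward (lebesgue_measure \x @lebesgue_rV R m)%E
      (fun z : R * 'rV[R]_m => row_mx z.1%:M z.2 : 'rV[R]_m.+1)
  end.

Section lebesgue_rV_lemmas.
Local Open Scope ereal_scope.

Lemma lebesgue_rV0 (R : realType) n : @lebesgue_rV R n set0 = 0.
Proof.
elim: n => [|n IH] /=; first by rewrite measure0.
rewrite /pushforward preimage_set0 /product_measure1 integral0_eq// => x _ /=.
by rewrite xsection0.
Qed.

Lemma lebesgue_rV_box (R : realType) n (a b : 'rV[R]_n) :
  (forall i, a ord0 i <= b ord0 i)%R ->
  lebesgue_rV [set x : 'rV[R]_n | forall i, (a ord0 i <= x ord0 i <= b ord0 i)%R] =
  (\prod_(i < n) (b ord0 i - a ord0 i))%:E.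
Proof.
elim: n a b => [|n IH] a b ab /=.
  by rewrite big_ord0 diracE mem_set//= => -[].
rewrite /pushforward /product_measure1.
pose a' := \row_(i < n) a ord0 (lift ord0 i).
pose b' := \row_(i < n) b ord0 (lift ord0 i).
have ab' i : (a' ord0 i <= b' ord0 i)%R by rewrite !mxE.
have e0 (x : R) (v : 'rV[R]_n) :
   (row_mx x%:M v : 'rV[R]_n.+1) ord0 ord0 = x.
  have <- : lshift n (ord0 : 'I_1) = (ord0 : 'I_n.+1) by apply: val_inj.
  by have := row_mxEl x%:M v ord0 ord0; rewrite [X in _ = X -> _]mxE eqxx mulr1n.
have e1 (x : R) (v : 'rV[R]_n) i :
   (row_mx x%:M v : 'rV[R]_n.+1) ord0 (lift ord0 i) = v ord0 i.
  have <- : rshift 1 i = lift ord0 i by apply: val_inj.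
  exact: row_mxEr x%:M v ord0 i.
under eq_integral => x _.
  rewrite /= (_ : lebesgue_rV _ = (\1_(`[a ord0 ord0, b ord0 ord0]%classic : set R) x)%:E *
    (\prod_(i < n) (b' ord0 i - a' ord0 i))%:E); last first.
    rewrite indicE -(IH _ _ ab'); case: (boolP (_ \in _)) => xab.
      rewrite mul1e; congr lebesgue_rV.
      apply/seteqP; split => v; rewrite /xsection /= inE /=.
        by move=> h i; have := h (lift ord0 i); rewrite e1 !mxE.
      move=> h i; case: (unliftP ord0 i) => [j|] ->.
        by have := h j; rewrite e1 !mxE.
      by rewrite e0; move: xab; rewrite inE /= in_itv.
    rewrite mul0e -[RHS](lebesgue_rV0 R n); congr lebesgue_rV.
    apply/seteqP; split => v //; rewrite /xsection /= inE /= => /(_ ord0).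
    by rewrite e0 => h; move/negP: xab; apply; rewrite inE /= in_itv.
  over.
rewrite ge0_integralZr//=.
- rewrite integral_indic//= setIT lebesgue_measure_itv /= lte_fin.
  rewrite big_ord_recl EFinM; congr (_ * _).
    have := ab ord0; rewrite le_eqVlt => /orP[/eqP ->|->].
      by rewrite ltxx subrr.
    by rewrite EFinB.
  by congr EFin; apply: eq_bigr => i _; rewrite !mxE.
- by apply/measurable_EFinP; exact: measurable_indic.
- by rewrite lee_fin prodr_ge0// => i _; rewrite subr_ge0.
Qed.

End lebesgue_rV_lemmas.

Section independence.
Context d (T : measurableType d) (R : realType) (P : probability T R).
Local Open Scope ereal_scope.

Definition mutually_independent (I : choiceType) (G : I -> set (set T)) :=
  forall (J : {fset I}) (A : I -> set T),
    (forall i, i \in J -> G i (A i)) ->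
    P (\bigcap_(i in [set` J]) A i) = \big[*%E/1]_(i <- J) P (A i).

Definition g_sigma_family d' (T' : measurableType d') (J : Type) (D : set J)
    (f : J -> T -> T') : set (set T) :=
  <<s \bigcup_(j in D) g_sigma_algebra_preimage (f j) >>.

End independence.

Section point_processes.
Context (R : realType) (n : nat).
Local Notation E := 'rV[R]_n.
Implicit Types (eta : set E -> \bar R).
Local Open Scope ereal_scope.

(* The measure B |-> eta (B - x). Thus S_t eta = translate (- t) eta, and
   integration against Q(dy - x) is integration against translate x Q. *)
Definition translate (x : E) eta : set E -> \bar R :=
  pushforward eta (fun y : E => (y + x)%R).

Definition unit_cube : set E := [set x | forall i, (0 <= x ord0 i <= 1)%R].

Definition point_measure (x : nat -> E) : set E -> \bar R :=
  mseries (fun k => \d_(x k)) 0.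

(* Generators of the sigma-algebra for which every eta |-> eta B, B
   measurable, is measurable. The ambient type contains all set functions, not
   only measures, so that S_y eta - \d_0 is defined for every y. *)
Definition evaluations : set (set (set E -> \bar R)) :=
  \bigcup_(B in measurable)
    g_sigma_algebra_preimage (fun eta : set E -> \bar R => eta B).

Section on_a_probability_space.
Context d (T : measurableType d) (P : probability T R).

Definition g_sigma_process (N : T -> set E -> \bar R) : set (set T) :=
  g_sigma_family measurable (fun B w => N w B).

(* The library's poisson_pmf is not the Dirac mass at 0 when the rate is 0,
   hence the explicit formula. *)
Definition poisson_process (Lambda : set E -> \bar R)
    (N : T -> set E -> \bar R) : Prop :=
  [/\ forall B, measurable B -> measurable_fun setT (fun w => N w B),
      forall B, measurable B -> Lambda B < +oo -> forall k : nat,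
        P [set w | N w B = k%:R%:E] =
        (fine (Lambda B) ^+ k / k`!%:R * expR (- fine (Lambda B)))%:E &
      forall B : (set E)^nat,
        (forall i, measurable (B i)) -> trivIset setT B ->
        mutually_independent P
          (fun i => g_sigma_algebra_preimage (fun w => N w (B i)))].

Section cluster_process.
Variables (X : nat -> {RV P >-> E}) (kappa : nat -> {RV P >-> nat}).
Variables (Y : nat -> nat -> {RV P >-> E}).

Definition parents (w : T) : set E -> \bar R := point_measure (X ^~ w).

Definition offspring (i : nat) (w : T) : set E -> \bar R :=
  msum (fun k => \d_(Y i k w)) (kappa i w).

Definition cluster_process (w : T) : set E -> \bar R :=
  fun B => \sum_(0 <= i <oo) translate (X i w) (offspring i w) B.

(* Independence involves the sequence of parent points and not only the point
   process it defines: an enumeration of the parents depending on the clusters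
   would change the law of the cluster process. *)
Definition PPCP (lambda mu : R) (Q : probability E R) : Prop :=
  [/\ poisson_process (fun B => lambda%:E * @lebesgue_rV R n B) parents,
      forall i, poisson_process (fun B => mu%:E * Q B) (offspring i) &
      mutually_independent P (fun o : option nat =>
        if o is Some i then g_sigma_process (offspring i)
        else g_sigma_family setT (fun i => X i : T -> E))].

End cluster_process.

(* N0 on (T0, P0) is a reduced Palm version of the stationary point process N
   with intensity lambda. *)
Definition reduced_palm (lambda : R) (N : T -> set E -> \bar R)
    d0 (T0 : measurableType d0) (P0 : probability T0 R)
    (N0 : T0 -> set E -> \bar R) : Prop :=
  forall F : (set E -> \bar R) -> \bar R,
    measurable_fun [set: g_sigma_algebraType evaluations] F ->
    (forall eta, 0 <= F eta) ->
    \int[P0]_w F (N0 w) = (lambda^-1)%:E *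
      \int[P]_w \int[N w]_(y in unit_cube)
        F (fun B => translate (- y)%R (N w) B - \d_(0%R : E) B).

End on_a_probability_space.

Section network.
Context d (T : measurableType d) (P : probability T R).

(* Phi is the point process of the Z i with tx i, where the tx i are
   independent of each other and of (Z i)_i, and each holds with
   probability p. *)
Definition thinning (p : R) (Z : nat -> {RV P >-> E})
    (tx : nat -> {RV P >-> bool}) (Phi : T -> set E -> \bar R) : Prop :=
  [/\ forall i, P [set w | tx i w] = p%:E,
      mutually_independent P (fun o : option nat =>
        if o is Some i then g_sigma_algebra_preimage (tx i : T -> bool)
        else g_sigma_family setT (fun i => Z i : T -> E)) &
      {ae P, forall w, forall B, measurable B ->
        Phi w B = \sum_(0 <= i <oo | tx i w) \d_(Z i w) B}].

(* Here too the independence is from the sequence of points. *)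
Definition fading (H : nat -> {RV P >-> R}) (Y : nat -> {RV P >-> E}) : Prop :=
  (forall m V, measurable V -> distribution P (H m) V = exponential_prob 1 V) /\
  mutually_independent P (fun o : option nat =>
    if o is Some m then g_sigma_algebra_preimage (H m : T -> R)
    else g_sigma_family setT (fun m => Y m : T -> E)).

Section coverage.
Variables (p : R) (ell : R -> R) (noise theta : R).
Variables (H : nat -> {RV P >-> R}) (Y : nat -> {RV P >-> E}).

(* In \bar R, +oo^-1 = 0, 0^-1 = +oo and 0 * +oo = 0, so the ratio is 0 when
   the numerator is 0 or the denominator infinite, and +oo when only the
   denominator is 0. *)
Definition SINR (m : nat) (w : T) : \bar R :=
  (H m w * ell (enorm (Y m w)))%:E /
  (\sum_(0 <= j <oo | j != m) (H j w * ell (enorm (Y j w)))%:E + noise%:E).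

Definition coverage_probability : \bar R :=
  (1 - p)%:E * \sum_(0 <= m <oo)
    P [set w | theta%:E < SINR m w /\
               forall j, j != m -> (enorm (Y m w) < enorm (Y j w))%R].

End coverage.

End network.

(* Only the values of ell on (0, +oo) matter. *)
Definition path_loss (ell : R -> R) : Prop :=
  [/\ measurable_fun (`]0%R, +oo[ : set R) ell,
      forall r, (0 < r)%R -> (0 <= ell r)%R &
      forall eps, (0 < eps)%R ->
        \int[lebesgue_measure]_(r in `]eps, +oo[) (ell r * r ^+ n.-1)%:E < +oo].

Section coverage_formula.
Variables (lambda mu p : R) (Q : probability E R).
Variables (ell : R -> R) (noise theta : R).

Definition C_theta (y x : E) : R :=
  expR (- (p * mu * (1 - fine
    (\int[translate x Q]_(z in [set z | (enorm y < enorm z)%R])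
      ((1 + theta * (ell (enorm z) / ell (enorm y)))^-1)%:E)))).

Definition E_theta (y : E) : \bar R :=
  expeR (- (lambda%:E * \int[@lebesgue_rV R n]_w (1 - C_theta y w)%:E)).

Definition I1_theta (t : E) : \bar R :=
  \int[translate t Q]_y
    if ell (enorm y) == 0%R then 0 else
    (expR (- (theta * noise / ell (enorm y))) * C_theta y t)%:E * E_theta y.

Definition I2_theta (t : E) : \bar R :=
  lambda%:E * \int[@lebesgue_rV R n]_x \int[translate x Q]_y
    if ell (enorm y) == 0%R then 0 else
    (expR (- (theta * noise / ell (enorm y))) *
      C_theta y t * C_theta y x)%:E * E_theta y.

Definition reflection : set E -> \bar R := pushforward Q (fun x : E => (- x)%R).

End coverage_formula.

End point_processes.

(* Main.v *)
From HB Require Import structures.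
Require Import Defs.
From mathcomp Require Import all_boot all_order all_algebra.
From mathcomp Require Import finmap.
From mathcomp Require Import all_classical all_reals all_analysis.
From mathcomp Require Import measurable_realfun.
From mathcomp Require Import ring lra.

Set Implicit Arguments.
Unset Strict Implicit.
Unset Printing Implicit Defensive.

Import Order.TTheory GRing.Theory Num.Theory.
Import numFieldNormedType.Exports.

Local Open Scope classical_set_scope.
Local Open Scope ring_scope.


Section rV_measurability.
Context (R : realType) (n : nat).
Local Notation E := 'rV[R]_n.

Lemma measurable_coord (i : 'I_n) : measurable_fun [set: E] (fun x : E => x ord0 i).
Proof.
move=> _ A mA; apply: sub_sigma_algebra.
case: n i => [[] []//|m i].
rewrite -bigcup_mkord_ord; exists i; first exact: ltn_ord.
by exists A => //; rewrite inord_val.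
Qed.

Lemma measurable_fun_rV d (T : measurableType d) (f : T -> E) :
  (forall i, measurable_fun setT (fun x => f x ord0 i)) -> measurable_fun setT f.
Proof.
move=> mf; suff : g_sigma_preimage (fun (i : 'I_n) => fun x => f x ord0 i) `<=` measurable.
  have -> : (fun (i : 'I_n) => (fun x => f x ord0 i)) =
      (fun i => (fun x : E => x ord0 i) \o f) by [].
  by rewrite g_sigma_preimage_comp => H _ A mA; apply: H; exists A.
apply: smallest_sub; first exact: sigma_algebra_measurable.
case: n f mf => [|m] f mf; first by rewrite big_ord0.
rewrite -bigcup_mkord_ord; apply: bigcup_sub => i Ii.
by move=> A [B mB <-]; exact: mf.
Qed.

Lemma measurable_rV_add d (T : measurableType d) (f g : T -> E) :
  measurable_fun setT f -> measurable_fun setT g ->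
  measurable_fun setT (fun x => f x + g x).
Proof.
move=> mf mg; apply: measurable_fun_rV => i.
under eq_fun do rewrite mxE.
apply: measurable_funD.
- exact: measurableT_comp (measurable_coord i) mf.
- exact: measurableT_comp (measurable_coord i) mg.
Qed.

Lemma measurable_rV_opp d (T : measurableType d) (f : T -> E) :
  measurable_fun setT f -> measurable_fun setT (fun x => - f x).
Proof.
move=> mf; apply: measurable_fun_rV => i.
under eq_fun do rewrite mxE.
apply: measurable_funN.
exact: measurableT_comp (measurable_coord i) mf.
Qed.

Lemma measurable_rV_sub d (T : measurableType d) (f g : T -> E) :
  measurable_fun setT f -> measurable_fun setT g ->
  measurable_fun setT (fun x => f x - g x).
Proof. by move=> mf mg; apply: measurable_rV_add => //; exact: measurable_rV_opp. Qed.

Lemma measurable_enorm : measurable_fun setT (@enorm R n).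
Proof.
apply: (measurableT_comp (f := @Num.sqrt R)).
  by apply: continuous_measurable_fun; exact: sqrt_continuous.
apply: measurable_sum => i; apply: measurable_funX.
exact: measurable_coord.
Qed.

Lemma measurable_rV_set1 (a : E) : measurable [set a].
Proof.
have -> : [set a] = \bigcap_(i in [set: 'I_n]) ((fun x : E => x ord0 i) @^-1` [set a ord0 i]).
  apply/seteqP; split => [x -> i _//|x xa].
  by apply/rowP => i; exact: xa.
apply: fin_bigcap_measurable => // i _.
by rewrite -[X in measurable X]setTI; apply: measurable_coord.
Qed.

Lemma enorm_ge0 (x : E) : 0 <= enorm x.
Proof. exact: sqrtr_ge0. Qed.

Lemma enorm_eq0 (x : E) : enorm x = 0 -> x = 0.
Proof.
move=> /eqP; rewrite /enorm sqrtr_eq0 => s0; apply/rowP => i; rewrite mxE.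
have : \sum_(j < n) x ord0 j ^+ 2 == 0.
  by rewrite eq_le s0 sumr_ge0// => j _; exact: sqr_ge0.
rewrite psumr_eq0; last by move=> j _; exact: sqr_ge0.
by move=> /allP/(_ i (mem_index_enum _)); rewrite sqrf_eq0 => /eqP.
Qed.

Lemma enorm0 : enorm (0 : E) = 0.
Proof. by rewrite /enorm big1 ?sqrtr0// => i _; rewrite mxE expr0n. Qed.
End rV_measurability.

Section image_measure.
Context d d' (T1 : measurableType d) (T2 : measurableType d') (R : realType).
Variables (m : {measure set T1 -> \bar R}) (f : T1 -> T2).

Definition image_measure (mf : measurable_fun [set: T1] f) :
    {measure set T2 -> \bar R} :=
  measure_function_pushforward__canonical__measure_function_Measure m mf.

End image_measure.

Section sigma_finite_pack.
Context d (T : measurableType d) (R : realType).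
Variables (m : {measure set T -> \bar R}) (sf : sigma_finite setT m).

Let m' (_ : sigma_finite setT m) : set T -> \bar R := m.

HB.instance Definition _ := Measure.copy (m' sf) m.

HB.instance Definition _ := Measure_isSigmaFinite.Build _ _ _ (m' sf) sf.

Lemma sigma_finite_pack :
  exists m' : {sigma_finite_measure set T -> \bar R}, m = m' :> (set T -> \bar R).
Proof. by exists [the {sigma_finite_measure set T -> \bar R} of m' sf]. Qed.

End sigma_finite_pack.

Section lebesgue_rV_measure.
Context (R : realType).
Local Open Scope ereal_scope.

Lemma lebesgue_measure_shift (c : R) (A : set R) : measurable A ->
  pushforward lebesgue_measure (fun x => x + c : measurableTypeR R)%R A = lebesgue_measure A.
Proof.
have mc : measurable_fun setT (fun x : measurableTypeR R => x + c : measurableTypeR R)%R by apply: measurable_funD.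
move=> mA; apply/esym.
apply: (@lebesgue_measure_unique _ (image_measure lebesgue_measure mc)) => //= _ [[a b]] _ <-.
rewrite /pushforward/=.
have -> : (fun x : R => x + c)%R @^-1` [set` `]a, b]] = [set` `]a - c, b - c]%R].
  by apply/seteqP; split=> x; rewrite /= !in_itv/= ltrBlDr lerBrDr.
by rewrite !lebesgue_measure_itv/= !lte_fin ltrD2r -!EFinB opprB addrA subrK.
Qed.

Definition rV_cons n (z : R * 'rV[R]_n) : 'rV[R]_n.+1 :=
  row_mx z.1%:M z.2.

Lemma rV_cons0 n z : @rV_cons n z ord0 ord0 = z.1.
Proof.
have <- : lshift n (ord0 : 'I_1) = (ord0 : 'I_n.+1) by apply: val_inj.
by have := row_mxEl z.1%:M z.2 ord0 ord0; rewrite [X in _ = X -> _]mxE eqxx mulr1n.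
Qed.

Lemma rV_consS n z i : @rV_cons n z ord0 (lift ord0 i) = z.2 ord0 i.
Proof.
have <- : rshift 1 i = lift ord0 i by apply: val_inj.
exact: row_mxEr z.1%:M z.2 ord0 i.
Qed.

Lemma measurable_rV_cons n : measurable_fun setT (@rV_cons n).
Proof.
apply: measurable_fun_rV => i; case: (unliftP ord0 i) => [j|] ->.
  under eq_fun do rewrite rV_consS.
  exact: (measurableT_comp (measurable_coord j) measurable_snd).
under eq_fun do rewrite rV_cons0.
exact: measurable_fst.
Qed.

Definition cube_rV n (r : R) : set 'rV[R]_n :=
  [set x | forall i, (- r <= x ord0 i <= r)%R].

Lemma measurable_cube_rV n r : measurable (@cube_rV n r).
Proof.
have -> : @cube_rV n r = \bigcap_(i in [set: 'I_n])
    ((fun x : 'rV[R]_n => x ord0 i) @^-1` `[- r, r]%classic)%R.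
  apply/seteqP; split => [x xa i _/=|x xa i].
    by rewrite in_itv/=.
  by have := xa i I; rewrite /= in_itv.
apply: fin_bigcap_measurable => // i _.
by rewrite -[X in measurable X]setTI; apply: measurable_coord.
Qed.

Lemma cube_rV_homo n r s : (r <= s)%R -> @cube_rV n r `<=` @cube_rV n s.
Proof.
move=> rs x xr i; have /andP[h1 h2] := xr i.
by rewrite (le_trans h2)// andbT (le_trans _ h1)// lerN2.
Qed.

Lemma cube_rV_cover n : \bigcup_k @cube_rV n k%:R = setT.
Proof.
apply/seteqP; split => // x _.
exists (Num.truncn (\sum_(i < n) `|x ord0 i|)).+1 => //= i.
rewrite -ler_norml (le_trans _ (ltW (truncnS_gt _)))//.
by rewrite (bigD1 i)//= lerDl sumr_ge0.
Qed.

Lemma lebesgue_cube_rV_lty n r : (0 <= r)%R -> lebesgue_rV (@cube_rV n r) < +oo.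
Proof.
move=> r0; have /(_ n (const_mx (- r)%R) (const_mx r)) := @lebesgue_rV_box R.
rewrite (_ : [set x | _] = @cube_rV n r); last first.
  by apply/seteqP; split => x h i; have := h i; rewrite !mxE.
by move=> ->; rewrite ?ltry// => i; rewrite !mxE lerNl (le_trans _ r0)// oppr_le0.
Qed.

Lemma lebesgue_rV_is_measure n :
  exists m : {sigma_finite_measure set 'rV[R]_n -> \bar R},
    @lebesgue_rV R n = m.
Proof.
elim: n => [|n [m mE]].
  by exists [the {sigma_finite_measure set 'rV[R]_0 -> \bar R} of \d_(0%R : 'rV[R]_0)].
have E : @lebesgue_rV R n.+1 = image_measure (lebesgue_measure \x m)%E (@measurable_rV_cons n).
  by apply/funext => A /=; rewrite /pushforward mE.
have sf : sigma_finite setT (image_measure (lebesgue_measure \x m)%E (@measurable_rV_cons n)).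
  exists (fun k => @cube_rV n.+1 k%:R); first by rewrite cube_rV_cover.
  move=> k; split; first exact: measurable_cube_rV.
  by rewrite -E lebesgue_cube_rV_lty.
by have [sm smE] := sigma_finite_pack sf; exists sm; rewrite E.
Qed.

Lemma lebesgue_rV_shift n (c : 'rV[R]_n) (A : set 'rV[R]_n) : measurable A ->
  lebesgue_rV ((fun x => x + c)%R @^-1` A) = lebesgue_rV A.
Proof.
elim: n c A => [|n IH] c A mA.
  have -> // : (fun x => x + c)%R @^-1` A = A.
  apply/seteqP; split => x /=; have -> : (x + c = x)%R by apply/rowP => -[].
    by [].
  by [].
have [m mE] := lebesgue_rV_is_measure n.
rewrite /= /pushforward mE.
pose B := @rV_cons n @^-1` A.
have mB : measurable B.
  by rewrite -[X in measurable X]setTI; exact: measurable_rV_cons.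
pose c' := (\row_i c ord0 (lift ord0 i))%R.
have sE x v : (rV_cons (x, v) + c = rV_cons (x + c ord0 ord0, v + c'))%R.
  apply/rowP => i; rewrite mxE; case: (unliftP ord0 i) => [j|] ->.
    by rewrite !rV_consS/= !mxE.
  by rewrite !rV_cons0.
transitivity (\int[lebesgue_measure]_x m (xsection B (x + c ord0 ord0)%R)).
  apply: eq_integral => x _ /=.
  have mx : measurable (xsection B (x + c ord0 ord0)%R) by exact: measurable_xsection.
  rewrite -mE -(IH c' _ mx); congr lebesgue_rV.
  by apply/seteqP; split => v; rewrite /xsection /= !inE /= -/(rV_cons (_, _)) sE.
pose f x := m (xsection B x).
have mf : measurable_fun setT f by exact: measurable_fun_xsection.
have mc : measurable_fun setT (fun x : measurableTypeR R => x + c ord0 ord0 : measurableTypeR R)%R.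
  by apply: measurable_funD.
have /= <- := @ge0_integral_pushforward _ _ _ _ _ _ mc lebesgue_measure setT f measurableT mf (fun _ _ => measure_ge0 _ _).
apply: eq_measure_integral => D mD _; exact: lebesgue_measure_shift.
Qed.

Lemma lebesgue_unit_cube n : lebesgue_rV (@unit_cube R n) = 1.
Proof.
have /(_ n (const_mx 0%R) (const_mx 1%R)) := @lebesgue_rV_box R.
rewrite (_ : [set x | _] = @unit_cube R n); last first.
  by apply/seteqP; split => x h i; have := h i; rewrite !mxE.
by move=> ->; [rewrite big1// => i _|move=> i]; rewrite !mxE ?subr0.
Qed.

Lemma measurable_unit_cube n : measurable (@unit_cube R n).
Proof.
have -> : @unit_cube R n = \bigcap_(i in [set: 'I_n])
    ((fun x : 'rV[R]_n => x ord0 i) @^-1` `[0, 1]%classic)%R.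
  apply/seteqP; split => [x xa i _/=|x xa i].
    by rewrite in_itv/=.
  by have := xa i I; rewrite /= in_itv.
apply: fin_bigcap_measurable => // i _.
by rewrite -[X in measurable X]setTI; apply: measurable_coord.
Qed.

End lebesgue_rV_measure.

Section grouping.
Context d (T : measurableType d) (R : realType) (P : probability T R).
Context (I : choiceType) (G : I -> set (set T)).
Hypothesis sG : forall i, sigma_algebra setT (G i).
Hypothesis mG : forall i, G i `<=` measurable.
Hypothesis indG : mutually_independent P G.
Local Open Scope ereal_scope.

Let cylinders (K : set I) : set (set T) :=
  [set A | exists (J : {fset I}) (F : I -> set T),
    [/\ forall i, i \in J -> K i, forall i, G i (F i) &
        A = \bigcap_(i in [set` J]) F i] ].

Let GT i : G i setT.
Proof. by have [h0 hC _] := sG i; have := hC _ h0; rewrite setD0. Qed.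

Let GI i A B : G i A -> G i B -> G i (A `&` B).
Proof.
have /sigma_algebraP := sG i; case=> // _ _ _; exact.
Qed.

Let setI_cylinders K : setI_closed (cylinders K).
Proof.
move=> _ _ [J1 [F1 [JK1 GF1 ->]]] [J2 [F2 [JK2 GF2 ->]]].
exists (J1 `|` J2)%fset.
exists (fun i => (if i \in J1 then F1 i else setT) `&` (if i \in J2 then F2 i else setT)).
split.
- by move=> i; rewrite inE => /orP[/JK1|/JK2].
- by move=> i; apply: GI; case: ifP.
- apply/seteqP; split => x.
    by move=> [x1 x2] i /= iJ; split; case: ifPn => // h; [exact: x1|exact: x2].
  move=> h; split => i /= iJ; have := h i; rewrite /= inE iJ ?orbT => /(_ isT).
    by case.
  by case.
Qed.

Let sub_cylinders K : \bigcup_(i in K) G i `<=` cylinders K.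
Proof.
move=> A [i Ki GA]; exists [fset i]%fset.
exists (fun j => if pselect (j = i) is left _ then A else setT); split.
- by move=> j; rewrite inE => /eqP ->.
- by move=> j; case: pselect => // ->.
- apply/seteqP; split => x.
    by move=> Ax j /=; case: pselect.
  by move=> /(_ i) /=; rewrite inE eqxx => /(_ isT); case: pselect.
Qed.

Let measurable_cylinders K : cylinders K `<=` measurable.
Proof.
move=> _ [J [F [_ GF ->]]]; apply: fin_bigcap_measurable.
  exact: finite_fset.
by move=> i _; exact/mG.
Qed.

Lemma independent_grouping (K : set I) (k : I) (A B : set T) : ~ K k ->
  <<s \bigcup_(i in K) G i >> A -> G k B -> P (A `&` B) = P A * P B.
Proof.
move=> Kk sA GB; have mB := mG GB.
have sA' : <<s cylinders K >> A by apply: sub_sigma_algebra2 sA; exact: sub_cylinders.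
have PB : (0 <= fine (P B))%R by rewrite fine_ge0.
pose m2 : {measure set T -> \bar R} := mscale (NngNum PB) P.
have m2E X : m2 X = P X * P B.
  rewrite /m2 /= /mscale/= muleC fineK//; exact: fin_num_measure.
rewrite -m2E -[LHS]/(mrestr P mB A).
apply: (@g_sigma_algebra_measure_unique _ _ _ (cylinders K) _ (fun=> setT)) sA' => //.
- move=> _; exists fset0, (fun=> setT); split => //.
  by apply/seteqP; split.
- by apply/seteqP; split => // x _; exists 0%N.
- move=> _ [J [F [JK GF ->]]]; rewrite m2E -[LHS]/(P (\bigcap_(i in [set` J]) F i `&` B)).
  have kJ : k \notin J by apply/negP => /JK.
  pose F' i := if i \in J then F i else B.
  have -> : \bigcap_(i in [set` J]) F i `&` B = \bigcap_(i in [set` (k |` J)%fset]) F' i.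
    apply/seteqP; split => x.
      move=> [h Bx] i /=; rewrite /F'; case: ifPn => // iJ _; exact: h.
    move=> h; split => [i /= iJ|].
      by have := h i; rewrite /F' /= in_fset1U iJ orbT; exact.
    by have := h k; rewrite /F' (negbTE kJ) /= in_fset1U eqxx; exact.
  rewrite indG; last first.
    by move=> i; rewrite /F' in_fset1U; case: ifPn => // iJ; rewrite orbF => /eqP ->.
  rewrite big_fsetU1//= {1}/F' (negbTE kJ) muleC; congr (_ * _).
  rewrite indG; last by move=> i _; exact: GF.
  by rewrite big_seq [RHS]big_seq; apply: eq_bigr => i iJ; rewrite /F' iJ.
- move=> _; rewrite -[X in X < _]/(P (setT `&` B)) setTI -ge0_fin_numE//.
  exact: fin_num_measure.
Qed.

Lemma mutually_independent_inj (J : choiceType) (f : J -> I) : injective f ->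
  mutually_independent P (G \o f).
Proof.
move=> fI J0 A GA.
pose g i := if pselect (exists j, f j = i) is left e then A (projT1 (cid e)) else setT.
have gf j : g (f j) = A j.
  rewrite /g; case: pselect => [e|]; last by case; exists j.
  by case: cid => j' /= /fI ->.
have := @indG [fset f x | x in J0]%fset g.
rewrite big_imfset/=; last by move=> x y _ _ /fI.
under eq_bigr do rewrite gf.
move=> <-; last by move=> i /imfsetP[j /= jJ ->]; rewrite gf; exact: GA.
congr (P _); apply/seteqP; split => x h i /=.
  by move=> /imfsetP[j /= jJ ->]; rewrite gf; exact: h.
by move=> iJ; rewrite -gf; apply: h; apply/imfsetP; exists i.
Qed.

End grouping.

Section diagonal.
Context d (T : measurableType d) (R : realType) (P : probability T R).
Variables (G1 G2 : set (set T)).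
Hypotheses (sG1 : sigma_algebra setT G1) (sG2 : sigma_algebra setT G2).
Hypotheses (mG1 : G1 `<=` measurable) (mG2 : G2 `<=` measurable).
Hypothesis indG : forall A B, G1 A -> G2 B -> P (A `&` B) = (P A * P B)%E.
Local Open Scope ereal_scope.
Local Notation T1 := (g_sigma_algebraType G1).
Local Notation T2 := (g_sigma_algebraType G2).

Lemma measurable_id_sub (G : set (set T)) : sigma_algebra setT G -> G `<=` measurable ->
  measurable_fun setT (fun w : T => w : g_sigma_algebraType G).
Proof.
move=> sG mG _ A mA; rewrite setTI; apply: mG.
by move: mA; rewrite /measurable/= sigma_algebra_id.
Qed.

Let m1 := measurable_id_sub sG1 mG1.
Let m2 := measurable_id_sub sG2 mG2.

Let fin_sub (G : set (set T)) (m : measurable_fun setT (fun w : T => w : g_sigma_algebraType G)) :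
  sigma_finite setT (image_measure P m).
Proof.
exists (fun=> setT); first by rewrite bigcup_const.
by move=> _; split => //=; rewrite /pushforward/= preimage_setT probability_setT ltry.
Qed.

Lemma integral_diagonal (phi : T1 * T2 -> \bar R) :
  measurable_fun setT phi -> (forall z, 0 <= phi z) ->
  \int[P]_w phi (w, w) = \int[P]_w \int[P]_w' phi (w, w').
Proof.
move=> mphi phi0.
have [P1 P1E] := sigma_finite_pack (fin_sub m1).
have [P2 P2E] := sigma_finite_pack (fin_sub m2).
have md : measurable_fun setT (fun w : T => (w, w) : T1 * T2).
  exact: measurable_fun_pair.
transitivity (\int[P1 \x P2]_z phi z).
  have := @ge0_integral_pushforward _ _ _ _ _ _ md P setT phi measurableT mphi (fun _ _ => phi0 _).
  rewrite preimage_setT => <-.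
  apply: eq_measure_integral => D mD _.
  rewrite -(@product_measure_unique _ _ _ _ _ P1 P2 (image_measure P md))// => A B mA mB.
  rewrite /= -P1E -P2E /= /pushforward/= !preimage_id -indG//.
  - by move: mA; rewrite /measurable/= sigma_algebra_id.
  - by move: mB; rewrite /measurable/= sigma_algebra_id.
rewrite fubini_tonelli1// /fubini_F/= -P1E -P2E.
rewrite (@ge0_integral_pushforward _ _ _ _ _ _ m1 P)//; last 2 first.
- rewrite P2E; exact: measurable_fun_fubini_tonelli_F.
- by move=> w _; exact: integral_ge0.
rewrite preimage_setT; apply: eq_integral => w _ /=.
rewrite (@ge0_integral_pushforward _ _ _ _ _ _ m2 P)//.
exact: measurableT_comp.
Qed.

End diagonal.

Section expeN.
Context (R : realType).
Local Open Scope ereal_scope.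
Implicit Types x y : \bar R.

Definition expeN x : \bar R := expeR (- x).

Lemma expeN_ge0 x : 0 <= expeN x. Proof. exact: expeR_ge0. Qed.

Lemma expeN0 : expeN 0 = 1. Proof. by rewrite /expeN oppe0 expeR0. Qed.

Lemma expeNy : expeN +oo = 0. Proof. by []. Qed.

Lemma le_expeN x y : (expeN x <= expeN y) = (y <= x).
Proof. by rewrite /expeN lee_expeR leeN2. Qed.

Lemma expeN_le1 x : 0 <= x -> expeN x <= 1.
Proof. by rewrite -expeN0 le_expeN. Qed.

Lemma expeN_fin_num x : 0 <= x -> expeN x \is a fin_num.
Proof.
move=> x0; rewrite ge0_fin_numE ?expeN_ge0//.
by rewrite (le_lt_trans (expeN_le1 x0))// ltry.
Qed.

Lemma expeND x y : 0 <= x -> 0 <= y -> expeN (x + y) = expeN x * expeN y.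
Proof. by move=> x0 y0; rewrite /expeN oppeD ?ge0_adde_def// expeRD. Qed.

Lemma expeN_sum (I : Type) (s : seq I) (p : pred I) (f : I -> \bar R) :
  (forall i, 0 <= f i) ->
  expeN (\sum_(i <- s | p i) f i) = \prod_(i <- s | p i) expeN (f i).
Proof.
move=> f0; elim: s => [|a s IH]; first by rewrite !big_nil expeN0.
by rewrite !big_cons; case: ifP => // _; rewrite expeND ?sume_ge0// IH.
Qed.

Lemma measurable_expeN : measurable_fun setT expeN.
Proof.
rewrite (_ : expeN = fun x : \bar R => if x == +oo then 0 else
    if x == -oo then +oo else (expR (- fine x))%:E); last first.
  by apply/funext => -[].
apply: measurable_fun_ifT => //.
  by apply: (measurable_fun_bool true); rewrite setTI /=;
    rewrite (_ : _ @^-1` _ = [set +oo]) //; apply/seteqP; split => x /= /eqP.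
apply: measurable_fun_ifT => //.
  by apply: (measurable_fun_bool true); rewrite setTI /=;
    rewrite (_ : _ @^-1` _ = [set -oo]) //; apply/seteqP; split => x /= /eqP.
apply/measurable_EFinP; apply: measurableT_comp => //.
apply: measurable_funN; exact: fine_measurable.
Qed.

Lemma cvg_expeN (f : (\bar R)^nat) l : (forall n, 0 <= f n) ->
  f @ \oo --> l -> expeN \o f @ \oo --> expeN l.
Proof.
move=> f0 fl; have l0 : 0 <= l.
  rewrite -(cvg_lim _ fl)//; apply: lime_ge; first by apply/cvg_ex; exists l.
  exact: nearW.
case: l l0 fl => // [r r0 /fine_cvgP[ffin fr]|_ fy].
  apply/fine_cvgP; split; first by apply: nearW => n; exact: expeN_fin_num.
  have : expR (- fine (f n)) @[n --> \oo] --> expR (- r).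
    apply: continuous_cvg; first exact: continuous_expR.
    exact: cvgN.
  apply: cvg_trans; apply: near_eq_cvg.
  near=> n => /=; have fn : f n \is a fin_num by near: n.
  by case: (f n) fn.
apply/fine_cvgP; split; first by apply: nearW => n; exact: expeN_fin_num.
apply/cvgrPdist_le => e e0; near=> n; rewrite sub0r normrN /=.
rewrite ger0_norm ?fine_ge0 ?expeN_ge0//.
rewrite -lee_fin fineK ?expeN_fin_num//.
have -> : e%:E = expeN (- ln e)%:E by rewrite /expeN /= opprK lnK.
rewrite le_expeN; near: n; by move/cvgeyPge : fy; apply.
Unshelve. all: by end_near. Qed.

Lemma expeN_ereal_fine x : (0 <= x)%E -> (fine (expeN x))%:E = expeN x.
Proof. by move=> x0; rewrite fineK// expeN_fin_num. Qed.

(* c(1 - e^{-x/c}) for c = 2^n *)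
Definition qexp n x : \bar R := (2 ^+ n)%:E * (1 - expeN ((2 ^- n)%:E * x)).

Let c_gt0 n : (0 < 2 ^+ n :> R)%R. Proof. by rewrite exprn_gt0. Qed.
Let ic_ge0 n : 0 <= ((2 ^- n)%:E : \bar R). Proof. by rewrite lee_fin invr_ge0 ltW. Qed.

Lemma qexp_ge0 n x : 0 <= x -> 0 <= qexp n x.
Proof.
move=> x0; apply: mule_ge0; first by rewrite lee_fin ltW.
by rewrite sube_ge0 ?expeN_fin_num ?mule_ge0// expeN_le1// mule_ge0.
Qed.

Lemma le_qexp n x y : 0 <= x -> x <= y -> qexp n x <= qexp n y.
Proof.
move=> x0 xy; apply: lee_wpmul2l; first by rewrite lee_fin ltW.
by apply: leeB => //; rewrite le_expeN lee_wpmul2l.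
Qed.

Lemma qexp_fin n (r : R) : qexp n r%:E = (2 ^+ n * (1 - expR (- (2 ^- n * r))))%:E.
Proof. by []. Qed.

Lemma qexpy n : qexp n +oo = (2 ^+ n)%:E.
Proof.
by rewrite /qexp mulry gtr0_sg ?invr_gt0// mul1e expeNy oppe0 adde0 mule1.
Qed.

Lemma qexpS n x : 0 <= x -> qexp n x <= qexp n.+1 x.
Proof.
case: x => // [r|_]; last by rewrite !qexpy lee_fin ler_eXn2l// ltr1n.
move=> _; rewrite !qexp_fin lee_fin.
set a := expR (- (2 ^- n.+1 * r)).
have -> : expR (- (2 ^- n * r)) = (a ^+ 2)%R.
  rewrite /a -expRM_natl; congr expR.
  by rewrite exprS invfM mulrN !mulrA mulfV// mul1r.
rewrite (exprS _ n) -mulrA mulrCA ler_pM2l//.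
have := sqr_ge0 (a - 1)%R; lra.
Qed.

Lemma qexp_le n x : 0 <= x -> qexp n x <= x.
Proof.
case: x => // [r|_]; last by rewrite leey.
move=> r0; rewrite qexp_fin lee_fin.
have := expR_ge1Dx (- (2 ^- n * r)).
set e := expR _ => h.
rewrite -[leRHS](mulVKf (lt0r_neq0 (c_gt0 n))) ler_pM2l//; lra.
Qed.

Lemma nd_qexp m n x : (m <= n)%N -> 0 <= x -> qexp m x <= qexp n x.
Proof.
move=> mn x0; elim: n mn => [|n IH]; first by rewrite leqn0 => /eqP ->.
by rewrite leq_eqVlt ltnS => /predU1P[->//|/IH h]; rewrite (le_trans h)// qexpS.
Qed.

Let cvg_pow2 : (2 ^- n : R)%R @[n --> \oo] --> (0 : R)%R.
Proof.
have -> : (fun n => 2 ^- n : R)%R = (fun n => (2^-1 : R) ^+ n)%R.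
  by apply/funext => n; rewrite exprVn.
apply: cvg_expr; rewrite ger0_norm ?invr_ge0//; lra.
Qed.

Lemma cvg_qexp_cst x : 0 <= x -> qexp n x @[n --> \oo] --> x.
Proof.
case: x => // [r r0|_]; last first.
  apply/cvgeyPge => A.
  have p0 : (0 < (`|A| + 1)^-1 :> R)%R by rewrite invr_gt0 ltr_wpDl.
  have N : \forall n \near \oo, (2 ^- n <= (`|A| + 1)^-1 :> R)%R.
    move/cvgrPdist_le : cvg_pow2 => /(_ _ p0); apply: filterS => n.
    by rewrite sub0r normrN; exact: le_trans (ler_norm _).
  near=> n; rewrite qexpy lee_fin.
  have h : (2 ^- n <= (`|A| + 1)^-1 :> R)%R by near: n.
  rewrite lef_pV2 ?posrE ?c_gt0 ?ltr_wpDl// in h.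
  by rewrite (le_trans (ler_norm _))// (le_trans _ h)// lerDl.
rewrite lee_fin in r0.
apply: (@squeeze_cvge _ _ _ _ (fun n => (r / (1 + 2 ^- n * r))%:E) _ (fun=> r%:E)).
- near=> n; rewrite qexp_le// andbT qexp_fin lee_fin.
  have t0 : (0 <= 2 ^- n * r)%R by rewrite mulr_ge0// invr_ge0 ltW.
  set t := (2 ^- n * r)%R in t0 *.
  have rE : r = (2 ^+ n * t)%R by rewrite mulVKf// lt0r_neq0.
  rewrite {1}rE -mulrA ler_pM2l// expRN.
  have h := expR_ge1Dx t; have t1 : (0 < 1 + t)%R by rewrite ltr_wpDr.
  have : ((expR t)^-1 <= (1 + t)^-1)%R by rewrite lef_pV2// posrE expR_gt0.
  have -> : (t / (1 + t) = 1 - (1 + t)^-1)%R by field; rewrite gt_eqF.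
  lra.
- apply: cvg_EFin; first by near=> n.
  rewrite -[X in _ --> X]divr1; apply: cvgM; first exact: cvg_cst.
  apply: cvgV => //; rewrite -[X in _ --> X]addr0; apply: cvgD; first exact: cvg_cst.
  by rewrite -(mul0r r); apply: cvgMl.
- exact: cvg_cst.
Unshelve. all: by end_near. Qed.

Lemma cvg_qexp (D : (\bar R)^nat) (l : \bar R) : (forall n, 0 <= D n) ->
  nondecreasing_seq D -> D @ \oo --> l -> qexp n (D n) @[n --> \oo] --> l.
Proof.
move=> D0 ndD Dl.
have ndq : nondecreasing_seq (fun n => qexp n (D n)).
  by move=> m n mn; rewrite (le_trans (nd_qexp mn (D0 m)))// le_qexp// ndD.
have cq := ereal_nondecreasing_is_cvgn ndq.
suff <- : limn (fun n => qexp n (D n)) = l by [].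
have lE : l = limn D by rewrite (cvg_lim _ Dl).
have cD : cvgn D by apply/cvg_ex; exists l.
apply/eqP; rewrite eq_le; apply/andP; split.
  by rewrite lE; apply: lee_lim => //; apply: nearW => n; exact: qexp_le.
rewrite lE; apply: lime_le => //; apply: nearW => m.
rewrite -(cvg_lim (@ereal_hausdorff R) (cvg_qexp_cst (D0 m))).
apply: lee_lim => //; first by apply/cvg_ex; exists (D m); exact: cvg_qexp_cst.
by near=> n; apply: le_qexp => //; apply: ndD; near: n; exists m.
Unshelve. all: by end_near. Qed.

Lemma measurable_qexp n : measurable_fun setT (qexp n).
Proof.
apply: measurable_funeM; apply: emeasurable_funB; first exact: measurable_cst.
apply: (measurableT_comp measurable_expeN).
exact: measurable_funeM.
Qed.

Lemma cvg_integral_qexp d (T : measurableType d) (m : {measure set T -> \bar R})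
    (w : T -> \bar R) (D : nat -> T -> \bar R) (L : T -> \bar R) :
  measurable_fun setT w -> (forall t, 0 <= w t) -> (forall t, w t \is a fin_num) ->
  (forall n, measurable_fun setT (D n)) -> (forall n t, 0 <= D n t) ->
  (forall t, nondecreasing_seq (D ^~ t)) -> (forall t, D ^~ t @ \oo --> L t) ->
  \int[m]_t (w t * qexp n (D n t)) @[n --> \oo] --> \int[m]_t (w t * L t).
Proof.
move=> mw w0 wfin mD D0 ndD DL.
have -> : \int[m]_t (w t * L t) = \int[m]_t limn (fun n => w t * qexp n (D n t)).
  apply: eq_integral => t _; apply/esym/cvg_lim => //.
  by apply: cvgeZl => //; exact: cvg_qexp.
apply: cvg_monotone_convergence => //.
- move=> n; apply: emeasurable_funM => //.
  exact: (measurableT_comp (measurable_qexp n)).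
- by move=> n t _; rewrite mule_ge0// qexp_ge0.
- move=> t _ a b ab; apply: lee_wpmul2l => //.
  by rewrite (le_trans (nd_qexp ab (D0 a t)))// le_qexp// ndD.
Qed.

Lemma expeN_qexp n x : 0 <= x -> 1 = expeN ((2 ^- n)%:E * x) + (2 ^- n)%:E * qexp n x.
Proof.
move=> x0; rewrite /qexp muleA -EFinM mulVf ?lt0r_neq0// mul1e.
by rewrite addeCA subee ?adde0// expeN_fin_num// mule_ge0.
Qed.

End expeN.

Lemma ge0_dominated_cvg d (T : measurableType d) (R : realType)
    (m : {measure set T -> \bar R}) (f_ : nat -> T -> \bar R) (f g : T -> \bar R) :
  (forall n, measurable_fun setT (f_ n)) -> measurable_fun setT f ->
  measurable_fun setT g -> (\int[m]_x g x < +oo)%E ->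
  (forall n x, 0 <= f_ n x <= g x)%E ->
  {ae m, forall x, f_ ^~ x @ \oo --> f x} ->
  (\int[m]_x f_ n x @[n --> \oo] --> \int[m]_x f x)%E.
Proof.
move=> mf_ mf mg ig f_g f_f.
have [] := @dominated_convergence _ _ _ m setT measurableT f_ f g mf_ mf.
- by apply: filterS f_f => x h _.
- apply/integrableP; split => //; under eq_integral => x _.
    rewrite gee0_abs; last first.
      by have /andP[h1 h2] := f_g 0%N x; exact: le_trans h1 h2.
    over.
  exact: ig.
- apply: aeW => x n _; have /andP[h1 h2] := f_g n x.
  by rewrite gee0_abs.
- by [].
Qed.

Lemma measurable_comp2 d d1 d2 d3 (T : measurableType d) (T1 : measurableType d1)
    (T2 : measurableType d2) (T3 : measurableType d3)
    (f : T1 * T2 -> T3) (g1 : T -> T1) (g2 : T -> T2) :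
  measurable_fun setT f -> measurable_fun setT g1 -> measurable_fun setT g2 ->
  measurable_fun setT (fun x => f (g1 x, g2 x)).
Proof.
move=> mf m1 m2; apply: (measurableT_comp mf (g := fun x => (g1 x, g2 x))).
exact: measurable_fun_pair.
Qed.

Section expeN_series.
Context (R : realType).
Local Open Scope ereal_scope.

Lemma cvg_expeN_series (u : (\bar R)^nat) : (forall n, 0 <= u n) ->
  expeN (\sum_(i < n) u i) @[n --> \oo] --> expeN (\sum_(i <oo) u i).
Proof.
move=> u0; apply: cvg_expeN; first by move=> n; exact: sume_ge0.
under eq_fun do rewrite -(big_mkord xpredT).
by apply: is_cvg_nneseries => n _ _; exact: u0.
Qed.

End expeN_series.

Section conditional_independence.
Context d (T : measurableType d) (R : realType) (P : probability T R).
Variable G : option nat -> set (set T).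
Hypothesis sG : forall i, sigma_algebra setT (G i).
Hypothesis mG : forall i, G i `<=` measurable.
Hypothesis indG : mutually_independent P G.
Local Open Scope ereal_scope.
Local Notation T0 := (g_sigma_algebraType (G None)).
Local Notation TS i := (g_sigma_algebraType (G (Some i))).

Lemma measurable_id_sub2 (G1 G2 : set (set T)) : sigma_algebra setT G1 -> G1 `<=` <<s G2 >> ->
  measurable_fun setT (fun w : g_sigma_algebraType G2 => w : g_sigma_algebraType G1).
Proof.
move=> sG1 mG12 _ A mA; rewrite setTI; apply: mG12.
by move: mA; rewrite /measurable/= sigma_algebra_id.
Qed.

Variables (psi : nat -> T -> T -> \bar R) (psib : nat -> T -> \bar R).
Hypothesis mpsi : forall i,
  measurable_fun setT (fun z : T0 * TS i => psi i z.1 z.2).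
Hypothesis mpsib : forall i, measurable_fun [set: T0] (psib i).
Hypothesis psi_ge0 : forall i w w', 0 <= psi i w w'.
Hypothesis psib_ge0 : forall i w, 0 <= psib i w.
Hypothesis psiE : forall i w, \int[P]_w' expeN (psi i w w') = expeN (psib i w).

Let past J : set (option nat) := [set o | if o is Some i then (i < J)%N else True].
Let GJ J := <<s \bigcup_(o in past J) G o >>.

Let sGJ J : sigma_algebra setT (GJ J). Proof. exact: smallest_sigma_algebra. Qed.

Let mGJ J : GJ J `<=` measurable.
Proof.
apply: smallest_sub; first exact: sigma_algebra_measurable.
by apply: bigcup_sub => o _; exact: mG.
Qed.

Let idGJ J o : past J o -> measurable_fun setT
  (fun w : g_sigma_algebraType (GJ J) => w : g_sigma_algebraType (G o)).
Proof.
move=> Jo; apply: measurable_id_sub2 => // A GA.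
by apply: sub_sigma_algebra; apply: sub_sigma_algebra; exists o.
Qed.

Let mid o := measurable_id_sub (sG o) (@mG o).

Let mpsi_diag i : measurable_fun setT (fun w : T => psi i w w).
Proof.
exact: (measurable_comp2 (@mpsi i) (@mid None) (@mid (Some i))).
Qed.

Let mpsib_T i : measurable_fun [set: T] (psib i).
Proof. exact: (measurableT_comp (@mpsib i) (@mid None)). Qed.

Lemma integral_discount_finite J (g : T -> \bar R) :
  measurable_fun [set: T0] g -> (forall w, 0 <= g w) ->
  \int[P]_w (g w * expeN (\sum_(i < J) psi i w w)) =
  \int[P]_w (g w * expeN (\sum_(i < J) psib i w)).
Proof.
elim: J g => [|J IH] g mg g0.
  by apply: eq_integral => w _; rewrite !big_ord0.
pose U := g_sigma_algebraType (GJ J).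
have mgU : measurable_fun [set: U] g.
  exact: (measurableT_comp mg (@idGJ J None I)).
have mEU : measurable_fun [set: U] (fun w => expeN (\sum_(i < J) psi i w w)).
  apply: (measurableT_comp (@measurable_expeN R)).
  rewrite (_ : (fun w => _) = (fun w => \sum_(i <- index_enum 'I_J) psi i w w))//.
  apply: emeasurable_sum => i.
  exact: (measurable_comp2 (@mpsi i) (@idGJ J None I) (@idGJ J (Some (val i)) (ltn_ord i))).
pose phi (z : U * TS J) := g z.1 * expeN (\sum_(i < J) psi i z.1 z.1) * expeN (psi J z.1 z.2).
have mphi : measurable_fun setT phi.
  apply: emeasurable_funM; first apply: emeasurable_funM.
  - exact: (measurableT_comp mgU measurable_fst).
  - exact: (measurableT_comp mEU measurable_fst).
  - apply: (measurableT_comp (@measurable_expeN R)).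
    apply: (measurable_comp2 (@mpsi J)).
      exact: (measurableT_comp (@idGJ J None I) measurable_fst).
    exact: measurable_snd.
have phi0 z : 0 <= phi z by rewrite /phi !mule_ge0// expeN_ge0.
transitivity (\int[P]_w phi (w, w)).
  apply: eq_integral => w _; rewrite /phi /= big_ord_recr/= expeND ?muleA//.
  by apply: sume_ge0.
rewrite (integral_diagonal (@sGJ J) (sG (Some J)) (@mGJ J) (@mG (Some J)))//; last first.
  by move=> A B GA GB; apply: (independent_grouping sG mG indG _ GA GB); rewrite /past/= ltnn.
transitivity (\int[P]_w (g w * expeN (psib J w) * expeN (\sum_(i < J) psi i w w))).
  apply: eq_integral => w _; rewrite /phi /= ge0_integralZl//.
  - by rewrite psiE muleAC.
  - apply: (measurableT_comp (@measurable_expeN R)).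
    exact: (measurable_comp2 (@mpsi J) (measurable_cst (w : T0)) (@mid (Some J))).
  - by move=> w' _; exact: expeN_ge0.
  - by rewrite mule_ge0// expeN_ge0.
rewrite IH; last 2 first.
- apply: emeasurable_funM => //.
  exact: (measurableT_comp (@measurable_expeN R)).
- by move=> w; rewrite mule_ge0// expeN_ge0.
apply: eq_integral => w _; rewrite big_ord_recr/= expeND ?sume_ge0//.
by rewrite -muleA [in RHS](muleC (expeN (\sum_(_ < _) _))).
Qed.

Lemma integral_discount (g : T -> \bar R) :
  measurable_fun [set: T0] g -> (forall w, 0 <= g w <= 1) ->
  \int[P]_w (g w * expeN (\sum_(i <oo) psi i w w)) =
  \int[P]_w (g w * expeN (\sum_(i <oo) psib i w)).
Proof.
move=> mg g01.
have g0 w : 0 <= g w by have /andP[] := g01 w.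
have gfin w : g w \is a fin_num.
  by rewrite ge0_fin_numE//; have /andP[_ h] := g01 w; rewrite (le_lt_trans h)// ltry.
have mgT : measurable_fun [set: T] g := measurableT_comp mg (@mid None).
have main (f : nat -> T -> \bar R) : (forall i w, 0 <= f i w) ->
    (forall i, measurable_fun [set: T] (f i)) ->
    \int[P]_w (g w * expeN (\sum_(i < J) f i w)) @[J --> \oo] -->
    \int[P]_w (g w * expeN (\sum_(i <oo) f i w)).
  move=> f0 mf.
  have mfJ J : measurable_fun [set: T] (fun w => g w * expeN (\sum_(i < J) f i w)).
    apply: emeasurable_funM => //.
    apply: (measurableT_comp (@measurable_expeN R)).
    rewrite (_ : (fun w => _) = (fun w => \sum_(i <- index_enum 'I_J) f i w))//.
    exact: emeasurable_sum.
  have cvf w : g w * expeN (\sum_(i < J) f i w) @[J --> \oo] --> g w * expeN (\sum_(i <oo) f i w).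
    by apply: cvgeZl => //; apply: cvg_expeN_series => i.
  apply: (ge0_dominated_cvg (g := cst 1)) => //.
  - exact: (@emeasurable_fun_cvg _ _ _ _ _ _ mfJ (fun w _ => cvf w)).
  - rewrite integral_cst// mul1e.
 exact: fin_num_fun_lty.
  - move=> J w; rewrite mule_ge0 ?expeN_ge0//=.
    rewrite -[leRHS]mule1; apply: lee_pmul => //; first exact: expeN_ge0.
      by have /andP[] := g01 w.
    by apply: expeN_le1; exact: sume_ge0.
  - exact: aeW.
have l1 := main _ (fun i w => psi_ge0 i w w) mpsi_diag.
have l2 := main _ psib_ge0 mpsib_T.
rewrite -(cvg_lim (@ereal_hausdorff R) l1) -(cvg_lim (@ereal_hausdorff R) l2).
by congr (limn _); apply/funext => J; exact: integral_discount_finite.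
Qed.

End conditional_independence.

Section poisson_laplace.
Context (R : realType).
Local Open Scope ereal_scope.

Lemma exp_eseries (x : R) : (0 <= x)%R ->
  \sum_(k <oo) (x ^+ k / k`!%:R)%:E = (expR x)%:E.
Proof.
move=> x0; rewrite /expR -EFin_lim; last exact: is_cvg_series_exp_coeff.
by apply/congr_lim/funext => n /=; rewrite /series/= -sumEFin.
Qed.

Context d (T : measurableType d) (P : probability T R).

Lemma poisson_variable_laplace (X : T -> \bar R) (a c : R) :
  measurable_fun setT X -> (0 <= a)%R -> (0 <= c)%R ->
  (forall k : nat, P [set w | X w = k%:R%:E] = (a ^+ k / k`!%:R * expR (- a))%:E) ->
  \int[P]_w expeN (c%:E * X w) = expeN ((1 - expR (- c)) * a)%:E.
Proof.
move=> mX a0 c0 PX; pose A k := [set w | X w = k%:R%:E].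
have mA k : measurable (A k) by rewrite -[A k]setTI; exact: (mX measurableT _ (emeasurable_set1 _)).
have tA : trivIset setT A.
  apply/trivIsetP => i j _ _ /eqP ij; apply/seteqP; split => // w [].
  by rewrite /A /= => -> [] /eqP; rewrite eqr_nat => /eqP.
have mU : measurable (\bigcup_k A k) by exact: bigcupT_measurable.
have fE (x : R) : (0 <= x)%R -> \sum_(k <oo) (x ^+ k / k`!%:R * expR (- a))%:E = (expR (x - a))%:E.
  move=> x0; rewrite expRD EFinM -exp_eseries// muleC -nneseriesZl//.
    by apply: eq_eseriesr => k _; rewrite -EFinM mulrC.
  by move=> k _; rewrite lee_fin divr_ge0// exprn_ge0.
have PU : P (\bigcup_k A k) = 1.
  rewrite measure_bigcup//=; under eq_eseriesr do rewrite PX.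
  rewrite (@eq_eseriesl _ _ xpredT); last by move=> i; rewrite in_setT.
  by rewrite fE// subrr expR0.
have PC : P (~` \bigcup_k A k) = 0 by rewrite probability_setC// PU subee.
have mf : measurable_fun setT (fun w => expeN (c%:E * X w)).
  exact: (measurableT_comp (@measurable_expeN R) (measurable_funeM _ mX)).
rewrite (@ge0_negligible_integral _ _ _ _ setT (~` \bigcup_k A k))//; last 2 first.
- exact: measurableC.
- by move=> w _; exact: expeN_ge0.
rewrite setTD setCK ge0_integral_bigcup//; last 2 first.
- exact: measurable_funTS.
- by move=> w _; exact: expeN_ge0.
transitivity (\sum_(k <oo) ((expR (- c) * a) ^+ k / k`!%:R * expR (- a))%:E).
  apply: eq_eseriesr => k _.
  rewrite (eq_integral (cst (expR (- (c * k%:R)))%:E)); last first.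
    by move=> w; rewrite inE /A /= => ->.
  rewrite integral_cst// [X in _ * X](_ : _ = (a ^+ k / k`!%:R * expR (- a))%:E); last exact: PX.
  rewrite -EFinM; congr EFin.
  rewrite exprMn -expRM_natl mulrN [(k%:R * c)%R]mulrC; ring.
by rewrite fE ?mulr_ge0 ?expR_ge0// /expeN /=; congr (expR _)%:E; ring.
Qed.

End poisson_laplace.

Section level_sets.
Context (R : realType) dE (E : measurableType dE).
Local Open Scope ereal_scope.

Import HBNNSimple.

Lemma nnsfun_level (h : {nnsfun E >-> R}) :
  exists (a : E -> nat) (c : nat -> R), [/\ forall i, measurable (a @^-1` [set i]),
    forall i, (0 <= c i)%R & forall x, h x = c (a x)].
Proof.
pose s := [seq r <- finmap.enum_fset (fset_set (range h)) | 0 <= r]%R.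
have sh x : h x \in s.
  by rewrite mem_filter fun_ge0/= in_fset_set// inE; exists x.
have us : uniq s by rewrite filter_uniq// finmap.fset_uniq.
exists (fun x => index (h x) s), (nth 0%R s); split.
- move=> i; have [si|si] := ltnP i (size s).
    rewrite (_ : _ @^-1` _ = h @^-1` [set nth 0%R s i])//.
    apply/seteqP; split => x /= xi; first by rewrite -xi nth_index.
    by rewrite xi index_uniq.
  rewrite (_ : _ @^-1` _ = set0)//; apply/seteqP; split => // x /= xi.
  by move: (sh x); rewrite -index_mem xi ltnNge si.
- move=> i; have [si|si] := ltnP i (size s); last by rewrite nth_default.
  by have := mem_nth 0%R si; rewrite mem_filter => /andP[].
- by move=> x; rewrite nth_index.
Qed.

Lemma integral_level (m : {measure set E -> \bar R}) (F : set E) (a : E -> nat)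
    (u : nat -> \bar R) : measurable F -> (forall i, measurable (a @^-1` [set i])) ->
  (forall i, 0 <= u i) ->
  \int[m]_(x in F) u (a x) = \sum_(i <oo) u i * m (F `&` a @^-1` [set i]).
Proof.
move=> mF ma u0.
have FE : F = \bigcup_i (F `&` a @^-1` [set i]).
  by apply/seteqP; split => [x Fx|x [i _ []]//]; exists (a x).
have mu : measurable_fun setT (u \o a).
  apply: (measurableT_comp (f := u)) => // _ A _; rewrite setTI.
  rewrite (_ : a @^-1` A = \bigcup_(i in A) a @^-1` [set i]).
    by apply: bigcup_measurable => i _.
  by apply/seteqP; split => [x Ax|x [i Ai /= ->]//]; exists (a x).
rewrite [in LHS]FE ge0_integral_bigcup//.
- apply: eq_eseriesr => i _; rewrite (eq_integral (cst (u i))); last first.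
    by move=> x; rewrite inE /= => -[_ ->].
  by rewrite integral_cst//; exact: measurableI.
- by move=> k; exact: measurableI.
- exact: measurable_funTS.
- apply/trivIsetP => i j _ _ /eqP ij; apply/seteqP; split => // x [[_ /= xi] [_ /= xj]].
  by apply: ij; rewrite -xi -xj.
Qed.

Lemma measurable_integral_random_measure d (T : measurableType d)
    (N : T -> {measure set E -> \bar R}) (h : E -> R) :
  (forall B, measurable B -> measurable_fun setT (fun w => N w B)) ->
  measurable_fun setT h -> (forall x, 0 <= h x)%R ->
  measurable_fun setT (fun w => \int[N w]_x (h x)%:E).
Proof.
move=> mN mh h0.
have meh : measurable_fun setT (EFin \o h) by exact/measurable_EFinP.
pose g := nnsfun_approx measurableT meh.
apply: (@emeasurable_fun_cvg _ _ _ _ (fun k w => \int[N w]_x (g k x)%:E)).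
  move=> k; have [a [c [ma c0 gE]]] := nnsfun_level (g k).
  under eq_fun => w.
    under eq_integral => x _ do rewrite gE.
    rewrite (@integral_level (N w) setT a (EFin \o c))//.
    over.
  apply: ge0_emeasurable_sum => [i w _ _|i _].
    by apply: mule_ge0 => //=; rewrite lee_fin.
  by apply: measurable_funeM; apply: mN; rewrite setTI.
move=> w _; have -> : \int[N w]_x (h x)%:E = \int[N w]_x limn (fun k => (g k x)%:E).
  apply: eq_integral => x _; apply/esym/cvg_lim => //.
  by apply: cvg_nnsfun_approx => // y _; rewrite lee_fin.
apply: cvg_monotone_convergence => //.
- by move=> k; apply/measurable_EFinP.
- by move=> k x _; rewrite lee_fin.
- by move=> x _ a b ab; rewrite lee_fin; apply/lefP/nd_nnsfun_approx.
Qed.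

End level_sets.

Section poisson_process_laplace.
Context (R : realType) (n : nat).
Local Notation E := 'rV[R]_n.
Context d (T : measurableType d) (P : probability T R).
Variables (Lambda : {sigma_finite_measure set E -> \bar R}).
Variables (N : T -> {measure set E -> \bar R}).
Hypothesis pN : poisson_process P Lambda N.
Local Open Scope ereal_scope.

Let mN B : measurable B -> measurable_fun setT (fun w => N w B).
Proof. by move=> mB; have [h _ _] := pN; exact: h. Qed.

Lemma poisson_count_laplace (B : set E) (c : R) : measurable B ->
  (0 <= c)%R -> Lambda B < +oo ->
  \int[P]_w expeN (c%:E * N w B) = expeN ((1 - expR (- c))%:E * Lambda B).
Proof.
move=> mB c0 LB; have [_ pk _] := pN.
have LBE : Lambda B = (fine (Lambda B))%:E by rewrite fineK// ge0_fin_numE.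
rewrite LBE -EFinM; apply: poisson_variable_laplace => //.
- exact: mN.
- exact: fine_ge0.
- by move=> k; exact: pk.
Qed.

Lemma poisson_disjoint_laplace (B : nat -> set E) (c : nat -> R) :
  (forall i, measurable (B i)) -> trivIset setT B ->
  (forall i, 0 <= c i)%R -> (forall i, Lambda (B i) < +oo) ->
  \int[P]_w expeN (\sum_(i <oo) (c i)%:E * N w (B i)) =
  expeN (\sum_(i <oo) (1 - expR (- c i))%:E * Lambda (B i)).
Proof.
move=> mB tB c0 LB.
have [_ _ pI] := pN.
pose f (o : option nat) := if o is Some i then i.+1 else 0%N.
have fI : injective f by move=> [i|] [j|] //= [->].
pose B' i := if i is j.+1 then B j else set0.
have mB' i : measurable (B' i) by case: i => [|i]; [exact: measurable0|exact: mB].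
have tB' : trivIset setT B'.
  apply/trivIsetP => -[|i] [|j] _ _ //= ij; rewrite ?set0I ?setI0//.
  by move/trivIsetP : tB; apply.
pose G (i : nat) := g_sigma_algebra_preimage (fun w => N w (B' i)).
have sG i : sigma_algebra setT (G i).
  split.
  - by exists set0 => //; rewrite preimage_set0 setI0.
  - move=> A [D mD <-]; exists (~` D); first exact: measurableC.
    by rewrite !setTI setTD preimage_setC.
  - move=> F FG; pose D i := sval (cid2 (FG i)).
    exists (\bigcup_i D i).
      by apply: bigcup_measurable => k _; rewrite /D; case: cid2.
    rewrite setTI preimage_bigcup; apply: eq_bigcupr => k _.
    by rewrite /D; case: cid2 => ? ? /=; rewrite setTI.
have mG i : G i `<=` measurable by move=> _ [D mD <-]; exact: mN.
have := @integral_discount _ T R P (G \o f) (fun o => sG (f o)) (fun o => mG (f o))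
  (mutually_independent_inj (pI B' mB' tB') fI)
  (fun i _ w' => (c i)%:E * N w' (B i))
  (fun i _ => (1 - expR (- c i))%:E * Lambda (B i)) _ _ _ _ _ (cst 1).
under eq_integral do rewrite mul1e.
move=> ->.
- under eq_integral do rewrite mul1e.
  by rewrite integral_cst// -[RHS]mule1 -(probability_setT P).
- move=> i; apply: measurable_funeM.
  apply: (measurableT_comp (f := fun w : g_sigma_algebraType (G i.+1) => N w (B i))) => //.
  move=> _ A mA; rewrite setTI; apply: sub_sigma_algebra; exists A => //.
  by rewrite setTI.
- by move=> i; exact: measurable_cst.
- by move=> i w w'; apply: mule_ge0 => //; rewrite lee_fin.
- move=> i w; apply: mule_ge0 => //.
  by rewrite lee_fin subr_ge0 expR_le1 lerNl oppr0.
- by move=> i w; exact: poisson_count_laplace.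
- exact: measurable_cst.
- by move=> w /=; rewrite lee01 lexx.
Qed.

Import HBNNSimple.

Lemma poisson_laplace_nnsfun (h : {nnsfun E >-> R}) (F : set E) :
  measurable F -> Lambda F < +oo ->
  \int[P]_w expeN (\int[N w]_(x in F) (h x)%:E) =
  expeN (\int[Lambda]_(x in F) (1 - expR (- h x))%:E).
Proof.
move=> mF LF; have [a [c [ma c0 hE]]] := nnsfun_level h.
under eq_integral => w _.
  under eq_integral => x _ do rewrite hE.
  rewrite (@integral_level _ _ _ (N w) F a (EFin \o c))//.
  over.
under [in RHS]eq_integral => x _ do rewrite hE.
rewrite (@integral_level _ _ _ Lambda F a (fun i => (1 - expR (- c i))%:E))//; last first.
  by move=> i; rewrite lee_fin subr_ge0 expR_le1 lerNl oppr0.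
apply: poisson_disjoint_laplace => //.
- by move=> i; exact: measurableI.
- apply/trivIsetP => i j _ _ /eqP ij; apply/seteqP; split => // x [[_ /= xi] [_ /= xj]].
  by apply: ij; rewrite -xi -xj.
- move=> i; apply: le_lt_trans LF; apply: le_measure; rewrite ?inE//.
  exact: measurableI.
Qed.

Lemma poisson_laplace (h : E -> R) : measurable_fun setT h -> (forall x, 0 <= h x)%R ->
  \int[P]_w expeN (\int[N w]_x (h x)%:E) =
  expeN (\int[Lambda]_x (1 - expR (- h x))%:E).
Proof.
move=> mh h0.
have [F [FT ndF Ffin]] := (sigma_finiteP _ _).1 (sigma_finiteT Lambda).
have mF k : measurable (F k) by have [] := Ffin k.
have meh : measurable_fun setT (EFin \o h) by exact/measurable_EFinP.
pose g := nnsfun_approx measurableT meh.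
have gh x : (g k x)%:E @[k --> \oo] --> (h x)%:E.
  by apply: cvg_nnsfun_approx => // y _; rewrite lee_fin.
have ndg x : nondecreasing_seq (fun k => g k x).
  by move=> a b ab; apply/lefP/nd_nnsfun_approx.
(* truncation to the sets of finite measure F k *)
have main (m : {measure set E -> \bar R}) (q : R -> R) : continuous q ->
    {homo q : x y / (x <= y)%R} -> (forall r, 0 <= r -> 0 <= q r)%R -> measurable_fun setT q ->
    \int[m]_(x in F k) (q (g k x))%:E @[k --> \oo] --> \int[m]_x (q (h x))%:E.
  move=> cq ndq q0 mq.
  pose f k x := ((fun x => (q (g k x))%:E) \_ (F k)) x.
  have f0 k x : 0 <= f k x.
    by rewrite /f patchE; case: ifPn => // _; rewrite lee_fin q0// fun_ge0.
  have mf k : measurable_fun setT (f k).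
    apply/measurable_restrict => //; rewrite setTI; apply/measurable_EFinP.
    by apply: measurable_funTS; apply: measurableT_comp.
  have ndf x : nondecreasing_seq (f ^~ x).
    move=> i j ij; rewrite /f !patchE; case: ifPn => [|xi].
      rewrite !inE => xi; have xj : x \in F j by rewrite inE; exact: (subsetPset _ _ (ndF _ _ ij)).
      by rewrite xj lee_fin ndq// ndg.
    by have := f0 j x; rewrite /f patchE.
  have -> : \int[m]_x (q (h x))%:E = \int[m]_x limn (f ^~ x).
    apply: eq_integral => x _; apply/esym/cvg_lim => //.
    have [k _ xk] : (\bigcup_k F k) x by rewrite -FT.
    apply: cvg_trans (_ : (q (g j x))%:E @[j --> \oo] --> _).
      apply: near_eq_cvg; near=> j; rewrite /f patchE ifT// inE.
      by apply: (subsetPset _ _ (ndF k _ _)) => //; near: j; exists k.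
    apply: cvg_EFin; first by near=> j.
    apply: continuous_cvg; first exact: cq.
    by have /fine_cvgP[] := gh x.
  under eq_fun do rewrite integral_mkcond.
  exact: cvg_monotone_convergence.
have l1 w := main (N w) id (fun _ => cvg_id) (fun _ _ => id) (fun _ => id) (@measurable_id _ _ _).
have l2 : \int[Lambda]_(x in F k) (1 - expR (- g k x))%:E @[k --> \oo] -->
    \int[Lambda]_x (1 - expR (- h x))%:E.
  apply: (main _ (fun r => 1 - expR (- r))%R).
  - move=> r; apply: cvgB; first exact: cvg_cst.
    by apply: continuous_comp; [exact: oppr_continuous|exact: continuous_expR].
  - by move=> x y xy; rewrite lerD2l lerN2 ler_expR lerN2.
  - by move=> r r0; rewrite subr_ge0 expR_le1 lerNl oppr0.
  - apply: measurable_funB => //; apply: measurableT_comp => //.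
have mgk k : measurable_fun setT (fun w => \int[N w]_(x in F k) (g k x)%:E).
  have [a [c [ma c0 gE]]] := nnsfun_level (g k).
  under eq_fun => w.
    under eq_integral => x _ do rewrite gE.
    rewrite (@integral_level _ _ _ (N w) (F k) a (EFin \o c))//.
    over.
  apply: ge0_emeasurable_sum => [i w _ _|i _].
    by apply: mule_ge0 => //=; rewrite lee_fin.
  by apply: measurable_funeM; apply: mN; exact: measurableI.
have int0 (m : {measure set E -> \bar R}) k : 0 <= \int[m]_(x in F k) (g k x)%:E.
  by apply: integral_ge0 => x _; rewrite lee_fin.
have r1 : \int[P]_w expeN (\int[N w]_(x in F k) (g k x)%:E) @[k --> \oo] -->
    \int[P]_w expeN (\int[N w]_x (h x)%:E).
  apply: (ge0_dominated_cvg (g := cst 1)) => //.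
  - by move=> k; apply: (measurableT_comp (@measurable_expeN R)).
  - apply: (measurableT_comp (@measurable_expeN R)).
    exact: measurable_integral_random_measure.
  - by rewrite integral_cst// mul1e; exact: fin_num_fun_lty.
  - by move=> k w; rewrite expeN_ge0 expeN_le1.
  - by apply: aeW => w; apply: cvg_expeN.
have r2 := cvg_expeN (fun k => _) l2.
rewrite -(cvg_lim (@ereal_hausdorff R) r1) -(cvg_lim (@ereal_hausdorff R) (r2 _)).
  by congr (limn _); apply/funext => k /=; apply: poisson_laplace_nnsfun => //; have [] := Ffin k.
move=> k; apply: integral_ge0 => x _.
by rewrite lee_fin subr_ge0 expR_le1 lerNl oppr0.
Unshelve. all: by end_near. Qed.

End poisson_process_laplace.

Section baire.
Context (R : realType) d1 d2 (T1 : measurableType d1) (T2 : measurableType d2).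

Inductive baire : (T1 * T2 -> R) -> Prop :=
| baire_step (I : finType) (a : T1 -> I) (k : I -> T2 -> R) of
    (forall i, measurable (a @^-1` [set i])) &
    (forall i, measurable_fun setT (k i)) : baire (fun z => k (a z.1) z.2)
| baire_lim (f : nat -> T1 * T2 -> R) (g : T1 * T2 -> R) of
    (forall n, baire (f n)) & (forall z, f n z @[n --> \oo] --> g z) : baire g.

Lemma baire_op (op : R -> R -> R) :
  (forall x, continuous (op x)) -> (forall y, continuous (op ^~ y)) ->
  (forall f g : T2 -> R, measurable_fun setT f -> measurable_fun setT g ->
    measurable_fun setT (fun x => op (f x) (g x))) ->
  forall f g, baire f -> baire g -> baire (fun z => op (f z) (g z)).
Proof.
move=> c1 c2 mop f g bf bg.
elim: bf => {f} [I a k ma mk|f f' _ IH ff']; last first.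
  apply: (baire_lim IH) => z.
  exact: (cvg_comp _ _ (ff' z) (c2 (g z) (f' z))).
elim: bg => {g} [J b l mb ml|g g' _ IH gg']; last first.
  apply: (baire_lim IH) => z.
  exact: (cvg_comp _ _ (gg' z) (c1 _ (g' z))).
apply: (@baire_step (I * J)%type (fun x => (a x, b x))
  (fun ij y => op (k ij.1 y) (l ij.2 y))).
- move=> [i j]; rewrite (_ : _ @^-1` _ = a @^-1` [set i] `&` b @^-1` [set j]).
    exact: measurableI.
  by apply/seteqP; split => x /= [] -> ->.
- by move=> [i j]; exact: mop.
Qed.

Lemma baire_cst (c : R) : baire (cst c).
Proof.
apply: (@baire_step unit (fun=> tt) (fun _ _ => c)) => [i|i]; last exact: measurable_cst.
by rewrite preimage_cst; case: ifP.
Qed.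

Lemma baireD f g : baire f -> baire g -> baire (fun z => f z + g z).
Proof.
apply: baire_op => [x y|x y|u v mu mv]; last exact: measurable_funD.
- by apply: cvgD; [exact: cvg_cst|exact: cvg_id].
- by apply: cvgD; [exact: cvg_id|exact: cvg_cst].
Qed.

Lemma baireM f g : baire f -> baire g -> baire (fun z => f z * g z).
Proof.
apply: baire_op => [x y|x y|u v mu mv]; last exact: measurable_funM.
- by apply: cvgM; [exact: cvg_cst|exact: cvg_id].
- by apply: cvgM; [exact: cvg_id|exact: cvg_cst].
Qed.

Lemma baire_sum (I : Type) (s : seq I) (f : I -> T1 * T2 -> R) :
  (forall i, baire (f i)) -> baire (fun z => \sum_(i <- s) f i z).
Proof.
move=> bf; elim: s => [|i s IH].
  rewrite (_ : (fun z => _) = cst 0); first exact: baire_cst.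
  by apply/funext => z; rewrite big_nil.
rewrite (_ : (fun z => _) = (fun z => f i z + \sum_(i <- s) f i z)).
  exact: baireD.
by apply/funext => z; rewrite big_cons.
Qed.

Lemma baire_indic (G : set (T1 * T2)) : measurable G -> baire (\1_G : _ -> R).
Proof.
rewrite /measurable/=; suff : <<s preimage_set_system setT fst measurable `|`
    preimage_set_system setT snd measurable >> `<=` [set G | baire (\1_G : _ -> R)] by apply.
apply: smallest_sub; first split.
- by rewrite /= indic0; exact: baire_cst.
- move=> A /= bA; rewrite setTD.
  rewrite (_ : \1_(~` A) = fun z => cst 1 z + cst (-1) z * \1_A z :> R).
    by apply: baireD; [exact: baire_cst|apply: baireM => //; exact: baire_cst].
  apply/funext => z; rewrite !indicE/= in_setC; case: (z \in A) => /=; ring.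
- move=> F bF /=.
  pose u n z : R := 1 - \prod_(i < n) (1 - \1_(F i) z).
  apply: (@baire_lim u).
    elim=> [|n IH].
      rewrite (_ : u 0%N = cst 0); first exact: baire_cst.
      by apply/funext => z; rewrite /u big_ord0 subrr.
    have b := baireD (baire_cst 1) (baireM (baire_cst (-1)) IH).
    have b' := baireD IH (baireM b (bF n)).
    suff -> : u n.+1 = fun z => u n z + (cst 1 z + cst (-1) z * u n z) * \1_(F n) z by [].
    by apply/funext => z; rewrite /u big_ord_recr/=; ring.
  move=> z; have [Fz|Fz] := pselect ((\bigcup_k F k) z).
    rewrite indicE mem_set//; have [k _ kz] := Fz.
    apply: cvg_near_cst; near=> n; rewrite /u.
    have kn : (k < n)%N by near: n; exists k.+1.
    by rewrite (bigD1 (Ordinal kn))//= indicE mem_set// subrr mul0r subr0.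
  rewrite indicE memNset//; apply: cvg_near_cst; near=> n; rewrite /u big1 ?subrr// => i _.
  by rewrite indicE memNset ?subr0// => Fi; apply: Fz; exists i.
- move=> A [] [B mB <-]; rewrite setTI /=.
    rewrite (_ : \1_(_ @^-1` B) = fun z => ((z.1 \in B)%:R : R)); last first.
      by apply/funext => z; rewrite indicE; congr (_%:R); apply/idP/idP; rewrite !inE.
    apply: (@baire_step bool (fun x => x \in B) (fun b _ => b%:R)) => [b|b]; last exact: measurable_cst.
    case: b; [rewrite (_ : _ @^-1` _ = B)|rewrite (_ : _ @^-1` _ = ~` B)] => //.
    + by apply/seteqP; split => x /=; [exact: set_mem|exact: mem_set].
    + exact: measurableC.
    + apply/seteqP; split => x /=; first by move=> xB /mem_set; rewrite xB.
      by move=> h; apply/negbTE/negP => /set_mem.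
  rewrite (_ : \1_(_ @^-1` B) = fun z => (\1_B z.2 : R)); last first.
    by apply/funext => z; rewrite !indicE; congr (_%:R); apply/idP/idP; rewrite !inE.
  apply: (@baire_step unit (fun=> tt) (fun _ => \1_B)) => [b|b]; last exact: measurable_indic.
  by rewrite preimage_cst; case: ifP.
Unshelve. all: by end_near. Qed.

Import HBNNSimple.

(* Every nonnegative measurable function is a pointwise limit of limits of ... of step functions in the first variable. *)
Lemma measurable_baire (f : T1 * T2 -> R) : measurable_fun setT f ->
  (forall z, 0 <= f z) -> baire f.
Proof.
move=> mf f0.
have mef : measurable_fun setT (EFin \o f) by exact/measurable_EFinP.
pose g := nnsfun_approx measurableT mef.
apply: (@baire_lim (fun n z => g n z)); last first.
  move=> z; have /fine_cvgP[] : (g n z)%:E @[n --> \oo] --> (f z)%:E.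
    by apply: cvg_nnsfun_approx => // y _; rewrite lee_fin.
  by [].
move=> n; have [a [c [ma c0 gE]]] := nnsfun_level (g n).
apply: (@baire_lim (fun m z => \sum_(i < m) c i * \1_(a @^-1` [set val i]) z)).
  move=> m; apply: baire_sum => i; apply: baireM; first exact: baire_cst.
  exact: baire_indic.
move=> z; rewrite gE; apply: cvg_near_cst; near=> m.
have am : (a z < m)%N by near: m; exists (a z).+1.
rewrite (bigD1 (Ordinal am))//= big1 ?addr0.
  by rewrite indicE mem_set// mulr1.
move=> i ij; rewrite indicE memNset ?mulr0// => /= aiz.
by move/eqP : ij; apply; apply: val_inj.
Unshelve. all: by end_near. Qed.

End baire.
Section clamp.
Context (R : realType).

Definition clamp (c r : R) : R := Num.min (Num.max r 0) c.

Lemma clamp_ge0 c r : 0 <= c -> 0 <= clamp c r.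
Proof. by move=> c0; rewrite /clamp le_min le_max lexx orbT. Qed.

Lemma clamp_le c r : clamp c r <= c.
Proof. by rewrite /clamp ge_min lexx orbT. Qed.

Lemma clampE c r : 0 <= r <= c -> clamp c r = r.
Proof. by move=> /andP[r0 rc]; rewrite /clamp max_l// min_l. Qed.

Lemma clamp_min c r : 0 <= r -> clamp c r = Num.min r c.
Proof. by move=> r0; rewrite /clamp max_l. Qed.

Lemma continuous_clamp c : continuous (clamp c).
Proof.
move=> r; have cm : {for r, continuous ((fun x : R => x) \max (cst 0 : R -> R))}.
  by apply: (@continuous_max R R); [exact: cvg_id|exact: cvg_cst].
exact: (@continuous_min R R _ (cst c : R -> R) r cm (cvg_cst _)).
Qed.

Lemma measurable_clamp c : measurable_fun setT (clamp c).
Proof. by apply: continuous_measurable_fun; exact: continuous_clamp. Qed.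

Lemma cvg_clamp r : 0 <= r -> clamp n%:R r @[n --> \oo] --> r.
Proof.
move=> r0; apply: cvg_near_cst; near=> n; rewrite clampE// r0/=.
near: n; exists (Num.truncn r).+1 => // n /= rn.
by rewrite (le_trans (ltW (truncnS_gt r)))// ler_nat.
Unshelve. all: by end_near. Qed.

Lemma nd_clamp r : {homo (fun n : nat => clamp n%:R r) : m n / (m <= n)%N >-> m <= n}.
Proof.
move=> m n mn; rewrite /clamp le_min !ge_min lexx/=.
by rewrite ler_nat mn orbT.
Qed.

End clamp.

Section finite_random_measure.
Context (R : realType) d1 dE (T1 : measurableType d1) (E : measurableType dE).
Context d (T : measurableType d) (N : T -> {measure set E -> \bar R}).
Hypothesis mN : forall B, measurable B -> measurable_fun setT (fun w => N w B).
Hypothesis finN : forall w, (N w setT < +oo)%E.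
Local Open Scope ereal_scope.

Lemma measurable_integral_finite_random_measure (h : T1 * E -> R) :
  measurable_fun setT h -> (forall z, 0 <= h z)%R ->
  measurable_fun setT (fun z : T1 * T => \int[N z.2]_y (h (z.1, y))%:E).
Proof.
move=> mh h0.
have main (c : nat) (f : T1 * E -> R) : baire f -> measurable_fun setT f /\
  measurable_fun setT (fun z : T1 * T => \int[N z.2]_y (clamp c%:R (f (z.1, y)))%:E).
  elim=> {f} [I a k ma mk|f g _ IH fg].
    have mind i : measurable_fun setT (fun x => (\1_(a @^-1` [set i]) x : R)).
      exact: measurable_indic.
    have kE x y : k (a x) y = (\sum_(i : I) \1_(a @^-1` [set i]) x * k i y)%R.
      rewrite (bigD1 (a x))//= indicE mem_set// mul1r big1 ?addr0// => i ix.
      by rewrite indicE memNset ?mul0r//= => /eqP; rewrite eq_sym (negbTE ix).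
    split.
      under eq_fun do rewrite kE.
      apply: measurable_sum => i; apply: measurable_funM.
        exact: (measurableT_comp (mind i) measurable_fst).
      exact: (measurableT_comp (mk i) measurable_snd).
    rewrite (_ : (fun z => _) = fun z : T1 * T => \sum_(i <- index_enum I)
        (\1_(a @^-1` [set i]) z.1)%:E * \int[N z.2]_y (clamp c%:R (k i y))%:E); last first.
      apply/funext => z; rewrite (bigD1 (a z.1))//= indicE mem_set// mul1e big1 ?adde0// => i ix.
      by rewrite indicE memNset ?mul0e//= => /eqP; rewrite eq_sym (negbTE ix).
    apply: emeasurable_sum => i; apply: emeasurable_funM.
      by apply/measurable_EFinP; exact: (measurableT_comp (mind i) measurable_fst).
    apply: (measurableT_comp (f := fun w => \int[N w]_y (clamp c%:R (k i y))%:E)).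
      apply: measurable_integral_random_measure => //.
        exact: measurableT_comp (measurable_clamp _) (mk i).
      by move=> x; exact: clamp_ge0.
    exact: measurable_snd.
  have mg : measurable_fun setT g.
    by apply: (measurable_fun_cvg (h := f)) => [n|z _]; [exact: (IH n).1|exact: fg].
  split => //.
  apply: (@emeasurable_fun_cvg _ _ _ _
      (fun n (z : T1 * T) => \int[N z.2]_y (clamp c%:R (f n (z.1, y)))%:E)).
    by move=> n; exact: (IH n).2.
  move=> z _.
  have mc (v : T1 * E -> R) : measurable_fun setT v ->
      measurable_fun setT (fun y => (clamp c%:R (v (z.1, y)))%:E).
    move=> mv; apply/measurable_EFinP; apply: (measurableT_comp (@measurable_clamp R c%:R)).
    exact: (measurable_comp2 mv (measurable_cst z.1) (@measurable_id _ _ _)).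
  apply: (@ge0_dominated_cvg _ _ _ (N z.2) _ _ (cst c%:R%:E)).
  - by move=> n; apply: mc; exact: (IH n).1.
  - exact: mc.
  - exact: measurable_cst.
  - by rewrite integral_cst//; apply: lte_mul_pinfty.
  - by move=> n y; rewrite !lee_fin clamp_ge0//= clamp_le.
  - apply: aeW => y; apply: cvg_EFin; first exact: nearW.
    exact: (cvg_comp _ _ (fg _) (@continuous_clamp R c%:R _)).
have bh := measurable_baire mh h0.
apply: (@emeasurable_fun_cvg _ _ _ _
      (fun n (z : T1 * T) => \int[N z.2]_y (clamp n%:R (h (z.1, y)))%:E)).
  by move=> n; exact: (main n h bh).2.
move=> z _.
have -> : \int[N z.2]_y (h (z.1, y))%:E =
    \int[N z.2]_y limn (fun n => (clamp n%:R (h (z.1, y)))%:E).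
  apply: eq_integral => y _; apply/esym/cvg_lim => //.
  by apply: cvg_EFin; [exact: nearW|exact: cvg_clamp].
apply: cvg_monotone_convergence => //.
- move=> n; apply/measurable_EFinP; apply: (measurableT_comp (@measurable_clamp R n%:R)).
  exact: (measurable_comp2 mh (measurable_cst z.1) (@measurable_id _ _ _)).
- by move=> n y _; rewrite lee_fin clamp_ge0.
- by move=> y _ m n mn; rewrite lee_fin nd_clamp.
Qed.

End finite_random_measure.

Section cluster_functionals.
Context (R : realType) (n : nat).
Local Notation E := 'rV[R]_n.
Variables (lambda mu : R) (Q : probability E R).
Variables (L : {sigma_finite_measure set E -> \bar R}).
Hypotheses (lambda_ge0 : 0 <= lambda) (mu_ge0 : 0 <= mu).
Local Open Scope ereal_scope.
Implicit Types (g h : E -> R) (x t : E).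

Definition cluster_exponent h x : \bar R :=
  mu%:E * \int[Q]_c (1 - expR (- h (x + c)%R))%:E.

Definition process_exponent h : \bar R :=
  lambda%:E * \int[L]_x (1 - expeN (cluster_exponent h x)).

Definition palm_exponent (eps : bool) h t : \bar R :=
  process_exponent h + (if eps then cluster_exponent h t else 0).

Definition cluster_weight g h x : \bar R :=
  mu%:E * \int[Q]_c (g (x + c)%R * expR (- h (x + c)%R))%:E.

Let onem_ge0 (r : R) : (0 <= r)%R -> (0 <= 1 - expR (- r))%R.
Proof. by move=> r0; rewrite subr_ge0 expR_le1 lerNl oppr0. Qed.

Lemma measurable_shift2 (d1 : measure_display) (T1 : measurableType d1) (f : T1 -> E) g :
  measurable_fun setT f -> measurable_fun setT g ->
  measurable_fun setT (fun z : T1 * E => g (f z.1 + z.2)%R).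
Proof.
move=> mf mg; apply: (measurableT_comp mg); apply: measurable_rV_add.
  exact: (measurableT_comp mf measurable_fst).
exact: measurable_snd.
Qed.

Lemma cluster_exponent_ge0 h x : (forall z, 0 <= h z)%R -> 0 <= cluster_exponent h x.
Proof.
move=> h0; apply: mule_ge0; first by rewrite lee_fin.
by apply: integral_ge0 => c _; rewrite lee_fin onem_ge0.
Qed.

Lemma process_exponent_ge0 h : (forall z, 0 <= h z)%R -> 0 <= process_exponent h.
Proof.
move=> h0; apply: mule_ge0; first by rewrite lee_fin.
apply: integral_ge0 => x _; have b0 := cluster_exponent_ge0 x h0.
by rewrite sube_ge0 ?expeN_le1 ?expeN_fin_num.
Qed.

Lemma palm_exponent_ge0 eps h t : (forall z, 0 <= h z)%R -> 0 <= palm_exponent eps h t.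
Proof.
move=> h0; apply: adde_ge0; first exact: process_exponent_ge0.
by case: eps => //; exact: cluster_exponent_ge0.
Qed.

Lemma measurable_onem d (T : measurableType d) (h : T -> R) : measurable_fun setT h ->
  measurable_fun setT (fun w => 1 - expR (- h w))%R.
Proof.
by move=> mh; apply: measurable_funB => //; apply: measurableT_comp => //; exact: measurable_funN.
Qed.

Lemma measurable_integral_shift g : measurable_fun setT g -> (forall z, 0 <= g z)%R ->
  measurable_fun setT (fun x : E => \int[Q]_c (g (x + c)%R)%:E).
Proof.
move=> mg g0.
apply: (@measurable_fun_fubini_tonelli_F _ _ _ _ _ Q (fun z : E * E => (g (z.1 + z.2)%R)%:E)).
  by apply/measurable_EFinP; apply: (measurable_shift2 (f := id)).
by move=> z; rewrite lee_fin.
Qed.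

Lemma measurable_cluster_exponent h : measurable_fun setT h -> (forall z, 0 <= h z)%R ->
  measurable_fun setT (cluster_exponent h).
Proof.
move=> mh h0; apply: measurable_funeM.
apply: (measurable_integral_shift (g := fun x => 1 - expR (- h x))%R).
  exact: measurable_onem.
by move=> z; exact: onem_ge0.
Qed.

Lemma measurable_palm_exponent eps h : measurable_fun setT h -> (forall z, 0 <= h z)%R ->
  measurable_fun setT (palm_exponent eps h).
Proof.
move=> mh h0; apply: emeasurable_funD; first exact: measurable_cst.
by case: eps; [exact: measurable_cluster_exponent|exact: measurable_cst].
Qed.

Lemma cluster_weight_ge0 g h x : (forall z, 0 <= g z)%R -> 0 <= cluster_weight g h x.
Proof.
move=> g0; apply: mule_ge0; first by rewrite lee_fin.
by apply: integral_ge0 => c _; rewrite lee_fin mulr_ge0// expR_ge0.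
Qed.

Lemma measurable_cluster_weight g h : measurable_fun setT g -> measurable_fun setT h ->
  (forall z, 0 <= g z)%R -> measurable_fun setT (cluster_weight g h).
Proof.
move=> mg mh g0; apply: measurable_funeM.
apply: (measurable_integral_shift (g := fun x => g x * expR (- h x))%R).
  by apply: measurable_funM => //; apply: measurableT_comp => //; exact: measurable_funN.
by move=> z; rewrite mulr_ge0// expR_ge0.
Qed.

Section increments.
Variables (g h : E -> R).
Hypotheses (mg : measurable_fun setT g) (mh : measurable_fun setT h).
Hypotheses (g0 : forall x, (0 <= g x)%R) (h0 : forall x, (0 <= h x)%R).

Let hs m x := (h x + 2 ^- m * g x)%R.

Let s_ge0 m : (0 <= 2 ^- m :> R)%R. Proof. by rewrite invr_ge0 exprn_ge0. Qed.

Let se_ge0 m : 0 <= (2 ^- m)%:E :> \bar R. Proof. by rewrite lee_fin. Qed.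

Let hs0 m x : (0 <= hs m x)%R.
Proof. by rewrite addr_ge0// mulr_ge0. Qed.

Let mhs m : measurable_fun setT (hs m).
Proof. by apply: measurable_funD => //; exact: measurable_funM. Qed.

(* 1 - e^{-s x} = s qexp x *)
Let onemqexp m (x : \bar R) : 0 <= x ->
  1 - expeN ((2 ^- m)%:E * x) = (2 ^- m)%:E * qexp m x.
Proof.
move=> x0; rewrite [X in X - _](expeN_qexp m x0) addeAC subee ?add0e//.
by rewrite expeN_fin_num// mule_ge0.
Qed.

Let split_onem m (b x : \bar R) : 0 <= b -> 0 <= x ->
  1 - expeN (b + (2 ^- m)%:E * x) = (1 - expeN b) + (2 ^- m)%:E * (expeN b * qexp m x).
Proof.
move=> b0 x0; rewrite expeND ?mule_ge0//.
have bfin := expeN_fin_num b0.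
have sfin : expeN ((2 ^- m)%:E * x) \is a fin_num by rewrite expeN_fin_num// mule_ge0.
rewrite muleCA -onemqexp//.
move: bfin sfin; case: (expeN b) => // u _; case: (expeN _) => // v _.
transitivity ((1 - u + u * (1 - v))%:E) => //; rewrite -EFinM -EFinB; congr EFin; ring.
Qed.

Let mqg m : measurable_fun setT (fun x => expeN (h x)%:E * qexp m (g x)%:E).
Proof.
apply: emeasurable_funM.
  by apply: (measurableT_comp (@measurable_expeN R)); exact/measurable_EFinP.
by apply: (measurableT_comp (@measurable_qexp R m)); exact/measurable_EFinP.
Qed.

Let dbeta m x := mu%:E * \int[Q]_c (expeN (h (x + c)%R)%:E * qexp m (g (x + c)%R)%:E).

Let shift_m (f : E -> \bar R) x : measurable_fun setT f -> measurable_fun setT (fun c => f (x + c)%R).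
Proof.
by move=> mf; apply: (measurableT_comp mf); exact: measurable_rV_add.
Qed.

Let mqgx m x : measurable_fun setT (fun c => expeN (h (x + c)%R)%:E * qexp m (g (x + c)%R)%:E).
Proof. exact: (@shift_m (fun x => expeN (h x)%:E * qexp m (g x)%:E) x (@mqg m)). Qed.

Let q0 m x : 0 <= expeN (h x)%:E * qexp m (g x)%:E.
Proof. by rewrite mule_ge0 ?expeN_ge0// qexp_ge0// lee_fin. Qed.

Let dbeta_ge0 m x : 0 <= dbeta m x.
Proof. by apply: mule_ge0; [rewrite lee_fin|apply: integral_ge0 => c _]. Qed.

Let betaE m x : cluster_exponent (hs m) x = cluster_exponent h x + (2 ^- m)%:E * dbeta m x.
Proof.
rewrite /cluster_exponent /dbeta muleCA -ge0_muleDr; last 2 first.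
- by apply: integral_ge0 => c _; rewrite lee_fin onem_ge0.
- by apply: mule_ge0 => //; apply: integral_ge0 => c _.
congr (_ * _); rewrite -ge0_integralZl//.
rewrite -ge0_integralD//.
- apply: eq_integral => c _.
  have := split_onem m (b := (h (x + c)%R)%:E) (x := (g (x + c)%R)%:E).
  by rewrite !lee_fin => <-.
- by move=> c _; rewrite lee_fin onem_ge0.
- by apply/measurable_EFinP; apply: measurable_onem; apply: measurableT_comp => //;
    apply: measurable_rV_add => //; exact: measurable_cst.
- by move=> c _; apply: mule_ge0.
- exact: measurable_funeM.
Qed.

Let mdbeta m : measurable_fun setT (dbeta m).
Proof.
apply: measurable_funeM.
apply: (@measurable_fun_fubini_tonelli_F _ _ _ _ _ Q
  (fun z : E * E => expeN (h (z.1 + z.2)%R)%:E * qexp m (g (z.1 + z.2)%R)%:E)) => //.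
apply: (measurableT_comp (mqg m) (g := fun z : E * E => (z.1 + z.2)%R)).
by apply: measurable_rV_add.
Qed.

Let nd_dbeta x : nondecreasing_seq (dbeta ^~ x).
Proof.
move=> i j ij; apply: lee_wpmul2l; first by rewrite lee_fin.
apply: ge0_le_integral => //.
move=> c _; apply: lee_wpmul2l; first exact: expeN_ge0.
by apply: nd_qexp => //; rewrite lee_fin.
Qed.

Let cvg_dbeta x : dbeta ^~ x @ \oo --> cluster_weight g h x.
Proof.
apply: cvgeZl => //.
have := @cvg_integral_qexp R _ _ Q (fun c => expeN (h (x + c)%R)%:E) (fun _ c => (g (x + c)%R)%:E)
   (fun c => (g (x + c)%R)%:E).
under [in X in _ -> _ -> _ -> _ -> _ -> _ -> _ -> _ --> X]eq_integral => c _ do rewrite /expeN/= -EFinM mulrC.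
apply.
- apply: (shift_m (f := fun x => expeN (h x)%:E)).
  by apply: (measurableT_comp (@measurable_expeN R)); exact/measurable_EFinP.
- by move=> c; exact: expeN_ge0.
- by move=> c; apply: expeN_fin_num; rewrite lee_fin.
- by move=> _; apply: (shift_m (f := fun x => (g x)%:E)); exact/measurable_EFinP.
- by move=> _ c; rewrite lee_fin.
- by move=> c i j _.
- by move=> c; exact: cvg_cst.
Qed.

Let b0 x := cluster_exponent_ge0 x h0.

Let dalpha m := lambda%:E * \int[L]_x (expeN (cluster_exponent h x) * qexp m (dbeta m x)).

Let mEb : measurable_fun setT (fun x => expeN (cluster_exponent h x)).
Proof. exact: (measurableT_comp (@measurable_expeN R) (measurable_cluster_exponent mh h0)). Qed.

Let mdal m : measurable_fun setT (fun x => expeN (cluster_exponent h x) * qexp m (dbeta m x)).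
Proof.
apply: emeasurable_funM => //.
by apply: (measurableT_comp (@measurable_qexp R m)).
Qed.

Let alphaE m : process_exponent (hs m) = process_exponent h + (2 ^- m)%:E * dalpha m.
Proof.
have i0 x : 0 <= expeN (cluster_exponent h x) * qexp m (dbeta m x).
  by rewrite mule_ge0 ?expeN_ge0// qexp_ge0.
have j0 x : 0 <= 1 - expeN (cluster_exponent h x).
  by rewrite sube_ge0 ?expeN_le1 ?expeN_fin_num.
rewrite /process_exponent /dalpha muleCA -ge0_muleDr; last 2 first.
- exact: integral_ge0.
- by apply: mule_ge0 => //; exact: integral_ge0.
congr (_ * _); rewrite -ge0_integralZl//.
rewrite -ge0_integralD//.
- by apply: eq_integral => x _; rewrite betaE split_onem.
- by apply: emeasurable_funB => //; exact: measurable_cst.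
- by move=> x _; apply: mule_ge0.
- exact: measurable_funeM.
Qed.

Let dalpha_ge0 m : 0 <= dalpha m.
Proof.
apply: mule_ge0; first by rewrite lee_fin.
by apply: integral_ge0 => x _; rewrite mule_ge0 ?expeN_ge0// qexp_ge0.
Qed.

Let nd_dalpha : nondecreasing_seq dalpha.
Proof.
move=> i j ij; apply: lee_wpmul2l; first by rewrite lee_fin.
apply: ge0_le_integral; [exact: measurableT| |exact: mdal|exact: mdal|].
- move=> x _; apply: mule_ge0; first exact: expeN_ge0.
  by apply: qexp_ge0; exact: dbeta_ge0.
- move=> x _; apply: lee_wpmul2l; first exact: expeN_ge0.
  apply: (le_trans (nd_qexp ij (dbeta_ge0 i x))).
  by apply: le_qexp; [exact: dbeta_ge0|exact: nd_dbeta].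
Qed.

Let cvg_dalpha : dalpha @ \oo -->
  lambda%:E * \int[L]_x (expeN (cluster_exponent h x) * cluster_weight g h x).
Proof.
apply: cvgeZl => //; apply: cvg_integral_qexp => //.
- by move=> x; exact: expeN_ge0.
- by move=> x; exact: expeN_fin_num.
Qed.

Variable eps : bool.

Let dA m t := dalpha m + if eps then dbeta m t else 0.

Let dA_ge0 m t : 0 <= dA m t.
Proof. by apply: adde_ge0 => //; case: eps. Qed.

Let AE m t : palm_exponent eps (hs m) t = palm_exponent eps h t + (2 ^- m)%:E * dA m t.
Proof.
rewrite /palm_exponent /dA alphaE betaE ge0_muleDr//; last by case: eps.
by case: eps; [rewrite addeACA|rewrite mule0 !adde0].
Qed.

Definition palm_weight t : \bar R :=
  lambda%:E * \int[L]_x (expeN (cluster_exponent h x) * cluster_weight g h x) +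
  if eps then cluster_weight g h t else 0.

Section first_order.
Context d (T : measurableType d) (P : probability T R).
Variables (S : (E -> R) -> T -> \bar R).
Hypothesis S_ge0 : forall (f : E -> R) w, (forall x, 0 <= f x)%R -> 0 <= S f w.
Hypothesis mS : forall f : E -> R, measurable_fun setT f -> (forall x, 0 <= f x)%R ->
  measurable_fun setT (S f).
Hypothesis SD : forall (f1 f2 : E -> R) (c : R) w, (forall x, 0 <= f1 x)%R -> (forall x, 0 <= f2 x)%R ->
  (0 <= c)%R -> S (fun x => f1 x + c * f2 x)%R w = S f1 w + c%:E * S f2 w.
Hypothesis lap : forall f : E -> R, measurable_fun setT f -> (forall x, 0 <= f x)%R ->
  \int[P]_w expeN (S f w) = \int[Q]_a expeN (palm_exponent eps f (- a)%R).

Lemma first_order_fixed :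
  \int[P]_w (expeN (S h w) * S g w) =
  \int[Q]_a (expeN (palm_exponent eps h (- a)%R) * palm_weight (- a)%R).
Proof.
have mneg (f : E -> \bar R) : measurable_fun setT f -> measurable_fun setT (fun a : E => f (- a)%R).
  by move=> mf; apply: (measurableT_comp mf); exact: measurable_rV_opp.
have mdA m : measurable_fun setT (dA m).
  by apply: emeasurable_funD => //; case: eps.
have mEA : measurable_fun setT (fun a : E => expeN (palm_exponent eps h (- a)%R)).
  apply: (mneg (fun a => expeN (palm_exponent eps h a))).
  by apply: (measurableT_comp (@measurable_expeN R)); exact: measurable_palm_exponent.
have Ah0 t : 0 <= palm_exponent eps h t by exact: palm_exponent_ge0.
have genE d' (T' : measurableType d') (m' : {measure set T' -> \bar R}) m (b D : T' -> \bar R) :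
    measurable_fun setT b -> measurable_fun setT D -> (forall z, 0 <= b z) -> (forall z, 0 <= D z) ->
    \int[m']_z expeN (b z) = \int[m']_z expeN (b z + (2 ^- m)%:E * D z) +
      (2 ^- m)%:E * \int[m']_z (expeN (b z) * qexp m (D z)).
  move=> mb mD b_ge0 D_ge0.
  have mEb' : measurable_fun setT (fun z => expeN (b z)) by exact: (measurableT_comp (@measurable_expeN R) mb).
  have mEq : measurable_fun setT (fun z => expeN (b z) * qexp m (D z)).
    by apply: emeasurable_funM => //; exact: (measurableT_comp (@measurable_qexp R m) mD).
  have Eq0 z : 0 <= expeN (b z) * qexp m (D z) by apply: mule_ge0; [exact: expeN_ge0|exact: qexp_ge0].
  rewrite -ge0_integralZl//.
  rewrite -ge0_integralD//.
  - apply: eq_integral => z _; rewrite expeND ?mule_ge0//.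
    rewrite muleCA -ge0_muleDr; last 2 first.
    + exact: expeN_ge0.
    + by apply: mule_ge0 => //; exact: qexp_ge0.
    by rewrite -expeN_qexp// mule1.
  - by move=> z _; exact: expeN_ge0.
  - apply: (measurableT_comp (@measurable_expeN R)); apply: emeasurable_funD => //.
    exact: measurable_funeM.
  - by move=> z _; exact: mule_ge0.
  - exact: measurable_funeM.
have step m : \int[P]_w (expeN (S h w) * qexp m (S g w)) =
    \int[Q]_a (expeN (palm_exponent eps h (- a)%R) * qexp m (dA m (- a)%R)).
  have e1 := lap mh h0.
  rewrite (genE _ _ _ m (S h) (S g)) in e1; [|exact: mS|exact: mS|by move=> w; exact: S_ge0|by move=> w; exact: S_ge0].
  rewrite (genE _ _ _ m (fun a : E => palm_exponent eps h (- a)%R) (fun a : E => dA m (- a)%R)) in e1; last 4 first.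
  - by apply: mneg; exact: measurable_palm_exponent.
  - by apply: mneg; exact: mdA.
  - by move=> a; exact: Ah0.
  - by move=> a; exact: dA_ge0.
  have e2 := lap (@mhs m) (@hs0 m).
  rewrite (eq_integral (fun w => expeN (S h w + (2 ^- m)%:E * S g w))) in e2; last first.
    by move=> w _; rewrite SD.
  rewrite [RHS](eq_integral (fun a : E => expeN (palm_exponent eps h (- a)%R + (2 ^- m)%:E * dA m (- a)%R))) in e2; last first.
    by move=> a _; rewrite AE.
  rewrite e2 in e1.
  have fin : \int[Q]_a expeN (palm_exponent eps h (- a)%R + (2 ^- m)%:E * dA m (- a)%R) \is a fin_num.
    have E1 a : 0 <= expeN (palm_exponent eps h (- a)%R + (2 ^- m)%:E * dA m (- a)%R) <= 1.
      by rewrite expeN_ge0 expeN_le1// adde_ge0// mule_ge0.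
    rewrite ge0_fin_numE; last by apply: integral_ge0 => a _; have /andP[] := E1 a.
    apply: (@le_lt_trans _ _ (\int[Q]_a cst 1 a)).
      apply: ge0_le_integral => //; last by move=> a _; have /andP[] := E1 a.
      - by move=> a _; have /andP[] := E1 a.
      - apply: (measurableT_comp (@measurable_expeN R)); apply: emeasurable_funD.
          by apply: (mneg (palm_exponent eps h)); exact: measurable_palm_exponent.
        by apply: measurable_funeM; apply: mneg; exact: mdA.
    by rewrite integral_cst// mul1e; exact: fin_num_fun_lty.
  have addI (y u v : \bar R) : y \is a fin_num -> y + u = y + v -> u = v.
    move=> yf; have yK z : y + z - y = z by rewrite addeAC subee// add0e.
    by move=> /(congr1 (fun z => z - y)); rewrite !yK.
  have {}e1 := addI _ _ _ fin e1.
  have mulI (u v : \bar R) : (2 ^- m)%:E * u = (2 ^- m)%:E * v -> u = v.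
    move=> /(congr1 (fun z => (2 ^+ m)%:E * z)).
    by rewrite !muleA -EFinM divff ?mul1e// lt0r_neq0// exprn_gt0.
  exact: mulI _ _ e1.
have l1 : \int[P]_w (expeN (S h w) * qexp m (S g w)) @[m --> \oo] --> \int[P]_w (expeN (S h w) * S g w).
  apply: (cvg_integral_qexp (D := fun _ => S g)).
  - by apply: (measurableT_comp (@measurable_expeN R)); exact: mS.
  - by move=> w; exact: expeN_ge0.
  - by move=> w; apply: expeN_fin_num; exact: S_ge0.
  - by move=> _; exact: mS.
  - by move=> _ w; exact: S_ge0.
  - by move=> w i j _.
  - by move=> w; exact: cvg_cst.
have l2 : \int[Q]_a (expeN (palm_exponent eps h (- a)%R) * qexp m (dA m (- a)%R)) @[m --> \oo] -->
    \int[Q]_a (expeN (palm_exponent eps h (- a)%R) * palm_weight (- a)%R).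
  apply: (cvg_integral_qexp (D := fun m (a : E) => dA m (- a)%R)).
  - exact: mEA.
  - by move=> a; exact: expeN_ge0.
  - by move=> a; apply: expeN_fin_num; exact: Ah0.
  - by move=> m; apply: mneg; exact: mdA.
  - by move=> m a; exact: dA_ge0.
  - move=> a i j ij; apply: leeD; first exact: nd_dalpha.
    by case: eps; [exact: nd_dbeta|exact: lexx].
  - move=> a; apply: cvgeD; last 2 first.
    + exact: cvg_dalpha.
    + by case: eps; [exact: cvg_dbeta|exact: cvg_cst].
    + apply: ge0_adde_def; rewrite inE.
        apply: mule_ge0; first by rewrite lee_fin.
        apply: integral_ge0 => x _; apply: mule_ge0; first exact: expeN_ge0.
        exact: cluster_weight_ge0.
      by case: eps => //; exact: cluster_weight_ge0.
rewrite -(cvg_lim (@ereal_hausdorff R) l1) -(cvg_lim (@ereal_hausdorff R) l2).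
by congr (limn _); apply/funext => m; exact: step.
Qed.

End first_order.
End increments.
End cluster_functionals.

Lemma measurable_step (R : realType) d1 d2 (T1 : measurableType d1) (T2 : measurableType d2)
    (J : finType) (a : T1 -> J) (k : J -> T2 -> R) :
  (forall j, measurable (a @^-1` [set j])) -> (forall j, measurable_fun setT (k j)) ->
  measurable_fun setT (fun z : T1 * T2 => k (a z.1) z.2).
Proof.
move=> ma mk.
rewrite (_ : (fun z => _) = fun z : T1 * T2 =>
    \sum_(j <- index_enum J) \1_(a @^-1` [set j]) z.1 * k j z.2); last first.
  apply/funext => z; rewrite (bigD1 (a z.1))//= indicE mem_set// mul1r big1 ?addr0// => j jx.
  by rewrite indicE memNset ?mul0r//= => /eqP; rewrite eq_sym (negbTE jx).
have mind j : measurable_fun setT (fun x => (\1_(a @^-1` [set j]) x : R)).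
  exact: measurable_indic.
apply: measurable_sum => j; apply: measurable_funM.
  exact: (measurableT_comp (mind j) measurable_fst).
exact: (measurableT_comp (mk j) measurable_snd).
Qed.

Section admissible.
Context (R : realType) (n : nat).
Local Notation E := 'rV[R]_n.
Local Open Scope ereal_scope.

Definition box_bounded (c : nat) (g : E -> R) :=
  forall x, (0 <= g x <= c%:R * \1_(@cube_rV R n c%:R) x)%R.

Record admissible (I : (E -> R) -> (E * E -> R) -> \bar R) : Prop := Admissible {
  admissible_partition : forall (J : finType) (a : E -> J) (k : J -> E -> R) (g : E -> R),
    (forall j, measurable (a @^-1` [set j])) ->
    (forall j, measurable_fun setT (k j)) -> (forall j x, 0 <= k j x)%R ->
    measurable_fun setT g -> (forall x, 0 <= g x)%R ->
    I g (fun z => k (a z.1) z.2) =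
    \sum_(j <- index_enum J) I (fun x => g x * \1_(a @^-1` [set j]) x)%R (fun z => k j z.2) ;
  admissible_bounded : forall (c : nat) (g : E -> R) (h_ : nat -> E * E -> R) (h : E * E -> R),
    measurable_fun setT g -> box_bounded c g ->
    (forall m, measurable_fun setT (h_ m)) -> measurable_fun setT h ->
    (forall m y, box_bounded c (fun z => h_ m (y, z))) ->
    (forall z, h_ m z @[m --> \oo] --> h z) ->
    I g (h_ m) @[m --> \oo] --> I g h ;
  admissible_nondecreasing : forall (c : nat) (g : E -> R) (h_ : nat -> E * E -> R) (h : E * E -> R),
    measurable_fun setT g -> box_bounded c g ->
    (forall m, measurable_fun setT (h_ m)) -> measurable_fun setT h ->
    (forall m z, 0 <= h_ m z)%R ->
    (forall z, nondecreasing_seq (h_ ^~ z)) ->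
    (forall z, h_ m z @[m --> \oo] --> h z) ->
    I g (h_ m) @[m --> \oo] --> I g h ;
  admissible_weight : forall (g_ : nat -> E -> R) (g : E -> R) (h : E * E -> R),
    (forall m, measurable_fun setT (g_ m)) -> measurable_fun setT g ->
    (forall m z, 0 <= g_ m z)%R -> (forall z, nondecreasing_seq (g_ ^~ z)) ->
    (forall z, g_ m z @[m --> \oo] --> g z) ->
    measurable_fun setT h -> (forall z, 0 <= h z)%R ->
    I (g_ m) h @[m --> \oo] --> I g h }.

Definition box_clamp (c : nat) (x : E) (r : R) : R :=
  (clamp c%:R r * \1_(@cube_rV R n c%:R) x)%R.

Lemma box_clamp_ge0 c x r : (0 <= box_clamp c x r)%R.
Proof. by rewrite /box_clamp mulr_ge0// ?clamp_ge0// indicE. Qed.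

Lemma box_bounded_clamp c (f : E -> R) : box_bounded c (fun x => box_clamp c x (f x)).
Proof. by move=> x; rewrite box_clamp_ge0/= ler_wpM2r ?clamp_le// indicE. Qed.

Lemma le_indic_cube (c c' : nat) (x : E) : (c <= c')%N ->
  (\1_(@cube_rV R n c%:R) x <= \1_(@cube_rV R n c'%:R) x :> R)%R.
Proof.
move=> cc'; rewrite !indicE; have [xc|xc] := boolP (x \in @cube_rV R n c%:R); last exact: ler0n.
suff -> : x \in @cube_rV R n c'%:R by [].
by move: xc; rewrite !inE; apply: cube_rV_homo; rewrite ler_nat.
Qed.

Lemma nd_box_clamp x r : (0 <= r)%R ->
  {homo (fun c : nat => box_clamp c x r) : m p / (m <= p)%N >-> (m <= p)%R}.
Proof.
move=> r0 m p mp; rewrite /box_clamp; apply: ler_pM; rewrite ?clamp_ge0//.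
  exact: nd_clamp.
exact: le_indic_cube.
Qed.

Lemma cvg_box_clamp x r : (0 <= r)%R -> box_clamp c x r @[c --> \oo] --> r.
Proof.
move=> r0; have [k _ kx] : (\bigcup_k @cube_rV R n k%:R) x by rewrite cube_rV_cover.
rewrite -[X in _ --> X]mulr1; apply: cvgM; first exact: cvg_clamp.
apply: cvg_near_cst; near=> m; rewrite indicE mem_set//.
apply: cube_rV_homo kx; rewrite ler_nat; near: m; by exists k.
Unshelve. all: by end_near. Qed.

Lemma box_boundedS c c' g : (c <= c')%N -> box_bounded c g -> box_bounded c' g.
Proof.
move=> cc' bg x; have /andP[-> h] := bg x; rewrite (le_trans h)//.
apply: ler_pM => //; first by rewrite ler_nat.
exact: le_indic_cube.
Qed.

Lemma measurable_box_clamp d (T : measurableType d) (c : nat) (u : T -> E) (f : T -> R) :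
  measurable_fun setT u -> measurable_fun setT f ->
  measurable_fun setT (fun x => box_clamp c (u x) (f x)).
Proof.
move=> mu mf; apply: measurable_funM.
  exact: (measurableT_comp (@measurable_clamp R c%:R) mf).
have mc : measurable_fun setT (fun x => \1_(@cube_rV R n c%:R) x : R).
  by apply: measurable_indic; exact: measurable_cube_rV.
exact: (measurableT_comp mc mu).
Qed.

Theorem admissible_unique I1 I2 : admissible I1 -> admissible I2 ->
  (forall g h : E -> R, measurable_fun setT g -> measurable_fun setT h ->
    (forall x, 0 <= g x)%R -> (forall x, 0 <= h x)%R ->
    I1 g (fun z => h z.2) = I2 g (fun z => h z.2)) ->
  forall (g : E -> R) (h : E * E -> R), measurable_fun setT g -> measurable_fun setT h ->
    (forall x, 0 <= g x)%R -> (forall z, 0 <= h z)%R ->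
    I1 g h = I2 g h.
Proof.
move=> adm1 adm2 I12.
have bounded c (g : E -> R) (f : E * E -> R) : measurable_fun setT g -> box_bounded c g ->
    baire f -> measurable_fun setT f /\
    I1 g (fun z => box_clamp c z.2 (f z)) = I2 g (fun z => box_clamp c z.2 (f z)).
  move=> mg bg; have g0 x : (0 <= g x)%R by have /andP[] := bg x.
  elim=> {f} [J a k ma mk|f_ f _ IH ff].
    split; first by apply: (measurable_step ma mk).
    have mk' j : measurable_fun setT (fun x => box_clamp c x (k j x)).
      exact: measurable_box_clamp.
    have k0 j x : (0 <= box_clamp c x (k j x))%R by exact: box_clamp_ge0.
    rewrite (admissible_partition adm1 ma mk' k0 mg g0).
    rewrite (admissible_partition adm2 ma mk' k0 mg g0).
    apply: eq_bigr => j _; apply: (I12 _ (fun x => box_clamp c x (k j x))) => //.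
    - by apply: measurable_funM => //; exact: measurable_indic.
    - by move=> x; rewrite mulr_ge0// indicE.
  have mf : measurable_fun setT f.
    by apply: (measurable_fun_cvg (h := f_)) => [m|z _]; [exact: (IH m).1|exact: ff].
  split => //.
  have l I : admissible I -> I g (fun z => box_clamp c z.2 (f_ m z)) @[m --> \oo] -->
      I g (fun z => box_clamp c z.2 (f z)).
    move=> adm; apply: (@admissible_bounded _ adm c) => //.
    - by move=> m; apply: measurable_box_clamp => //; exact: (IH m).1.
    - exact: measurable_box_clamp.
    - by move=> m y; exact: box_bounded_clamp.
    - move=> z; apply: cvgMl.
      exact: (cvg_comp _ _ (ff z) (@continuous_clamp R c%:R (f z))).
  rewrite -(cvg_lim (@ereal_hausdorff R) (l _ adm1)) -(cvg_lim (@ereal_hausdorff R) (l _ adm2)).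
  by congr (limn _); apply/funext => m; have [] := IH m.
have unbounded c (g : E -> R) (h : E * E -> R) : measurable_fun setT g -> box_bounded c g ->
    measurable_fun setT h -> (forall z, 0 <= h z)%R -> I1 g h = I2 g h.
  move=> mg bg mh h0.
  have l I : admissible I -> I g (fun z => box_clamp (m + c) z.2 (h z)) @[m --> \oo] --> I g h.
    move=> adm; apply: (@admissible_nondecreasing _ adm c) => //.
    - by move=> m; exact: measurable_box_clamp.
    - by move=> m z; exact: box_clamp_ge0.
    - by move=> z m p mp; apply: nd_box_clamp => //; rewrite leq_add2r.
    - by move=> z; rewrite (cvg_shiftn c (fun m => box_clamp m z.2 (h z))); exact: cvg_box_clamp.
  rewrite -(cvg_lim (@ereal_hausdorff R) (l _ adm1)) -(cvg_lim (@ereal_hausdorff R) (l _ adm2)).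
  congr (limn _); apply/funext => m.
  have [] // := bounded (m + c)%N g h mg _ (measurable_baire mh h0).
  by apply: box_boundedS bg; rewrite leq_addl.
move=> g h mg mh g0 h0.
have l I : admissible I -> I (fun x => box_clamp m x (g x)) h @[m --> \oo] --> I g h.
  move=> adm; apply: (@admissible_weight _ adm) => //.
  - by move=> m; exact: measurable_box_clamp.
  - by move=> m z; exact: box_clamp_ge0.
  - by move=> z m p mp; exact: nd_box_clamp.
  - by move=> z; exact: cvg_box_clamp.
rewrite -(cvg_lim (@ereal_hausdorff R) (l _ adm1)) -(cvg_lim (@ereal_hausdorff R) (l _ adm2)).
congr (limn _); apply/funext => m; apply: (unbounded m) => //.
- exact: measurable_box_clamp.
- exact: box_bounded_clamp.
Qed.

Lemma admissibleD (I1 I2 : (E -> R) -> (E * E -> R) -> \bar R) (k1 k2 : R) :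
  (forall g h, (forall x, 0 <= g x)%R -> 0 <= I1 g h) ->
  (forall g h, (forall x, 0 <= g x)%R -> 0 <= I2 g h) ->
  (0 <= k1)%R -> (0 <= k2)%R -> admissible I1 -> admissible I2 ->
  admissible (fun g h => k1%:E * I1 g h + k2%:E * I2 g h).
Proof.
move=> I10 I20 k10 k20 adm1 adm2.
have cvg (u v : nat -> \bar R) (l l' : \bar R) : u @ \oo --> l -> v @ \oo --> l' ->
    0 <= l -> 0 <= l' -> k1%:E * u m + k2%:E * v m @[m --> \oo] --> k1%:E * l + k2%:E * l'.
  move=> ul vl l0 l'0; apply: cvgeD; [|exact: cvgeZl|exact: cvgeZl].
  by apply: ge0_adde_def; rewrite inE mule_ge0.
have bounded_ge0 c (g : E -> R) : box_bounded c g -> forall x, (0 <= g x)%R.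
  by move=> bg x; have /andP[] := bg x.
split.
- move=> J a k g ma mk k0 mg g0.
  rewrite (admissible_partition adm1 ma mk k0 mg g0) (admissible_partition adm2 ma mk k0 mg g0).
  have g10 j x : (0 <= g x * \1_(a @^-1` [set j]) x)%R by rewrite mulr_ge0// indicE.
  rewrite big_split/= !ge0_sume_distrr// => j _.
    exact: I20 (g10 j).
  exact: I10 (g10 j).
- move=> c g h_ h mg bg mh_ mh bh hh; apply: cvg.
  + exact: (admissible_bounded adm1 mg bg mh_ mh bh hh).
  + exact: (admissible_bounded adm2 mg bg mh_ mh bh hh).
  + by apply: I10; exact: bounded_ge0 bg.
  + by apply: I20; exact: bounded_ge0 bg.
- move=> c g h_ h mg bg mh_ mh h0 ndh hh; apply: cvg.
  + exact: (admissible_nondecreasing adm1 mg bg mh_ mh h0 ndh hh).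
  + exact: (admissible_nondecreasing adm2 mg bg mh_ mh h0 ndh hh).
  + by apply: I10; exact: bounded_ge0 bg.
  + by apply: I20; exact: bounded_ge0 bg.
- move=> g_ g h mg_ mg g0 ndg gg mh h0.
  have gl0 x : (0 <= g x)%R.
    rewrite -(cvg_lim _ (gg x))//; apply: limr_ge; first by apply/cvg_ex; exists (g x).
    exact: nearW.
  apply: cvg.
  + exact: (admissible_weight adm1 mg_ mg g0 ndg gg mh h0).
  + exact: (admissible_weight adm2 mg_ mg g0 ndg gg mh h0).
  + exact: I10.
  + exact: I20.
Qed.

Section discounted_integral.
Context d (X : measurableType d) (m : {measure set X -> \bar R}).
Variables (Y : X -> E) (wt : X -> R) (D : (E * E -> R) -> X -> \bar R).
Hypotheses (mY : measurable_fun setT Y) (mwt : measurable_fun setT wt).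
Hypothesis wt0 : forall x, (0 <= wt x)%R.
Hypothesis D_ge0 : forall (h : E * E -> R) x, (forall z, 0 <= h z)%R -> 0 <= D h x.
Hypothesis mD : forall h : E * E -> R, measurable_fun setT h -> (forall z, 0 <= h z)%R -> measurable_fun setT (D h).
Hypothesis D_local : forall (h h' : E * E -> R) x, (forall z, h (Y x, z) = h' (Y x, z)) -> D h x = D h' x.
Hypothesis wt_fin : forall c : nat, \int[m]_x (wt x * \1_(@cube_rV R n c%:R) (Y x))%:E < +oo.
Hypothesis D_bounded : forall (c : nat) (h_ : nat -> E * E -> R) (h : E * E -> R),
    (forall p, measurable_fun setT (h_ p)) -> measurable_fun setT h ->
    (forall p y, box_bounded c (fun z => h_ p (y, z))) ->
    (forall z, h_ p z @[p --> \oo] --> h z) ->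
    {ae m, forall x, D (h_ p) x @[p --> \oo] --> D h x}.
Hypothesis D_nondecreasing : forall (h_ : nat -> E * E -> R) (h : E * E -> R),
    (forall p, measurable_fun setT (h_ p)) -> measurable_fun setT h ->
    (forall p z, 0 <= h_ p z)%R ->
    (forall z, nondecreasing_seq (h_ ^~ z)) ->
    (forall z, h_ p z @[p --> \oo] --> h z) ->
    forall x, D (h_ p) x @[p --> \oo] --> D h x.

Definition discounted_integral (g : E -> R) (h : E * E -> R) : \bar R :=
  \int[m]_x ((wt x * g (Y x))%:E * expeN (D h x)).

Let mwg (g : E -> R) : measurable_fun setT g -> measurable_fun setT (fun x => (wt x * g (Y x))%:E).
Proof.
move=> mg; apply/measurable_EFinP; apply: measurable_funM => //.
exact: (measurableT_comp mg mY).
Qed.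

Let mE (h : E * E -> R) : measurable_fun setT h -> (forall z, 0 <= h z)%R -> measurable_fun setT (fun x => expeN (D h x)).
Proof. by move=> mh h0; exact: (measurableT_comp (@measurable_expeN R) (mD mh h0)). Qed.

Let minteg (g : E -> R) (h : E * E -> R) : measurable_fun setT g -> measurable_fun setT h -> (forall z, 0 <= h z)%R ->
  measurable_fun setT (fun x => (wt x * g (Y x))%:E * expeN (D h x)).
Proof. by move=> mg mh h0; apply: emeasurable_funM; [exact: mwg|exact: mE]. Qed.

Lemma discounted_integral_cube_lty (c : nat) (h : E * E -> R) : measurable_fun setT h ->
  (forall z, 0 <= h z)%R -> discounted_integral (\1_(@cube_rV R n c%:R)) h < +oo.
Proof.
move=> mh h0.
have mc : measurable_fun setT (\1_(@cube_rV R n c%:R) : E -> R).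
  by apply: measurable_indic; exact: measurable_cube_rV.
apply: le_lt_trans (wt_fin c); apply: ge0_le_integral.
- exact: measurableT.
- move=> x _; apply: mule_ge0; last exact: expeN_ge0.
  by rewrite lee_fin mulr_ge0// indicE.
- exact: minteg.
- exact: mwg.
- move=> x _; rewrite -[leRHS]mule1; apply: lee_wpmul2l; last exact: expeN_le1 (D_ge0 _ _).
  by rewrite lee_fin mulr_ge0// indicE.
Qed.

Let dominated (c : nat) (g : E -> R) (h_ : nat -> E * E -> R) (h : E * E -> R) :
  measurable_fun setT g -> box_bounded c g ->
  (forall p, measurable_fun setT (h_ p)) -> measurable_fun setT h ->
  (forall p z, 0 <= h_ p z)%R -> (forall z, 0 <= h z)%R ->
  {ae m, forall x, D (h_ p) x @[p --> \oo] --> D h x} ->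
  discounted_integral g (h_ p) @[p --> \oo] --> discounted_integral g h.
Proof.
move=> mg bg mh_ mh h_0 h0 Dh.
have mc : measurable_fun setT (fun x => (\1_(@cube_rV R n c%:R) (Y x)) : R).
  apply: (measurableT_comp (f := fun x => \1_(@cube_rV R n c%:R) x : R)) => //.
  by apply: measurable_indic; exact: measurable_cube_rV.
have mb : measurable_fun setT (fun x => (wt x * \1_(@cube_rV R n c%:R) (Y x))%:E).
  by apply/measurable_EFinP; exact: measurable_funM.
apply: (@ge0_dominated_cvg _ _ _ _ _ _ (fun x => c%:R%:E * (wt x * \1_(@cube_rV R n c%:R) (Y x))%:E)).
- by move=> p; exact: minteg.
- exact: minteg.
- exact: measurable_funeM.
- rewrite ge0_integralZl//.
  + apply: lte_mul_pinfty => //.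
  + by move=> x _; rewrite lee_fin mulr_ge0// indicE.
- move=> p x; have /andP[g0 gc] := bg (Y x); apply/andP; split.
    by apply: mule_ge0; [rewrite lee_fin mulr_ge0|exact: expeN_ge0].
  rewrite -EFinM -[leRHS]mule1; apply: lee_pmul.
  + by rewrite lee_fin mulr_ge0.
  + exact: expeN_ge0.
  + by rewrite lee_fin mulrCA ler_wpM2l.
  + by apply: expeN_le1; exact: D_ge0.
- apply: filterS Dh => x Dx; apply: cvgeZl => //.
  by apply: cvg_expeN => // p; exact: D_ge0.
Qed.

Lemma admissible_discounted_integral : admissible discounted_integral.
Proof.
split.
- move=> J a k g ma mk k0 mg g0; rewrite /discounted_integral.
  rewrite -ge0_integral_sum//.
  + apply: eq_integral => x _.
    rewrite (bigD1 (a (Y x)))//= indicE mem_set// mulr1 big1 ?adde0.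
      by congr (_ * expeN _); exact: D_local.
    by move=> j jx; rewrite indicE memNset ?mulr0 ?mul0e//= => /eqP; rewrite eq_sym (negbTE jx).
  + move=> j; apply: (@minteg (fun x => g x * \1_(a @^-1` [set j]) x)%R (fun z => k j z.2)).
    * by apply: measurable_funM => //; exact: measurable_indic.
    * exact: (measurableT_comp (mk j) measurable_snd).
    * by move=> z; exact: k0.
  + move=> j x _; apply: mule_ge0; last exact: expeN_ge0.
    by rewrite lee_fin !mulr_ge0// indicE.
- move=> c g h_ h mg bg mh_ mh bh hh.
  have h_0 p z : (0 <= h_ p z)%R by case: z => y z; have /andP[] := bh p y z.
  apply: (dominated mg bg) => //.
    move=> z; rewrite -(cvg_lim _ (hh z))//; apply: limr_ge; first by apply/cvg_ex; exists (h z).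
    exact: nearW.
  exact: (D_bounded mh_ mh bh).
- move=> c g h_ h mg bg mh_ mh h0 ndh hh.
  apply: (dominated mg bg) => //.
    move=> z; rewrite -(cvg_lim _ (hh z))//; apply: limr_ge; first by apply/cvg_ex; exists (h z).
    exact: nearW.
  by apply: aeW => x; exact: (D_nondecreasing mh_ mh).
- move=> g_ g h mg_ mg g0 ndg gg mh h0.
  have -> : discounted_integral g h = \int[m]_x limn (fun p => (wt x * g_ p (Y x))%:E * expeN (D h x)).
    apply: eq_integral => x _; apply/esym/cvg_lim => //.
    apply: cvgeZr; first by apply: expeN_fin_num; exact: D_ge0.
    by apply: cvg_EFin; [exact: nearW|exact: (cvgM (cvg_cst _) (gg (Y x)))].
  apply: cvg_monotone_convergence => //.
  + by move=> p; exact: minteg.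
  + by move=> p x _; apply: mule_ge0; [rewrite lee_fin mulr_ge0|exact: expeN_ge0].
  + move=> x _ p q pq; apply: lee_wpmul2r; first exact: expeN_ge0.
    by rewrite lee_fin ler_wpM2l// ndg.
Qed.

End discounted_integral.
End admissible.

Section cluster_discount.
Context (R : realType) (n : nat).
Local Notation E := 'rV[R]_n.
Variables (lambda mu : R) (Q : probability E R).
Variables (L : {sigma_finite_measure set E -> \bar R}).
Hypotheses (lambda_ge0 : 0 <= lambda) (mu_ge0 : 0 <= mu).
Hypothesis L_shift : forall (c : E) (A : set E), measurable A ->
  L ((fun x => x + c) @^-1` A) = L A.
Hypothesis L_cube : forall c : nat, (L (@cube_rV R n c%:R) < +oo)%E.
Local Open Scope ereal_scope.

Local Notation beta := (cluster_exponent mu Q).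
Local Notation alpha := (process_exponent lambda mu Q L).
Local Notation palm := (palm_exponent lambda mu Q L).

Definition slice (h : E * E -> R) (y : E) : E -> R := fun z => h (y, z).

Let onem_ge0 (r : R) : (0 <= r)%R -> (0 <= 1 - expR (- r))%R.
Proof. by move=> r0; rewrite subr_ge0 expR_le1 lerNl oppr0. Qed.

Let onem_le1 (r : R) : (0 <= r)%R -> (1 - expR (- r) <= 1)%R.
Proof. by move=> r0; rewrite gerBl expR_ge0. Qed.

Lemma measurable_slice h y : measurable_fun setT h -> measurable_fun setT (slice h y).
Proof.
move=> mh; exact: (measurable_comp2 mh (measurable_cst y) (@measurable_id _ _ _)).
Qed.

Lemma measurable_shift_cst (f : E -> R) (x : E) : measurable_fun setT f ->
  measurable_fun setT (fun c => f (x + c)%R).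
Proof. by move=> mf; apply: (measurableT_comp mf); exact: measurable_rV_add. Qed.

Lemma cvg_cluster_exponent (k_ : nat -> E -> R) (k : E -> R) (x : E) :
  (forall p, measurable_fun setT (k_ p)) -> measurable_fun setT k ->
  (forall p z, 0 <= k_ p z)%R -> (forall z, k_ p z @[p --> \oo] --> k z) ->
  beta (k_ p) x @[p --> \oo] --> beta k x.
Proof.
move=> mk_ mk k_0 kk; apply: cvgeZl => //.
apply: (@ge0_dominated_cvg _ _ _ _ _ _ (cst 1)).
- move=> p; apply/measurable_EFinP.
  apply: (@measurable_shift_cst (fun z => 1 - expR (- k_ p z))%R).
  exact: measurable_onem.
- apply/measurable_EFinP.
  apply: (@measurable_shift_cst (fun z => 1 - expR (- k z))%R).
  exact: measurable_onem.
- exact: measurable_cst.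
- by rewrite integral_cst// mul1e; exact: fin_num_fun_lty.
- by move=> p c; rewrite !lee_fin onem_ge0//= onem_le1.
- apply: aeW => c; apply: cvg_EFin; first exact: nearW.
  apply: cvgB; first exact: cvg_cst.
  apply: continuous_cvg; first exact: continuous_expR.
  exact: cvgN.
Qed.

Lemma integral_L_shift (f : E -> \bar R) (c : E) : measurable_fun setT f ->
  (forall x, 0 <= f x) -> \int[L]_x f (x + c)%R = \int[L]_x f x.
Proof.
move=> mf f0.
have mc : measurable_fun setT (fun x : E => x + c)%R by apply: measurable_rV_add => //; exact: measurable_cst.
have := @ge0_integral_pushforward _ _ _ _ _ _ mc L setT f measurableT mf (fun _ _ => f0 _).
rewrite preimage_setT => <-; apply: eq_measure_integral => D mD _; exact: L_shift.
Qed.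

Lemma integral_L_cluster (f : E -> \bar R) : measurable_fun setT f -> (forall x, 0 <= f x) ->
  \int[L]_x \int[Q]_c f (x + c)%R = \int[L]_x f x.
Proof.
move=> mf f0.
have m2 : measurable_fun setT (fun z : E * E => f (z.1 + z.2)%R).
  by apply: (measurableT_comp mf); exact: measurable_rV_add.
rewrite (fubini_tonelli (fun z : E * E => f (z.1 + z.2)%R))//=.
rewrite (eq_integral (cst (\int[L]_x f x))); last first.
  by move=> c _; exact: integral_L_shift.
by rewrite integral_cst// -[RHS]mule1; congr (_ * _); exact: probability_setT.
Qed.

Let mcube (c : nat) : measurable_fun setT (fun x => (\1_(@cube_rV R n c%:R) x)%:E : \bar R).
Proof. by apply/measurable_EFinP; apply: measurable_indic; exact: measurable_cube_rV. Qed.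

Let integral_L_cube (c : nat) : \int[L]_x (\1_(@cube_rV R n c%:R) x)%:E < +oo.
Proof.
rewrite integral_indic; [|exact: measurableT|exact: measurable_cube_rV].
rewrite setIT; exact: L_cube.
Qed.

Lemma cvg_process_exponent_bounded (c : nat) (k_ : nat -> E -> R) (k : E -> R) :
  (forall p, measurable_fun setT (k_ p)) -> measurable_fun setT k ->
  (forall p, box_bounded c (k_ p)) -> (forall z, 0 <= k z)%R ->
  (forall z, k_ p z @[p --> \oo] --> k z) ->
  alpha (k_ p) @[p --> \oo] --> alpha k.
Proof.
move=> mk_ mk bk k0 kk; apply: cvgeZl => //.
have k_0 p z : (0 <= k_ p z)%R by have /andP[] := bk p z.
have mint (f : E -> R) : measurable_fun setT f -> (forall z, 0 <= f z)%R ->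
    measurable_fun setT (fun x => 1 - expeN (beta f x)).
  move=> mf f0; apply: emeasurable_funB; first exact: measurable_cst.
  by apply: (measurableT_comp (@measurable_expeN R)); exact: measurable_cluster_exponent.
have mG : measurable_fun setT (fun x : E => \int[Q]_c' (\1_(@cube_rV R n c%:R) (x + c')%R)%:E).
  apply: (@measurable_integral_shift R n Q (\1_(@cube_rV R n c%:R))).
    by apply: measurable_indic; exact: measurable_cube_rV.
  by move=> z; rewrite indicE.
pose G x := mu%:E * \int[Q]_c' (\1_(@cube_rV R n c%:R) (x + c')%R)%:E.
apply: (@ge0_dominated_cvg _ _ _ _ _ _ G).
- by move=> p; apply: mint.
- exact: mint.
- apply: measurable_funeM.
  exact: mG.
- rewrite ge0_integralZl//.
  + apply: lte_mul_pinfty; [by rewrite lee_fin|by []|].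
    by rewrite (integral_L_cluster (f := fun x => (\1_(@cube_rV R n c%:R) x)%:E)).
  + by move=> x _; apply: integral_ge0 => c' _; rewrite lee_fin indicE.
- move=> p x; have b0 := cluster_exponent_ge0 Q mu_ge0 x (k_0 p).
  rewrite sube_ge0 ?expeN_fin_num// expeN_le1//=.
  apply: (@le_trans _ _ (beta (k_ p) x)).
    have := qexp_le 0 b0; rewrite /qexp expr0 invr1 !mul1e; exact.
  apply: lee_wpmul2l; first by rewrite lee_fin.
  apply: ge0_le_integral.
  + exact: measurableT.
  + by move=> c' _; rewrite lee_fin onem_ge0.
  + by apply/measurable_EFinP; apply: (@measurable_shift_cst (fun z => 1 - expR (- k_ p z))%R);
      exact: measurable_onem.
  + apply/measurable_EFinP; apply: (@measurable_shift_cst (\1_(@cube_rV R n c%:R))).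
    by apply: measurable_indic; exact: measurable_cube_rV.
  + move=> c' _; rewrite lee_fin indicE; have [xc|xc] := boolP ((x + c')%R \in @cube_rV R n c%:R).
      exact: onem_le1.
    have /andP[_] := bk p (x + c')%R; rewrite indicE (negbTE xc) mulr0 => kle.
    have -> : k_ p (x + c')%R = 0%R by apply/le_anti/andP; split.
    by rewrite oppr0 expR0 subrr.
- apply: aeW => x; apply: cvgeB; first exact: fin_num_adde_defr.
    exact: cvg_cst.
  apply: cvg_expeN; first by move=> p; exact: cluster_exponent_ge0.
  exact: cvg_cluster_exponent.
Qed.

Lemma cvg_process_exponent_nondecreasing (k_ : nat -> E -> R) (k : E -> R) :
  (forall p, measurable_fun setT (k_ p)) -> measurable_fun setT k ->
  (forall p z, 0 <= k_ p z)%R -> (forall z, nondecreasing_seq (k_ ^~ z)) ->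
  (forall z, k_ p z @[p --> \oo] --> k z) ->
  alpha (k_ p) @[p --> \oo] --> alpha k.
Proof.
move=> mk_ mk k_0 ndk kk; apply: cvgeZl => //.
have b0 p x := cluster_exponent_ge0 Q mu_ge0 x (k_0 p).
rewrite [X in _ --> X](_ : _ = \int[L]_x limn (fun p => 1 - expeN (beta (k_ p) x))); last first.
  apply: eq_integral => x _; apply/esym/cvg_lim => //.
  apply: cvgeB; first exact: fin_num_adde_defr.
    exact: cvg_cst.
  by apply: cvg_expeN => //; exact: cvg_cluster_exponent.
apply: cvg_monotone_convergence.
- exact: measurableT.
- move=> p; apply: emeasurable_funB; first exact: measurable_cst.
  by apply: (measurableT_comp (@measurable_expeN R)); exact: measurable_cluster_exponent.
- by move=> p x _; rewrite sube_ge0 ?expeN_fin_num// expeN_le1.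
- move=> x _ p q pq; apply: leeB; first exact: lexx.
  rewrite le_expeN.
  apply: lee_wpmul2l; first by rewrite lee_fin.
  apply: ge0_le_integral.
  + exact: measurableT.
  + by move=> c' _; rewrite lee_fin onem_ge0.
  + by apply/measurable_EFinP; apply: (@measurable_shift_cst (fun z => 1 - expR (- k_ p z))%R);
      exact: measurable_onem.
  + by apply/measurable_EFinP; apply: (@measurable_shift_cst (fun z => 1 - expR (- k_ q z))%R);
      exact: measurable_onem.
  + by move=> c' _; rewrite lee_fin lerD2l lerN2 ler_expR lerN2; exact: ndk.
Qed.

Lemma measurable_slice_cluster_exponent (h : E * E -> R) : measurable_fun setT h ->
  (forall z, 0 <= h z)%R ->
  measurable_fun setT (fun yx : E * E => beta (slice h yx.1) yx.2).
Proof.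
move=> mh h0; apply: measurable_funeM.
apply: (@measurable_fun_fubini_tonelli_F _ _ _ _ _ Q
  (fun z : (E * E) * E => (1 - expR (- h (z.1.1, z.1.2 + z.2)))%:E)%R).
  apply/measurable_EFinP; apply: (@measurable_onem R _ _ (fun z : (E * E) * E => h (z.1.1, (z.1.2 + z.2)%R))).
  apply: (measurable_comp2 mh).
    exact: (measurableT_comp measurable_fst measurable_fst).
  apply: measurable_rV_add; last exact: measurable_snd.
  exact: (measurableT_comp measurable_snd measurable_fst).
by move=> z; rewrite lee_fin onem_ge0.
Qed.

Lemma measurable_slice_process_exponent (h : E * E -> R) : measurable_fun setT h ->
  (forall z, 0 <= h z)%R -> measurable_fun setT (fun y : E => alpha (slice h y)).
Proof.
move=> mh h0; apply: measurable_funeM.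
apply: (@measurable_fun_fubini_tonelli_F _ _ _ _ _ L
  (fun z : E * E => 1 - expeN (beta (slice h z.1) z.2))).
  apply: emeasurable_funB; first exact: measurable_cst.
  exact: (measurableT_comp (@measurable_expeN R) (measurable_slice_cluster_exponent mh h0)).
move=> z; have b0 := cluster_exponent_ge0 Q mu_ge0 z.2 (fun x => h0 (z.1, x)).
by rewrite sube_ge0 ?expeN_fin_num// expeN_le1.
Qed.

Lemma measurable_slice_palm_exponent eps (h : E * E -> R) : measurable_fun setT h ->
  (forall z, 0 <= h z)%R -> measurable_fun setT (fun yt : E * E => palm eps (slice h yt.1) yt.2).
Proof.
move=> mh h0; apply: emeasurable_funD.
  exact: (measurableT_comp (measurable_slice_process_exponent mh h0) measurable_fst).
by case: eps; [exact: measurable_slice_cluster_exponent|exact: measurable_cst].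
Qed.


Variable eps : bool.

Definition diagonal_discount (h : E * E -> R) (y t : E) : \bar R :=
  (h (y, y))%:E + palm eps (slice h y) t.

Lemma diagonal_discount_ge0 h y t : (forall z, 0 <= h z)%R -> 0 <= diagonal_discount h y t.
Proof.
move=> h0; apply: adde_ge0; first by rewrite lee_fin.
by apply: palm_exponent_ge0 => // z; exact: h0.
Qed.

Lemma measurable_diagonal_discount (h : E * E -> R) : measurable_fun setT h ->
  (forall z, 0 <= h z)%R ->
  measurable_fun setT (fun yt : E * E => diagonal_discount h yt.1 yt.2).
Proof.
move=> mh h0; apply: emeasurable_funD; last exact: measurable_slice_palm_exponent.
apply/measurable_EFinP.
exact: (measurable_comp2 mh measurable_fst measurable_fst).
Qed.

Let diagonal_cvg (h_ : nat -> E * E -> R) (h : E * E -> R) (y t : E) :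
  (forall p, measurable_fun setT (h_ p)) -> measurable_fun setT h ->
  (forall p z, 0 <= h_ p z)%R -> (forall z, 0 <= h z)%R ->
  (forall z, h_ p z @[p --> \oo] --> h z) ->
  alpha (slice (h_ p) y) @[p --> \oo] --> alpha (slice h y) ->
  diagonal_discount (h_ p) y t @[p --> \oo] --> diagonal_discount h y t.
Proof.
move=> mh_ mh h_0 h0 hh ha; apply: cvgeD.
- apply: ge0_adde_def; rewrite inE; first by rewrite lee_fin.
  by apply: palm_exponent_ge0 => // z; exact: h0.
- by apply: cvg_EFin; [exact: nearW|exact: hh].
apply: cvgeD.
- apply: ge0_adde_def; rewrite inE; first by apply: process_exponent_ge0 => // z; exact: h0.
  by case: eps => //; apply: cluster_exponent_ge0 => // z; exact: h0.
- exact: ha.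
- case: eps; last exact: cvg_cst.
  apply: cvg_cluster_exponent.
  + by move=> p; exact: measurable_slice.
  + exact: measurable_slice.
  + by move=> p z; exact: h_0.
  + by move=> z; exact: hh.
Qed.

Let limit_ge0 (h_ : nat -> E * E -> R) (h : E * E -> R) : (forall p z, 0 <= h_ p z)%R ->
  (forall z, h_ p z @[p --> \oo] --> h z) -> forall z, (0 <= h z)%R.
Proof.
move=> h_0 hh z; rewrite -(cvg_lim _ (hh z))//; apply: limr_ge; first by apply/cvg_ex; exists (h z).
exact: nearW.
Qed.

Let alpha_bounded (c : nat) (h_ : nat -> E * E -> R) (h : E * E -> R) y :
  (forall p, measurable_fun setT (h_ p)) -> measurable_fun setT h ->
  (forall p y, box_bounded c (fun z => h_ p (y, z))) ->
  (forall z, h_ p z @[p --> \oo] --> h z) ->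
  alpha (slice (h_ p) y) @[p --> \oo] --> alpha (slice h y).
Proof.
move=> mh_ mh bh hh.
have h_0 p z : (0 <= h_ p z)%R by case: z => u v; have /andP[] := bh p u v.
apply: (@cvg_process_exponent_bounded c).
- by move=> p; exact: measurable_slice.
- exact: measurable_slice.
- by move=> p; exact: bh.
- by move=> z; exact: (limit_ge0 h_0 hh).
- by move=> z; exact: hh.
Qed.

Let alpha_nondecreasing (h_ : nat -> E * E -> R) (h : E * E -> R) y :
  (forall p, measurable_fun setT (h_ p)) -> measurable_fun setT h ->
  (forall p z, 0 <= h_ p z)%R -> (forall z, nondecreasing_seq (h_ ^~ z)) ->
  (forall z, h_ p z @[p --> \oo] --> h z) ->
  alpha (slice (h_ p) y) @[p --> \oo] --> alpha (slice h y).
Proof.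
move=> mh_ mh h_0 ndh hh; apply: cvg_process_exponent_nondecreasing.
- by move=> p; exact: measurable_slice.
- exact: measurable_slice.
- by move=> p z; exact: h_0.
- by move=> z p q pq; exact: ndh.
- by move=> z; exact: hh.
Qed.

Let own_location (ac : E * E) : E := (ac.2 - ac.1)%R.

Let own_discount (h : E * E -> R) (ac : E * E) : \bar R :=
  diagonal_discount h (own_location ac) (- ac.1)%R.

Definition own_cluster_integral := discounted_integral (Q \x Q)%E own_location (cst 1%R) own_discount.

Let measurable_own_location : measurable_fun setT own_location.
Proof. by apply: measurable_rV_sub. Qed.

Let measurable_own_discount (h : E * E -> R) : measurable_fun setT h -> (forall z, 0 <= h z)%R ->
  measurable_fun setT (own_discount h).
Proof.
move=> mh h0; apply: (measurable_comp2 (measurable_diagonal_discount mh h0)) => //.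
exact: measurable_rV_opp.
Qed.

Let measurable_cube_at d (X : measurableType d) (Y : X -> E) (c : nat) :
  measurable_fun setT Y -> measurable_fun setT (fun x => (1 * \1_(@cube_rV R n c%:R) (Y x))%:E : \bar R).
Proof.
move=> mY; apply/measurable_EFinP; apply: measurable_funM => //.
apply: (measurableT_comp (f := fun x => \1_(@cube_rV R n c%:R) x : R)) => //.
by apply: measurable_indic; exact: measurable_cube_rV.
Qed.

Let own_location_finite (c : nat) :
  \int[(Q \x Q)%E]_x (cst 1 x * \1_(@cube_rV R n c%:R) (own_location x))%:E < +oo.
Proof.
apply: (@le_lt_trans _ _ (\int[(Q \x Q)%E]_x cst 1 x)).
  apply: ge0_le_integral.
  + exact: measurableT.
  + by move=> x _; rewrite lee_fin mul1r indicE.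
  + exact: measurable_cube_at.
  + exact: measurable_cst.
  + by move=> x _; rewrite lee_fin mul1r indicE lern1 leq_b1.
rewrite (fubini_tonelli1 (cst 1)); [|exact: measurable_cst|by move=> x; exact: lee01].
rewrite (eq_integral (cst 1)); last first.
  move=> x _; rewrite /fubini_F integral_cst// mul1e; exact: probability_setT.
by rewrite integral_cst// mul1e; exact: fin_num_fun_lty.
Qed.

Lemma admissible_own_cluster_integral : admissible own_cluster_integral.
Proof.
apply: admissible_discounted_integral.
- exact: measurable_own_location.
- exact: measurable_cst.
- by move=> x.
- by move=> h x h0; exact: diagonal_discount_ge0.
- exact: measurable_own_discount.
- move=> h h' x hh; rewrite /own_discount /diagonal_discount hh.
  suff -> : slice h (own_location x) = slice h' (own_location x) by [].
  by apply/funext => z; exact: hh.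
- exact: own_location_finite.
- move=> c h_ h mh_ mh bh hh; apply: aeW => x.
  have h_0 p z : (0 <= h_ p z)%R by case: z => u v; have /andP[] := bh p u v.
  apply: diagonal_cvg => //; first exact: (limit_ge0 h_0 hh).
  exact: (alpha_bounded mh_ mh bh hh).
- move=> h_ h mh_ mh h_0 ndh hh x.
  apply: diagonal_cvg => //; first exact: (limit_ge0 h_0 hh).
  exact: (alpha_nondecreasing mh_ mh).
Qed.

Local Notation QQ := (product_subprobability (Q : subprobability E R, Q : subprobability E R)).

Lemma integral_two_offsets (f : E * E -> \bar R) : measurable_fun setT f ->
  (forall z, 0 <= f z) -> \int[QQ]_z f z = \int[Q]_a \int[Q]_c f (a, c).
Proof. by move=> mf f0; rewrite -[RHS](fubini_tonelli1 f mf f0). Qed.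

Let other_location (xac : E * (E * E)) : E := (xac.1 + xac.2.2)%R.

Let other_discount (h : E * E -> R) (xac : E * (E * E)) : \bar R :=
  diagonal_discount h (other_location xac) (- xac.2.1)%R +
  beta (slice h (other_location xac)) xac.1.

Definition other_cluster_integral :=
  discounted_integral (L \x QQ)%E other_location (cst 1%R) other_discount.

Let measurable_other_location : measurable_fun setT other_location.
Proof.
apply: measurable_rV_add => //; exact: (measurableT_comp _ measurable_snd).
Qed.

Let measurable_other_discount (h : E * E -> R) : measurable_fun setT h -> (forall z, 0 <= h z)%R ->
  measurable_fun setT (other_discount h).
Proof.
move=> mh h0; apply: emeasurable_funD.
  apply: (measurable_comp2 (measurable_diagonal_discount mh h0)) => //.
  by apply: measurable_rV_opp; exact: (measurableT_comp _ measurable_snd).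
apply: (measurable_comp2 (measurable_slice_cluster_exponent mh h0)) => //.
Qed.

Let other_location_finite (c : nat) :
  \int[(L \x QQ)%E]_x (cst 1 x * \1_(@cube_rV R n c%:R) (other_location x))%:E < +oo.
Proof.
rewrite fubini_tonelli1; last 2 first.
+ exact: measurable_cube_at.
+ by move=> x; rewrite lee_fin mul1r indicE.
rewrite (eq_integral (fun x : E => \int[Q]_c' (\1_(@cube_rV R n c%:R) (x + c')%R)%:E)); last first.
  move=> x _; rewrite /fubini_F integral_two_offsets; last 2 first.
  + by apply: measurable_cube_at; apply: measurable_rV_add => //; exact: measurable_snd.
  + by move=> z; rewrite lee_fin mul1r indicE.
  rewrite (eq_integral (cst (\int[Q]_c' (\1_(@cube_rV R n c%:R) (x + c')%R)%:E))); last first.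
    by move=> a _; apply: eq_integral => c' _; rewrite mul1r.
  rewrite integral_cst// [X in _ * X](_ : _ = 1); last exact: probability_setT.
  by rewrite mule1.
by rewrite (integral_L_cluster (f := fun x => (\1_(@cube_rV R n c%:R) x)%:E)).
Qed.

Lemma admissible_other_cluster_integral : admissible other_cluster_integral.
Proof.
apply: admissible_discounted_integral.
- exact: measurable_other_location.
- exact: measurable_cst.
- by move=> x.
- move=> h x h0; apply: adde_ge0; first exact: diagonal_discount_ge0.
  by apply: cluster_exponent_ge0 => // z; exact: h0.
- exact: measurable_other_discount.
- move=> h h' x hh; rewrite /other_discount /diagonal_discount hh.
  suff -> : slice h (other_location x) = slice h' (other_location x) by [].
  by apply/funext => z; exact: hh.
- exact: other_location_finite.
- move=> c h_ h mh_ mh bh hh; apply: aeW => x.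
  have h_0 p z : (0 <= h_ p z)%R by case: z => u v; have /andP[] := bh p u v.
  have h0 := limit_ge0 h_0 hh.
  apply: cvgeD.
  + apply: ge0_adde_def; rewrite inE; first exact: diagonal_discount_ge0.
    by apply: cluster_exponent_ge0 => // z; exact: h0.
  + by apply: diagonal_cvg => //; exact: (alpha_bounded mh_ mh bh hh).
  + apply: cvg_cluster_exponent.
    * by move=> p; exact: measurable_slice.
    * exact: measurable_slice.
    * by move=> p z; exact: h_0.
    * by move=> z; exact: hh.
- move=> h_ h mh_ mh h_0 ndh hh x.
  have h0 := limit_ge0 h_0 hh.
  apply: cvgeD.
  + apply: ge0_adde_def; rewrite inE; first exact: diagonal_discount_ge0.
    by apply: cluster_exponent_ge0 => // z; exact: h0.
  + by apply: diagonal_cvg => //; exact: (alpha_nondecreasing mh_ mh).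
  + apply: cvg_cluster_exponent.
    * by move=> p; exact: measurable_slice.
    * exact: measurable_slice.
    * by move=> p z; exact: h_0.
    * by move=> z; exact: hh.
Qed.

Lemma own_cluster_integralE (g : E -> R) (h : E * E -> R) : measurable_fun setT g ->
  measurable_fun setT h -> (forall x, 0 <= g x)%R -> (forall z, 0 <= h z)%R ->
  own_cluster_integral g h =
  \int[Q]_a \int[Q]_c ((g (c - a)%R)%:E * expeN (diagonal_discount h (c - a)%R (- a)%R)).
Proof.
move=> mg mh g0 h0; rewrite /own_cluster_integral /discounted_integral.
rewrite fubini_tonelli1.
- apply: eq_integral => a _; rewrite /fubini_F; apply: eq_integral => c _.
  by rewrite mul1r.
- apply: emeasurable_funM; last first.
    exact: (measurableT_comp (@measurable_expeN R) (measurable_own_discount mh h0)).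
  by apply/measurable_EFinP; apply: measurable_funM => //; exact: (measurableT_comp mg).
- move=> z; apply: mule_ge0; last exact: expeN_ge0.
  by rewrite lee_fin mul1r.
Qed.

Lemma other_cluster_integralE (g : E -> R) (h : E * E -> R) : measurable_fun setT g ->
  measurable_fun setT h -> (forall x, 0 <= g x)%R -> (forall z, 0 <= h z)%R ->
  other_cluster_integral g h =
  \int[L]_x \int[Q]_a \int[Q]_c ((g (x + c)%R)%:E *
    expeN (diagonal_discount h (x + c)%R (- a)%R + beta (slice h (x + c)%R) x)).
Proof.
move=> mg mh g0 h0; rewrite /other_cluster_integral /discounted_integral.
have mF : measurable_fun setT (fun z : E * (E * E) =>
    (cst 1%R z * g (other_location z))%:E * expeN (other_discount h z)).
  apply: emeasurable_funM; last first.
    exact: (measurableT_comp (@measurable_expeN R) (measurable_other_discount mh h0)).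
  by apply/measurable_EFinP; apply: measurable_funM => //; exact: (measurableT_comp mg).
have F0 z : 0 <= (cst 1%R z * g (other_location z))%:E * expeN (other_discount h z).
  by apply: mule_ge0; [rewrite lee_fin mul1r|exact: expeN_ge0].
rewrite fubini_tonelli1; [|exact: mF|exact: F0].
apply: eq_integral => x _; rewrite /fubini_F integral_two_offsets; last 2 first.
- exact: (measurable_comp2 mF (measurable_cst x) (@measurable_id _ _ _)).
- by move=> z; exact: F0.
apply: eq_integral => a _; apply: eq_integral => c _.
by rewrite mul1r.
Qed.

Definition palm_integral g h : \bar R :=
  (lambda * mu)%:E * other_cluster_integral g h +
  (if eps then mu else 0)%:E * own_cluster_integral g h.

Lemma admissible_palm_integral : admissible palm_integral.
Proof.
apply: admissibleD.
- move=> g h g0; apply: integral_ge0 => z _; apply: mule_ge0; last exact: expeN_ge0.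
  by rewrite lee_fin mul1r.
- move=> g h g0; apply: integral_ge0 => z _; apply: mule_ge0; last exact: expeN_ge0.
  by rewrite lee_fin mul1r.
- exact: mulr_ge0.
- by case: eps.
- exact: admissible_other_cluster_integral.
- exact: admissible_own_cluster_integral.
Qed.

Lemma palm_integral_cube_lty (c : nat) (h : E * E -> R) : measurable_fun setT h ->
  (forall z, 0 <= h z)%R -> palm_integral (\1_(@cube_rV R n c%:R)) h < +oo.
Proof.
move=> mh h0; rewrite lte_add_pinfty//; apply: lte_mul_pinfty => //.
- by rewrite lee_fin mulr_ge0.
- apply: discounted_integral_cube_lty => // f z f0.
  apply: adde_ge0; first exact: diagonal_discount_ge0.
  by apply: cluster_exponent_ge0 => // y; exact: f0.
- by rewrite lee_fin; case: eps.
- apply: discounted_integral_cube_lty => // f z f0.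
  exact: diagonal_discount_ge0.
Qed.

Let integral_weight_sum (m1 m2 W : \bar R) (e V : E -> \bar R) : 0 <= m1 -> 0 <= m2 -> 0 <= W ->
  measurable_fun setT e -> measurable_fun setT V ->
  (forall a, 0 <= e a) -> (forall a, 0 <= V a) ->
  m1 * \int[Q]_a (e a * W) + m2 * \int[Q]_a (e a * V a) =
  \int[Q]_a (e a * (m1 * W + m2 * V a)).
Proof.
move=> m10 m20 W0 me mV e0 V0.
have meW : measurable_fun setT (fun a => e a * W).
  by apply: emeasurable_funM => //; exact: measurable_cst.
have meV : measurable_fun setT (fun a => e a * V a) by exact: emeasurable_funM.
have eW0 a : 0 <= e a * W by exact: mule_ge0.
have eV0 a : 0 <= e a * V a by exact: mule_ge0.
rewrite -!ge0_integralZl// -ge0_integralD//.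
- apply: eq_integral => a _; rewrite ge0_muleDr; last 2 first.
  + exact: mule_ge0.
  + exact: mule_ge0.
  by congr (_ + _); rewrite muleCA.
- by move=> a _; exact: mule_ge0.
- exact: measurable_funeM.
- by move=> a _; exact: mule_ge0.
- exact: measurable_funeM.
Qed.

Lemma palm_integral_fixed (g k : E -> R) : measurable_fun setT g -> measurable_fun setT k ->
  (forall x, 0 <= g x)%R -> (forall x, 0 <= k x)%R ->
  palm_integral g (fun z => k z.2) =
  \int[Q]_a (expeN (palm eps k (- a)%R) * palm_weight lambda mu Q L g k eps (- a)%R).
Proof.
move=> mg mk g0 k0.
have mh : measurable_fun setT (fun z : E * E => k z.2) by exact: (measurableT_comp mk).
have h0 (z : E * E) : (0 <= k z.2)%R by [].
pose V x : \bar R := \int[Q]_c (g (x + c) * expR (- k (x + c)))%:E.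
have mgk : measurable_fun setT (fun x => g x * expR (- k x))%R.
  by apply: measurable_funM => //; apply: measurableT_comp => //; exact: measurable_funN.
have gk0 x : (0 <= g x * expR (- k x))%R by rewrite mulr_ge0// expR_ge0.
have mV : measurable_fun setT V by exact: (measurable_integral_shift Q mgk).
have V0 x : 0 <= V x by apply: integral_ge0 => c _; rewrite lee_fin.
have palm0 t : 0 <= palm eps k t by exact: palm_exponent_ge0.
have beta0 t : 0 <= beta k t by exact: cluster_exponent_ge0.
have mpalm : measurable_fun setT (fun a : E => expeN (palm eps k (- a)%R)).
  apply: (measurableT_comp (@measurable_expeN R)).
  apply: (measurableT_comp (f := palm eps k)); first exact: measurable_palm_exponent.
  exact: measurable_rV_opp.
have mbeta : measurable_fun setT (fun x : E => expeN (beta k x)).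
  by apply: (measurableT_comp (@measurable_expeN R)); exact: measurable_cluster_exponent.
have discount (x : E) (D : \bar R) : 0 <= D ->
    \int[Q]_c ((g (x + c)%R)%:E * expeN ((k (x + c)%R)%:E + D)) = expeN D * V x.
  move=> D0; rewrite /V -ge0_integralZl//.
  - apply: eq_integral => c _; rewrite expeND//; last by rewrite lee_fin.
    by rewrite muleA muleC EFinM.
  - by apply/measurable_EFinP; exact: measurable_shift_cst mgk.
  - by move=> c _; rewrite lee_fin.
  - exact: expeN_ge0.
have mWV : measurable_fun setT (fun x : E => expeN (beta k x) * V x) by exact: emeasurable_funM.
have WV0 x : 0 <= expeN (beta k x) * V x by apply: mule_ge0 => //; exact: expeN_ge0.
pose W := \int[L]_x (expeN (beta k x) * V x).
have W0 : 0 <= W by exact: integral_ge0.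
have weightE t : palm_weight lambda mu Q L g k eps t =
    (lambda * mu)%:E * W + (if eps then mu else 0)%:E * V t.
  rewrite /palm_weight; congr (_ + _); last by case: eps; rewrite ?mul0e.
  rewrite EFinM -muleA; congr (_ * _); rewrite /W -ge0_integralZl//.
  by apply: eq_integral => x _; rewrite muleCA.
have otherE : other_cluster_integral g (fun z => k z.2) =
    \int[Q]_a (expeN (palm eps k (- a)%R) * W).
  rewrite other_cluster_integralE//.
  rewrite (eq_integral (fun x : E => \int[Q]_a (expeN (palm eps k (- a)%R) * (expeN (beta k x) * V x)))); last first.
    move=> x _; apply: eq_integral => a _.
    rewrite muleA -expeND// -discount; last exact: adde_ge0.
    by apply: eq_integral => c _; rewrite addeA.
  rewrite (fubini_tonelli (fun z : E * E => expeN (palm eps k (- z.2)%R) * (expeN (beta k z.1) * V z.1))).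
  - by apply: eq_integral => a _; rewrite /W -ge0_integralZl//; exact: expeN_ge0.
  - apply: emeasurable_funM; first exact: (measurableT_comp mpalm measurable_snd).
    exact: (measurableT_comp mWV measurable_fst).
  - by move=> z; apply: mule_ge0 => //; exact: expeN_ge0.
have ownE : own_cluster_integral g (fun z => k z.2) =
    \int[Q]_a (expeN (palm eps k (- a)%R) * V (- a)%R).
  rewrite own_cluster_integralE//; apply: eq_integral => a _.
  rewrite -discount//; apply: eq_integral => c _; by rewrite [(c - a)%R]addrC.
rewrite /palm_integral otherE ownE.
have mVN : measurable_fun setT (fun a : E => V (- a)%R).
  by apply: (measurableT_comp mV); exact: measurable_rV_opp.
have e0 a : 0 <= expeN (palm eps k (- a)%R) by exact: expeN_ge0.
have k1 : 0 <= (lambda * mu)%:E by rewrite lee_fin mulr_ge0.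
have k2 : 0 <= (if eps then mu else 0)%:E by rewrite lee_fin; case: eps.
have -> : \int[Q]_a (expeN (palm eps k (- a)%R) * palm_weight lambda mu Q L g k eps (- a)%R) =
    \int[Q]_a (expeN (palm eps k (- a)%R) *
      ((lambda * mu)%:E * W + (if eps then mu else 0)%:E * V (- a)%R)).
  by apply: eq_integral => a _; rewrite weightE.
exact: (integral_weight_sum k1 k2 W0 mpalm mVN e0 (fun a => V0 (- a)%R)).
Qed.

End cluster_discount.

Lemma cvg_nneseries_dominated (R : realType) (f_ : nat -> nat -> \bar R) (f g : nat -> \bar R) :
  (\sum_(i <oo) g i < +oo)%E -> (forall p i, 0 <= f_ p i <= g i)%E ->
  (forall i, f_ p i @[p --> \oo] --> f i) ->
  (\sum_(i <oo) f_ p i @[p --> \oo] --> \sum_(i <oo) f i)%E.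
Proof.
move=> goo f_g ff.
have f_0 p i : (0 <= f_ p i)%E by have /andP[] := f_g p i.
have f0 i : (0 <= f i)%E.
  rewrite -(cvg_lim (@ereal_hausdorff R) (ff i)); apply: lime_ge.
    by apply/cvg_ex; exists (f i); exact: ff.
  by apply: nearW => p; exact: f_0.
have g0 i : (0 <= g i)%E by have /andP[a b] := f_g 0%N i; exact: le_trans a b.
rewrite -(ge0_integral_count f0).
under eq_fun => p do rewrite -(ge0_integral_count (f_0 p)).
apply: (@ge0_dominated_cvg _ _ _ _ _ _ g) => //.
- by rewrite ge0_integral_count.
- by apply: aeW => i; exact: ff.
Qed.

Lemma cvg_nneseries_nondecreasing (R : realType) (f_ : nat -> nat -> \bar R) (f : nat -> \bar R) :
  (forall p i, 0 <= f_ p i)%E -> (forall i, nondecreasing_seq (f_ ^~ i)) ->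
  (forall i, f_ p i @[p --> \oo] --> f i) ->
  (\sum_(i <oo) f_ p i @[p --> \oo] --> \sum_(i <oo) f i)%E.
Proof.
move=> f_0 ndf ff.
have f0 i : (0 <= f i)%E.
  rewrite -(cvg_lim (@ereal_hausdorff R) (ff i)); apply: lime_ge.
    by apply/cvg_ex; exists (f i); exact: ff.
  by apply: nearW => p; exact: f_0.
rewrite -(ge0_integral_count f0).
rewrite (_ : (fun p => \sum_(i <oo) f_ p i)%E = fun p => (\int[counting]_i f_ p i)%E); last first.
  by apply/funext => p; rewrite ge0_integral_count.
rewrite [X in _ --> X](_ : _ = \int[counting]_i limn (fun p => f_ p i))%E; last first.
  by apply: eq_integral => i _; apply/esym/cvg_lim; [exact: ereal_hausdorff|exact: ff].
apply: cvg_monotone_convergence => //.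
Qed.

Section index_measure.
Context d (T : measurableType d) (R : realType) (P : probability T R).
Local Open Scope ereal_scope.

Let at_index (i : nat) (w : T) : T * nat := (w, i).

Let mat_index i : measurable_fun setT (at_index i).
Proof. by apply/measurable_fun_pairP; split; [exact: measurable_id|exact: measurable_cst]. Qed.

Definition index_measure : {measure set (T * nat)%type -> \bar R} :=
  mseries (fun i => image_measure P (mat_index i)) 0.

Lemma measurable_index d' (Y : measurableType d') (F : T * nat -> Y) :
  (forall i, measurable_fun setT (fun w => F (w, i))) -> measurable_fun setT F.
Proof.
move=> mF _ A mA; rewrite setTI.
rewrite (_ : _ @^-1` _ = \bigcup_i (((fun w => F (w, i)) @^-1` A) `*` [set i])).
  apply: bigcupT_measurable => i; apply: measurableX => //.
  by have := mF i measurableT _ mA; rewrite setTI.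
by apply/seteqP; split=> [[w i] Aw|[w i] [j _ [/= Aw ->]]] //; exists i.
Qed.

Lemma integral_index_measure (F : T * nat -> \bar R) :
  (forall i, measurable_fun setT (fun w => F (w, i))) -> (forall z, 0 <= F z) ->
  \int[index_measure]_z F z = \sum_(i <oo) \int[P]_w F (w, i).
Proof.
move=> mF F0; have mF2 := measurable_index mF.
rewrite ge0_integral_measure_series//; apply: eq_eseriesr => i _.
by rewrite (ge0_integral_pushforward (mat_index i)).
Qed.

Lemma ae_index_measure (A : T -> Prop) : {ae P, forall w, A w} ->
  {ae index_measure, forall z, A z.1}.
Proof.
move=> [N [mN PN AN]]; exists (N `*` setT); split.
- exact: measurableX.
- rewrite (_ : index_measure _ = \sum_(i <oo) P (at_index i @^-1` (N `*` setT)))//.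
  rewrite eseries0// => i _ _; rewrite -[RHS]PN; congr (P _); apply/seteqP; split => w /=; last by split.
  by case.
- by move=> [w i] /= nA; split => //=; apply: AN.
Qed.

End index_measure.

Section point_sums.
Context (R : realType) (n : nat).
Local Notation E := 'rV[R]_n.
Variables (lambda mu : R) (Q : probability E R).
Variables (L : {sigma_finite_measure set E -> \bar R}).
Hypotheses (lambda_ge0 : 0 <= lambda) (mu_ge0 : 0 <= mu).
Hypothesis L_shift : forall (c : E) (A : set E), measurable A ->
  L ((fun x => x + c) @^-1` A) = L A.
Hypothesis L_cube : forall c : nat, (L (@cube_rV R n c%:R) < +oo)%E.
Context d (T : measurableType d) (P : probability T R).
Variables (b : nat -> T -> bool) (z : nat -> T -> E).
Hypotheses (mb : forall i, measurable_fun setT (b i)) (mz : forall i, measurable_fun setT (z i)).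
Local Open Scope ereal_scope.

Definition point_sum (f : E -> R) (w : T) : \bar R :=
  \sum_(i <oo) if b i w then (f (z i w))%:E else 0.

Lemma point_sum_ge0 (f : E -> R) w : (forall x, 0 <= f x)%R -> 0 <= point_sum f w.
Proof. by move=> f0; apply: nneseries_ge0 => i _ _; case: ifP => // _; rewrite lee_fin. Qed.

Lemma measurable_present d' (Y : measurableType d') (c : Y -> bool) (F : Y -> \bar R) :
  measurable_fun setT c ->
  measurable_fun setT F -> measurable_fun setT (fun w => if c w then F w else 0).
Proof. by move=> mc mF; apply: measurable_fun_ifT => //. Qed.

Lemma measurable_point_sum (f : E -> R) : measurable_fun setT f -> (forall x, 0 <= f x)%R ->
  measurable_fun setT (point_sum f).
Proof.
move=> mf f0; apply: ge0_emeasurable_sum ; first by move=> i w _ _; case: ifP => // _; rewrite lee_fin.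
move=> i _; apply: measurable_present => //; apply/measurable_EFinP; exact: (measurableT_comp mf).
Qed.

Lemma point_sumD (f1 f2 : E -> R) (c : R) w : (forall x, 0 <= f1 x)%R -> (forall x, 0 <= f2 x)%R ->
  (0 <= c)%R -> point_sum (fun x => f1 x + c * f2 x)%R w = point_sum f1 w + c%:E * point_sum f2 w.
Proof.
move=> f10 f20 c0; rewrite /point_sum -nneseriesZl; last by move=> i _; case: ifP => // _; rewrite lee_fin.
rewrite -nneseriesD.
- by apply: eq_eseriesr => i _; case: ifP => // _; rewrite mule0 adde0.
- by move=> i _ _; case: ifP => // _; rewrite lee_fin.
- by move=> i _ _; case: ifP => // _; rewrite ?mule0// -EFinM lee_fin mulr_ge0.
Qed.

Variable eps : bool.
Hypothesis laplace : forall f : E -> R, measurable_fun setT f -> (forall x, 0 <= f x)%R ->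
  \int[P]_w expeN (point_sum f w) =
  \int[Q]_a expeN (palm_exponent lambda mu Q L eps f (- a)%R).

Lemma first_order_point_sum (g h : E -> R) : measurable_fun setT g -> measurable_fun setT h ->
  (forall x, 0 <= g x)%R -> (forall x, 0 <= h x)%R ->
  \int[P]_w (expeN (point_sum h w) * point_sum g w) =
  palm_integral lambda mu Q L eps g (fun y => h y.2).
Proof.
move=> mg mh g0 h0; rewrite palm_integral_fixed//.
apply: first_order_fixed => //.
- exact: point_sum_ge0.
- exact: measurable_point_sum.
- exact: point_sumD.
Qed.


Lemma point_sum_cube_lty (c : nat) :
  \int[P]_w point_sum (\1_(@cube_rV R n c%:R)) w < +oo.
Proof.
have m1 : measurable_fun setT (\1_(@cube_rV R n c%:R) : E -> R).
  by apply: measurable_indic; exact: measurable_cube_rV.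
rewrite (_ : \int[P]_w _ =
    \int[P]_w (expeN (point_sum (cst 0%R) w) * point_sum (\1_(@cube_rV R n c%:R)) w)); last first.
  apply: eq_integral => w _.
  have -> : point_sum (cst 0%R) w = 0 by apply: eseries0 => i _ _; case: ifP.
  by rewrite expeN0 mul1e.
rewrite first_order_point_sum; [|exact: m1|exact: measurable_cst|by move=> x; rewrite indicE|by []].
apply: palm_integral_cube_lty => //; exact: measurable_cst.
Qed.

Lemma ae_point_sum_cube_lty : {ae P, forall w, forall c : nat,
  point_sum (\1_(@cube_rV R n c%:R)) w < +oo}.
Proof.
apply: ae_foralln => c.
have m1 : measurable_fun setT (\1_(@cube_rV R n c%:R) : E -> R).
  by apply: measurable_indic; exact: measurable_cube_rV.
have S0 w : 0 <= point_sum (\1_(@cube_rV R n c%:R)) w by exact: point_sum_ge0.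
have mS : measurable_fun setT (point_sum (\1_(@cube_rV R n c%:R))) by exact: measurable_point_sum.
have : P.-integrable setT (point_sum (\1_(@cube_rV R n c%:R))).
  apply/integrableP; split => //; under eq_integral => w _ do rewrite gee0_abs//.
  exact: point_sum_cube_lty.
move=> /integrable_ae => /(_ measurableT); apply: filterS => w /(_ Logic.I).
by rewrite ge0_fin_numE.
Qed.

Let location (x : T * nat) : E := z x.2 x.1.
Let presence (x : T * nat) : R := (b x.2 x.1)%:R.

Definition point_discount (h : E * E -> R) (x : T * nat) : \bar R :=
  \sum_(j <oo) if b j x.1 then (h (z x.2 x.1, z j x.1))%:E else 0.

Let point_discountE h w i : point_discount h (w, i) = point_sum (slice h (z i w)) w.
Proof. by []. Qed.

Let measurable_point_discount_at (h : E * E -> R) i : measurable_fun setT h ->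
  (forall y, 0 <= h y)%R -> measurable_fun setT (fun w => point_discount h (w, i)).
Proof.
move=> mh h0; apply: ge0_emeasurable_sum; first by move=> j w _ _; case: ifP => // _; rewrite lee_fin.
move=> j _; apply: measurable_present => //; apply/measurable_EFinP.
exact: (measurable_comp2 mh (mz i) (mz j)).
Qed.

Let measurable_point_discount (h : E * E -> R) : measurable_fun setT h ->
  (forall y, 0 <= h y)%R -> measurable_fun setT (point_discount h).
Proof. by move=> mh h0; apply: measurable_index => i; exact: measurable_point_discount_at. Qed.

Let measurable_location : measurable_fun setT location.
Proof. exact: measurable_index. Qed.

Let measurable_presence_at i : measurable_fun setT (fun w => presence (w, i)).
Proof.
rewrite /presence /=; exact: (measurableT_comp (f := fun c : bool => c%:R : R)).
Qed.

Let measurable_presence : measurable_fun setT presence.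
Proof. exact: measurable_index. Qed.

Definition point_integral := discounted_integral (index_measure P) location presence point_discount.

Lemma admissible_point_integral : admissible point_integral.
Proof.
apply: admissible_discounted_integral.
- exact: measurable_location.
- exact: measurable_presence.
- by move=> x; exact: ler0n.
- move=> h [w i] h0; rewrite point_discountE; apply: point_sum_ge0 => y; exact: h0.
- exact: measurable_point_discount.
- move=> h h' [w i] hh; rewrite !point_discountE.
  suff -> : slice h (z i w) = slice h' (z i w) by [].
  by apply/funext => y; exact: hh.
- move=> c; rewrite integral_index_measure.
  + apply: le_lt_trans (point_sum_cube_lty c).
    rewrite /point_sum integral_nneseries//.
    * apply: lee_nneseries => i _.
        by move=> _; apply: integral_ge0 => w _; rewrite lee_fin mulr_ge0// indicE.
      rewrite le_eqVlt; apply/orP; left; apply/eqP; apply: eq_integral => w _.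
      by rewrite /presence /=; case: (b i w); rewrite ?mul1r ?mul0r.
    * move=> i; apply: measurable_present => //; apply/measurable_EFinP.
      apply: (measurableT_comp (f := \1_(@cube_rV R n c%:R) : E -> R)) => //.
      by apply: measurable_indic; exact: measurable_cube_rV.
    * by move=> i w _; case: ifP => // _; rewrite lee_fin indicE.
  + move=> i; apply/measurable_EFinP; apply: measurable_funM => //.
    apply: (measurableT_comp (f := \1_(@cube_rV R n c%:R) : E -> R)); last exact: mz.
    by apply: measurable_indic; exact: measurable_cube_rV.
  + by move=> x; rewrite lee_fin mulr_ge0// indicE.
- move=> c h_ h mh_ mh bh hh.
  apply: filterS (ae_index_measure ae_point_sum_cube_lty) => -[w i] /= finite_cube.
  apply: (@cvg_nneseries_dominated _ _ _ (fun j =>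
    if b j w then (c%:R * \1_(@cube_rV R n c%:R) (z j w))%:E else 0)).
  + rewrite (_ : \sum_(j <oo) _ = c%:R%:E * point_sum (\1_(@cube_rV R n c%:R)) w).
      by apply: lte_mul_pinfty.
    rewrite /point_sum -nneseriesZl.
      by apply: eq_eseriesr => j _; case: ifP; rewrite ?mule0.
    by move=> j _; case: ifP => // _; rewrite lee_fin indicE.
  + move=> p j /=; case: ifP => _; last by rewrite lexx.
    by rewrite !lee_fin; exact: bh.
  + move=> j; case: ifP => // _; last exact: cvg_cst.
    by apply: cvg_EFin; [exact: nearW|exact: hh].
- move=> h_ h mh_ mh h_0 ndh hh [w i] /=.
  apply: cvg_nneseries_nondecreasing.
  + by move=> p j; case: ifP => // _; rewrite lee_fin.
  + by move=> j p q pq; case: ifP => // _; rewrite lee_fin; exact: ndh.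
  + move=> j; case: ifP => // _; last exact: cvg_cst.
    by apply: cvg_EFin; [exact: nearW|exact: hh].
Qed.

Lemma point_integralE (g : E -> R) (h : E * E -> R) : measurable_fun setT g -> measurable_fun setT h ->
  (forall x, 0 <= g x)%R -> (forall y, 0 <= h y)%R ->
  point_integral g h = \int[P]_w (\sum_(i <oo) if b i w then (g (z i w))%:E *
   expeN (\sum_(j <oo) if b j w then (h (z i w, z j w))%:E else 0) else 0).
Proof.
move=> mg mh g0 h0.
have mF i : measurable_fun setT (fun w => (presence (w, i) * g (location (w, i)))%:E *
    expeN (point_discount h (w, i))).
  apply: emeasurable_funM.
    apply/measurable_EFinP; apply: measurable_funM => //.
    exact: (measurableT_comp mg (mz i)).
  apply: (measurableT_comp (@measurable_expeN R)).
  exact: measurable_point_discount_at.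
rewrite /point_integral /discounted_integral integral_index_measure; last 2 first.
- exact: mF.
- by move=> x; apply: mule_ge0; [rewrite lee_fin mulr_ge0|exact: expeN_ge0].
rewrite -integral_nneseries//; last first.
  by move=> i w _; apply: mule_ge0; [rewrite lee_fin mulr_ge0|exact: expeN_ge0].
apply: eq_integral => w _; apply: eq_eseriesr => i _.
by rewrite /presence /=; case: (b i w); rewrite ?mul1r ?mul0r ?mul0e.
Qed.

Theorem first_order_points (g : E -> R) (h : E * E -> R) :
  measurable_fun setT g -> measurable_fun setT h ->
  (forall x, 0 <= g x)%R -> (forall y, 0 <= h y)%R ->
  \int[P]_w (\sum_(i <oo) if b i w then (g (z i w))%:E *
     expeN (\sum_(j <oo) if b j w then (h (z i w, z j w))%:E else 0) else 0) =
  palm_integral lambda mu Q L eps g h.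
Proof.
move=> mg mh g0 h0; rewrite -point_integralE//.
apply: (admissible_unique admissible_point_integral) => //.
  exact: admissible_palm_integral.
move=> g' h' mg' mh' g'0 h'0.
rewrite point_integralE//; last exact: (measurableT_comp mh' measurable_snd).
rewrite -first_order_point_sum//.
apply: eq_integral => w _.
have e1 : expeN (point_sum h' w) \is a fin_num by apply: expeN_fin_num; exact: point_sum_ge0.
rewrite -(fineK e1) /point_sum -nneseriesZl.
  apply: eq_eseriesr => i _; rewrite (fineK e1).
  by case: ifP => _; rewrite ?mule0// muleC.
by move=> i _; case: ifP => // _; rewrite lee_fin.
Qed.

End point_sums.

Section point_measures.
Context (R : realType) (n : nat).
Local Notation E := 'rV[R]_n.
Local Open Scope ereal_scope.

Lemma integral_series_dirac (x : nat -> E) (f : E -> \bar R) : measurable_fun setT f ->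
  (forall y, 0 <= f y) ->
  \int[mseries (fun k => \d_(x k)) 0]_y f y = \sum_(k <oo) f (x k).
Proof.
move=> mf f0; rewrite ge0_integral_measure_series//.
by apply: eq_eseriesr => k _; rewrite integral_dirac// diracT mul1e.
Qed.

Lemma integral_sum_dirac (x : nat -> E) (m : nat) (f : E -> \bar R) : measurable_fun setT f ->
  (forall y, 0 <= f y) ->
  \int[msum (fun k => \d_(x k)) m]_y f y = \sum_(k < m) f (x k).
Proof.
move=> mf f0; rewrite ge0_integral_measure_sum//.
by apply: eq_bigr => k _; rewrite integral_dirac// diracT mul1e.
Qed.

Definition atom (c : bool) (x : E) : {measure set E -> \bar R} :=
  if c then (\d_x : {measure set E -> \bar R}) else (mzero : {measure set E -> \bar R}).

Lemma integral_series_atom (c : nat -> bool) (x : nat -> E) (f : E -> \bar R) :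
  measurable_fun setT f -> (forall y, 0 <= f y) ->
  \int[mseries (fun k => atom (c k) (x k)) 0]_y f y = \sum_(k <oo) if c k then f (x k) else 0.
Proof.
move=> mf f0; rewrite ge0_integral_measure_series//; apply: eq_eseriesr => k _.
rewrite /atom; case: ifP => _; first by rewrite integral_dirac// diracT mul1e.
by rewrite integral_measure_zero.
Qed.

Lemma nneseries_pickle_inv (F : nat -> nat -> \bar R) : (forall i k, 0 <= F i k) ->
  \sum_(m <oo) (if @pickle_inv (nat * nat)%type m is Some ik then F ik.1 ik.2 else 0) =
  \sum_(i <oo) \sum_(k <oo) F i k.
Proof.
move=> F0; rewrite nneseries_esumT; last by move=> m; case: pickle_inv.
under [RHS]eq_eseriesr => i _ do rewrite nneseries_esumT//.
rewrite nneseries_esumT; last by move=> i; exact: esum_ge0.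
rewrite esum_esum//.
rewrite (_ : [set: nat] `*`` _ = [set: nat * nat]); last by apply/seteqP; split.
pose G m := if @pickle_inv (nat * nat)%type m is Some ik then F ik.1 ik.2 else 0.
have -> : \esum_(k in [set: nat * nat]) F k.1 k.2 = \esum_(k in [set: nat * nat]) G (@choice.pickle (nat * nat)%type k).
  by apply: eq_esum => k _; rewrite /G pickleK_inv.
rewrite -(@reindex_esum _ _ _ [set: nat * nat] (range (@choice.pickle (nat * nat)%type)) (@choice.pickle (nat * nat)%type) G); last first.
  by split => [k _|k k' _ _|m];  [exists k|exact: (pcan_inj (@choice.pickleK _))|].
rewrite [RHS]esum_mkcond; apply: eq_esum => m _; rewrite /G.
case mE : pickle_inv => [ik|]; last by case: ifP.
rewrite mem_set//; exists ik => //.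
by have := @pickle_invK (nat * nat)%type m; rewrite mE.
Qed.

Variables (d : measure_display) (T : measurableType d) (P : probability T R).
Variables (X : nat -> {RV P >-> E}) (kappa : nat -> {RV P >-> nat}).
Variables (Y : nat -> nat -> {RV P >-> E}).

Definition cluster_mark (m : nat) (w : T) : bool :=
  if @pickle_inv (nat * nat)%type m is Some ik then (ik.2 < kappa ik.1 w)%N else false.

Definition cluster_point (m : nat) (w : T) : E :=
  if @pickle_inv (nat * nat)%type m is Some ik then (X ik.1 w + Y ik.1 ik.2 w)%R else 0%R.

Lemma measurable_cluster_mark m : measurable_fun setT (cluster_mark m).
Proof.
rewrite /cluster_mark; case: pickle_inv => [ik|]; last exact: measurable_cst.
apply: (measurableT_comp (f := fun k : nat => (ik.2 < k)%N)) => //.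
Qed.

Lemma measurable_cluster_point m : measurable_fun setT (cluster_point m).
Proof.
rewrite /cluster_point; case: pickle_inv => [ik|]; last exact: measurable_cst.
exact: measurable_rV_add.
Qed.

Let offspring_at i w : {measure set E -> \bar R} := msum (fun k => \d_(Y i k w)) (kappa i w).

Lemma integral_offspring i w (f : E -> \bar R) : measurable_fun setT f -> (forall y, 0 <= f y) ->
  \int[offspring kappa Y i w]_y f y = \sum_(k <oo) if (k < kappa i w)%N then f (Y i k w) else 0.
Proof.
move=> mf f0; rewrite (integral_sum_dirac (fun k => Y i k w))//.
rewrite (nneseries_split 0 (kappa i w)); last by move=> k _; case: ifP.
rewrite add0n eseries0 ?adde0; last by move=> k; rewrite leqNgt => /negbTE->.
by rewrite big_mkord; apply: eq_bigr => k _; rewrite ltn_ord.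
Qed.

Lemma point_sum_clusters (f : E -> R) w : measurable_fun setT f -> (forall y, 0 <= f y)%R ->
  point_sum cluster_mark cluster_point f w =
  \sum_(i <oo) \int[offspring kappa Y i w]_y (f (X i w + y)%R)%:E.
Proof.
move=> mf f0.
have mfs i : measurable_fun setT (fun y => (f (X i w + y)%R)%:E).
  by apply/measurable_EFinP; apply: measurable_shift_cst.
rewrite [RHS](eq_eseriesr (g := fun i => \sum_(k <oo)
  if (k < kappa i w)%N then (f (X i w + Y i k w)%R)%:E else 0)); last first.
  by move=> i _; apply: integral_offspring => // y; rewrite lee_fin.
rewrite -(nneseries_pickle_inv (F := fun i k =>
  if (k < kappa i w)%N then (f (X i w + Y i k w)%R)%:E else 0)); last first.
  by move=> i k; case: ifP => // _; rewrite lee_fin.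
apply: eq_eseriesr => m _; rewrite /cluster_mark /cluster_point.
by case: pickle_inv => [ik|].
Qed.

Definition cluster_measure (w : T) : {measure set E -> \bar R} :=
  mseries (fun m => atom (cluster_mark m w) (cluster_point m w)) 0.

Lemma cluster_processE w : cluster_process X kappa Y w = cluster_measure w.
Proof.
apply/funext => B; rewrite /cluster_process.
rewrite (eq_eseriesr (g := fun i => \sum_(k <oo)
  if (k < kappa i w)%N then \d_(X i w + Y i k w)%R B else 0)); last first.
  move=> i _; rewrite (nneseries_split 0 (kappa i w)); last by move=> k _; case: ifP.
  rewrite add0n eseries0 ?adde0; last by move=> k; rewrite leqNgt => /negbTE->.
  rewrite big_mkord; apply: eq_bigr => k _; rewrite ltn_ord addrC.
  by rewrite /translate /pushforward /= /dirac !indicE.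
rewrite -(nneseries_pickle_inv (F := fun i k =>
  if (k < kappa i w)%N then \d_(X i w + Y i k w)%R B else 0)); last first.
  by move=> i k; case: ifP.
apply: eq_eseriesr => m _; rewrite /atom /cluster_mark /cluster_point.
by case: pickle_inv => [ik|//]; case: ifP.
Qed.

End point_measures.

Section cluster_laplace.
Context (R : realType) (n : nat).
Local Notation E := 'rV[R]_n.
Local Open Scope ereal_scope.
Context (d : measure_display) (T : measurableType d) (P : probability T R).

Lemma poisson_laplace_scale (c : R) (m : {sigma_finite_measure set E -> \bar R})
    (N : T -> {measure set E -> \bar R}) : (0 <= c)%R ->
  poisson_process P (fun B => c%:E * m B) N ->
  forall f : E -> R, measurable_fun setT f -> (forall x, 0 <= f x)%R ->
  \int[P]_w expeN (\int[N w]_x (f x)%:E) = expeN (c%:E * \int[m]_x (1 - expR (- f x))%:E).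
Proof.
move=> c0 pN f mf f0; pose cm : {measure set E -> \bar R} := mscale (NngNum c0) m.
have [M ME] : exists M : {sigma_finite_measure set E -> \bar R}, cm = M :> (set E -> \bar R).
  apply: sigma_finite_pack; have /sigma_finiteP[F [FT _ Foo]] := sigma_finiteT m.
  exists F; first exact: FT.
  move=> k; have [mF Fk] := Foo k; split => //.
  by rewrite /cm /= /mscale /= lte_mul_pinfty// lee_fin.
have pM : poisson_process P M N by rewrite -ME.
rewrite (poisson_laplace pM mf f0); congr expeN.
rewrite -(ge0_integral_mscale m measurableT (NngNum c0))//.
- by apply: eq_measure_integral => A mA _; exact: (esym (congr1 (fun m' => m' A) ME)).
- by apply/measurable_EFinP; exact: measurable_onem.
- by move=> x _; rewrite lee_fin subr_ge0 expR_le1 lerNl oppr0.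
Qed.

Lemma cluster_exponent_fin_num (mu : R) (Q : probability E R) (f : E -> R) (x : E) :
  (0 <= mu)%R -> measurable_fun setT f -> (forall y, 0 <= f y)%R ->
  cluster_exponent mu Q f x \is a fin_num.
Proof.
move=> mu0 mf f0; rewrite ge0_fin_numE; last exact: cluster_exponent_ge0.
apply: lte_mul_pinfty => //; apply: (@le_lt_trans _ _ (\int[Q]_c cst 1 c)); last first.
  by rewrite integral_cst// mul1e; exact: fin_num_fun_lty.
apply: ge0_le_integral => //.
- by move=> c _; rewrite lee_fin subr_ge0 expR_le1 lerNl oppr0.
- apply/measurable_EFinP; apply: (measurable_shift_cst (f := fun y => 1 - expR (- f y))%R).
  exact: measurable_onem.
- by move=> c _; rewrite lee_fin gerBl expR_ge0.
Qed.

Variables (X : nat -> {RV P >-> E}) (kappa : nat -> {RV P >-> nat}).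
Variables (Y : nat -> nat -> {RV P >-> E}).
Variables (lambda mu : R) (Q : probability E R).
Variables (L : {sigma_finite_measure set E -> \bar R}).
Hypothesis LE : @lebesgue_rV R n = L.
Hypotheses (lambda_ge0 : (0 <= lambda)%R) (mu_ge0 : (0 <= mu)%R).
Hypothesis ppcp : PPCP X kappa Y lambda mu Q.

Let G (o : option nat) : set (set T) :=
  if o is Some i then g_sigma_process (offspring kappa Y i)
  else g_sigma_family setT (fun i => X i : T -> E).

Let sG o : sigma_algebra setT (G o).
Proof. by case: o => [i|]; exact: smallest_sigma_algebra. Qed.

Let offspring_at i w : {measure set E -> \bar R} := msum (fun k => \d_(Y i k w)) (kappa i w).

Let moff i B : measurable B -> measurable_fun setT (fun w => offspring kappa Y i w B).
Proof. by have [_ h _] := ppcp; move=> mB; have [mo _ _] := h i; exact: mo. Qed.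

Let mG o : G o `<=` measurable.
Proof.
case: o => [i|]; apply: smallest_sub; try exact: sigma_algebra_measurable.
- move=> A [B mB] [C mC <-]; rewrite setTI -[_ @^-1` _]setTI; exact: moff.
- by move=> A [j _] [C mC <-]; exact: measurable_funPT.
Qed.

Let moffG i B : measurable B ->
  measurable_fun [set: g_sigma_algebraType (G (Some i))] (fun w => offspring kappa Y i w B).
Proof.
move=> mB _ C mC; apply: sub_sigma_algebra; apply: sub_sigma_algebra; exists B => //; exists C => //.
Qed.

Let mXG i : measurable_fun [set: g_sigma_algebraType (G None)] (X i : T -> E).
Proof. move=> _ C mC; apply: sub_sigma_algebra; apply: sub_sigma_algebra; exists i => //; exists C => //. Qed.

Lemma laplace_cluster_process (f : E -> R) : measurable_fun setT f -> (forall x, 0 <= f x)%R ->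
  \int[P]_w expeN (point_sum (cluster_mark kappa) (cluster_point X Y) f w) =
  expeN (process_exponent lambda mu Q L f).
Proof.
move=> mf f0; have [pparents poff indG] := ppcp.
pose psi i (w w' : T) := \int[offspring_at i w']_y (f (X i w + y)%R)%:E.
pose beta w i := cluster_exponent mu Q f (X i w).
have mpsi i : measurable_fun setT (fun z : g_sigma_algebraType (G None) * g_sigma_algebraType (G (Some i)) =>
    psi i z.1 z.2).
  have finite_offspring w : offspring_at i w setT < +oo.
    by apply: lte_sum_pinfty => k _; rewrite /= /dirac indicT ltry.
  have mh : measurable_fun setT (fun z : g_sigma_algebraType (G None) * E => f (X i z.1 + z.2)%R).
    apply: (measurableT_comp mf); apply: measurable_rV_add; last exact: measurable_snd.
    exact: (measurableT_comp (@mXG i) measurable_fst).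
  exact: (@measurable_integral_finite_random_measure R _ _ (g_sigma_algebraType (G None)) E _
    (g_sigma_algebraType (G (Some i))) (offspring_at i) (fun B => @moffG i B) finite_offspring
    (fun z => f (X i z.1 + z.2)%R) mh (fun z => f0 _)).
have mbeta : measurable_fun setT (cluster_exponent mu Q f) by exact: measurable_cluster_exponent.
have b0 x : 0 <= cluster_exponent mu Q f x by exact: cluster_exponent_ge0.
have mfb : measurable_fun setT (fun x => fine (cluster_exponent mu Q f x)).
  exact: (measurableT_comp (@fine_measurable R setT measurableT) mbeta).
have bfin x : cluster_exponent mu Q f x \is a fin_num by exact: cluster_exponent_fin_num.
transitivity (\int[P]_w (1 * expeN (\sum_(i <oo) psi i w w))).
  apply: eq_integral => w _; rewrite mul1e; congr expeN.
  by rewrite point_sum_clusters.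
rewrite (@integral_discount _ _ _ P G sG mG indG psi (fun i w => beta w i)).
- transitivity (\int[P]_w expeN (\int[mseries (fun k => \d_(X k w)) 0]_x
      (fine (cluster_exponent mu Q f x))%:E)).
    apply: eq_integral => w _; rewrite mul1e; congr expeN.
    rewrite (integral_series_dirac (fun k => X k w)).
    + by apply: eq_eseriesr => i _; rewrite fineK.
    + by apply/measurable_EFinP.
    + by move=> x; rewrite fineK.
  rewrite LE in pparents.
  rewrite (@poisson_laplace_scale lambda L (fun w => mseries (fun k => \d_(X k w)) 0)) //.
  + congr (expeN (_ * _)); apply: eq_integral => x _.
    by rewrite -[in RHS](fineK (bfin x)) EFinB.
  + by move=> x; rewrite fine_ge0.
- exact: mpsi.
- move=> i; exact: (measurableT_comp mbeta (@mXG i)).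
- by move=> i w w'; apply: integral_ge0 => y _; rewrite lee_fin.
- by move=> i w; exact: b0.
- move=> i w.
  exact: (@poisson_laplace_scale mu Q (offspring_at i) mu_ge0 (poff i) (fun y => f (X i w + y)%R)
    (measurable_shift_cst (X i w) mf) (fun y => f0 _)).
- exact: measurable_cst.
- by move=> w; rewrite lexx lee01.
Qed.
End cluster_laplace.

Section laplace_functional.
Import HBNNSimple.
Context (R : realType) (n : nat).
Local Notation E := 'rV[R]_n.
Local Open Scope ereal_scope.
Variables (f : E -> R) (mf : measurable_fun setT f) (f0 : forall x, (0 <= f x)%R).

Let approx : {nnsfun E >-> R}^nat := nnsfun_approx measurableT ((@measurable_EFinP _ _ _ _ f).2 mf).

Definition simple_integral (g : {nnsfun E >-> R}) (eta : set E -> \bar R) : \bar R :=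
  \sum_(x <- fset_set (range g)) x%:E * eta (g @^-1` [set x]).

Definition laplace_functional (eta : set E -> \bar R) : \bar R :=
  expeN (esups (fun k => simple_integral (approx k) eta) 0%N).

Lemma measurable_laplace_functional :
  measurable_fun [set: g_sigma_algebraType (@evaluations R n)] laplace_functional.
Proof.
apply: (measurableT_comp (@measurable_expeN R)).
apply: (@measurable_fun_esups _ (g_sigma_algebraType (@evaluations R n)) R setT
  (fun k eta => simple_integral (approx k) eta)) => k.
apply: emeasurable_sum => x; apply: measurable_funeM.
move=> _ C mC; apply: sub_sigma_algebra; exists (approx k @^-1` [set x]) => //.
by exists C.
Qed.

Lemma laplace_functional_measure (m : {measure set E -> \bar R}) :
  laplace_functional m = expeN (\int[m]_x (f x)%:E).
Proof.
rewrite /laplace_functional; congr expeN.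
have nda : nondecreasing_seq (sintegral m \o approx).
  move=> i j ij /=.
  by apply: le_sintegral => // x; have /lefP := nd_nnsfun_approx measurableT ((@measurable_EFinP _ _ _ _ f).2 mf) ij; apply.
rewrite (@nd_ge0_integral_lim _ _ _ m (fun x => (f x)%:E) approx).
- rewrite (cvg_lim _ (ereal_nondecreasing_cvgn nda))//.
  rewrite /esups /sdrop; congr (ereal_sup _).
  rewrite (_ : (fun k => _) = sintegral m \o approx).
    by apply/seteqP; split => [_ [k _ <-]|_ [k _ <-]]; exists k.
  apply/funext => k; rewrite /simple_integral /= sintegralE.
  by rewrite fsbig_finite.
- by move=> x; rewrite lee_fin.
- by move=> x i j ij; have /lefP := nd_nnsfun_approx measurableT ((@measurable_EFinP _ _ _ _ f).2 mf) ij; apply.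
- by move=> x; apply: cvg_nnsfun_approx => // y _; rewrite lee_fin.
Qed.

End laplace_functional.
Section palm_laplace.
Context (R : realType) (n : nat).
Local Notation E := 'rV[R]_n.
Local Open Scope ereal_scope.
Context (d : measure_display) (T : measurableType d) (P : probability T R).
Variables (X : nat -> {RV P >-> E}) (kappa : nat -> {RV P >-> nat}).
Variables (Y : nat -> nat -> {RV P >-> E}).

Local Notation b := (cluster_mark kappa).
Local Notation z := (cluster_point X Y).

Definition seen_from (w : T) (y : E) : set E -> \bar R :=
  fun B => translate (- y)%R (cluster_process X kappa Y w) B - \d_(0%R : E) B.

Lemma seen_fromE w y B : seen_from w y B =
  \sum_(m <oo) (if b m w then \d_(z m w - y)%R B else 0) - \d_(0%R : E) B.
Proof.
rewrite /seen_from cluster_processE; congr (_ - _); rewrite /translate /pushforward.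
apply: eq_eseriesr => m _; rewrite /atom; case: ifP => _ //.
Qed.

Lemma measurable_seen_from w :
  measurable_fun setT (seen_from w : E -> g_sigma_algebraType (@evaluations R n)).
Proof.
apply: (@measurability _ _ _ (g_sigma_algebraType (@evaluations R n)) _ _ (@evaluations R n)) => //.
move=> _ [A [B mB [C mC <-]] <-]; rewrite !setTI.
suff : measurable_fun setT (fun y => seen_from w y B).
  by move=> /(_ measurableT _ mC); rewrite setTI.
rewrite (_ : (fun y => _) = fun y => \sum_(m <oo) (if b m w then \d_(z m w - y)%R B else 0) -
    \d_(0%R : E) B); last by apply/funext => y; rewrite seen_fromE.
apply: emeasurable_funB; last exact: measurable_cst.
apply: ge0_emeasurable_sum; first by move=> m y _ _; case: ifP.
move=> m _; case: (b m w); last exact: measurable_cst.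
rewrite /dirac; apply/measurable_EFinP.
apply: (measurableT_comp (f := \1_B : E -> R)); first exact: measurable_indic.
by apply: measurable_rV_sub => //; exact: measurable_cst.
Qed.

Lemma seen_from_point w i : b i w ->
  seen_from w (z i w) = mseries (fun m => atom ((m != i) && b m w) (z m w - z i w)%R) 0.
Proof.
move=> bi; apply/funext => B; rewrite seen_fromE.
rewrite (@nneseriesD1 _ _ i)//; last by move=> m _; case: ifP.
rewrite bi subrr [X in X - _]addeC addeK; last by rewrite /dirac.
by rewrite eseries_mkcond; apply: eq_eseriesr => m _; rewrite /atom; case: (m != i); case: (b m w).
Qed.

Variables (f : E -> R) (mf : measurable_fun setT f) (f0 : forall x, (0 <= f x)%R).

Let F := laplace_functional mf.

Lemma integral_seen_from w :
  \int[cluster_process X kappa Y w]_(y in @unit_cube R n) F (seen_from w y) =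
  \sum_(i <oo) if b i w then (\1_(@unit_cube R n) (z i w) * expR (f 0%R))%:E *
     expeN (\sum_(j <oo) if b j w then (f (z j w - z i w)%R)%:E else 0) else 0.
Proof.
have mG : measurable_fun setT (fun y => (\1_(@unit_cube R n) y)%:E * F (seen_from w y)).
  apply: emeasurable_funM.
    by apply/measurable_EFinP; apply: measurable_indic; exact: measurable_unit_cube.
  exact: (measurableT_comp (measurable_laplace_functional mf) (measurable_seen_from w)).
have G0 y : 0 <= (\1_(@unit_cube R n) y)%:E * F (seen_from w y).
  by apply: mule_ge0; [rewrite lee_fin indicE|exact: expeN_ge0].
rewrite cluster_processE integral_mkcond.
rewrite (eq_integral (fun y : E => (\1_(@unit_cube R n) y)%:E * F (seen_from w y))); last first.
  move=> y _; rewrite patchE indicE; case: ifP => _; first by rewrite mul1e.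
  by rewrite mul0e.
rewrite integral_series_atom//; apply: eq_eseriesr => i _; case: ifP => // bi.
rewrite EFinM -muleA; congr (_ * _).
rewrite /F seen_from_point// laplace_functional_measure//.
rewrite integral_series_atom; last 2 first.
- exact/measurable_EFinP.
- by move=> y; rewrite lee_fin.
rewrite [in RHS](@nneseriesD1 _ _ i)//; last by move=> j _; case: ifP => // _; rewrite lee_fin.
rewrite bi subrr expeND; last 2 first.
- by rewrite lee_fin.
- by apply: nneseries_ge0 => j _ _; case: ifP => // _; rewrite lee_fin.
rewrite muleA [X in X * _](_ : _ = 1) ?mul1e.
  congr expeN; rewrite [RHS]eseries_mkcond; apply: eq_eseriesr => j _.
  by case: (j != i); case: (b j w).
by rewrite /expeN /= -EFinM -expRD subrr expR0.
Qed.

End palm_laplace.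
Section palm_shift.
Context (R : realType) (n : nat).
Local Notation E := 'rV[R]_n.
Local Open Scope ereal_scope.
Variables (lambda mu : R) (Q : probability E R).
Variables (L : {sigma_finite_measure set E -> \bar R}).
Hypotheses (lambda_ge0 : (0 <= lambda)%R) (mu_ge0 : (0 <= mu)%R).
Hypothesis L_shift : forall (c : E) (A : set E), measurable A ->
  L ((fun x => x + c)%R @^-1` A) = L A.
Hypothesis L_unit_cube : L (@unit_cube R n) = 1.
Variables (f : E -> R) (mf : measurable_fun setT f) (f0 : forall x, (0 <= f x)%R).

Let relative (yz : E * E) : R := f (yz.2 - yz.1)%R.

Let cluster_exponent_relative y x :
  cluster_exponent mu Q (slice relative y) x = cluster_exponent mu Q f (x - y)%R.
Proof.
have E1 : \int[Q]_c (1 - expR (- slice relative y (x + c)))%:E =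
    \int[Q]_c (1 - expR (- f (x - y + c)))%:E.
  by apply: eq_integral => c _; rewrite /slice /relative /= addrAC.
exact: (congr1 (fun t => mu%:E * t) E1).
Qed.

Let process_exponent_relative y :
  process_exponent lambda mu Q L (slice relative y) = process_exponent lambda mu Q L f.
Proof.
pose G x := 1 - expeN (cluster_exponent mu Q f x).
have mG : measurable_fun setT G.
  apply: emeasurable_funB; first exact: measurable_cst.
  by apply: (measurableT_comp (@measurable_expeN R)); exact: measurable_cluster_exponent.
have G0 x : 0 <= G x.
  have b0 := cluster_exponent_ge0 Q mu_ge0 x f0.
  by rewrite sube_ge0 ?expeN_fin_num// expeN_le1.
have GE : \int[L]_x (1 - expeN (cluster_exponent mu Q (slice relative y) x)) =
    \int[L]_x G (x - y)%R.
  apply: eq_integral => x _.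
  exact: (congr1 (fun t => 1 - expeN t) (cluster_exponent_relative y x)).
exact: (congr1 (fun t => lambda%:E * t) (etrans GE (integral_L_shift L_shift (- y)%R mG G0))).
Qed.

Let integral_unit_cube_shift (c : E) : \int[L]_x (\1_(@unit_cube R n) (x + c)%R)%:E = 1.
Proof.
rewrite (integral_L_shift L_shift (f := fun x => (\1_(@unit_cube R n) x)%:E)).
- by rewrite integral_indic//= ?setIT//; exact: measurable_unit_cube.
- by apply/measurable_EFinP; apply: measurable_indic; exact: measurable_unit_cube.
- by move=> x; rewrite lee_fin indicE.
Qed.

Lemma palm_integral_unit_cube :
  palm_integral lambda mu Q L false (fun y => \1_(@unit_cube R n) y * expR (f 0))%R relative =
  (lambda * mu)%:E * \int[Q]_a expeN (palm_exponent lambda mu Q L true f (- a)%R).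
Proof.
rewrite /palm_integral mul0e adde0.
suff -> : other_cluster_integral lambda mu Q L false
    (fun y => \1_(@unit_cube R n) y * expR (f 0))%R relative =
  \int[Q]_a expeN (palm_exponent lambda mu Q L true f (- a)%R) by [].
have mcube : measurable_fun setT (\1_(@unit_cube R n) : E -> R).
  by apply: measurable_indic; exact: measurable_unit_cube.
have mrel : measurable_fun setT relative.
  by apply: (measurableT_comp mf); exact: measurable_rV_sub.
pose K c := expeN (palm_exponent lambda mu Q L true f (- c)%R).
have mK : measurable_fun setT K.
  apply: (measurableT_comp (@measurable_expeN R)).
  apply: (measurableT_comp (f := palm_exponent lambda mu Q L true f)).
    exact: measurable_palm_exponent.
  exact: measurable_rV_opp.
have K0 c : 0 <= K c by exact: expeN_ge0.
have m2 : measurable_fun setT (fun xc : E * E => (\1_(@unit_cube R n) (xc.1 + xc.2)%R)%:E * K xc.2).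
  apply: emeasurable_funM; last exact: (measurableT_comp mK).
  by apply/measurable_EFinP; apply: (measurableT_comp mcube); exact: measurable_rV_add.
have p0 (xc : E * E) : 0 <= (\1_(@unit_cube R n) (xc.1 + xc.2)%R)%:E * K xc.2.
  by apply: mule_ge0 => //; rewrite lee_fin indicE.
rewrite other_cluster_integralE//; last 2 first.
- by apply: measurable_funM => //; exact: measurable_cst.
- by move=> y; exact: f0.
have alpha0 : 0 <= process_exponent lambda mu Q L f by exact: process_exponent_ge0.
have beta0 x : 0 <= cluster_exponent mu Q f x by exact: cluster_exponent_ge0.
have integrandE (x a c : E) :
    (\1_(@unit_cube R n) (x + c)%R * expR (f 0%R))%:E *
      expeN (diagonal_discount lambda mu Q L false relative (x + c)%R (- a)%R +
        cluster_exponent mu Q (slice relative (x + c)%R) x) =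
    (\1_(@unit_cube R n) (x + c)%R)%:E * K c.
  rewrite /diagonal_discount /palm_exponent process_exponent_relative cluster_exponent_relative.
  rewrite adde0 -addeA [in X in _ + (_ + X)]opprD addNKr /relative /= subrr.
  rewrite expeND; [|by rewrite lee_fin|exact: adde_ge0].
  rewrite EFinM -muleA; congr (_ * _); rewrite muleA [X in X * _](_ : _ = 1) ?mul1e//.
  by rewrite /expeN /= -EFinM -expRD subrr expR0.
rewrite (eq_integral (fun x : E => \int[Q]_c ((\1_(@unit_cube R n) (x + c)%R)%:E * K c))); last first.
  move=> x _.
  rewrite (eq_integral (cst (\int[Q]_c ((\1_(@unit_cube R n) (x + c)%R)%:E * K c)))); last first.
    by move=> a _; apply: eq_integral => c _; exact: integrandE.
  rewrite integral_cst// [X in _ * X](_ : _ = 1); last exact: probability_setT.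
  by rewrite mule1.
rewrite (fubini_tonelli (fun xc : E * E => (\1_(@unit_cube R n) (xc.1 + xc.2)%R)%:E * K xc.2))//.
apply: eq_integral => c _.
rewrite -[RHS]mul1e -(integral_unit_cube_shift c) -ge0_integralZr//.
- apply/measurable_EFinP; apply: (measurableT_comp mcube).
  by apply: measurable_rV_add => //; exact: measurable_cst.
- exact: K0.
Qed.

End palm_shift.
Section reduced_palm_laplace.
Context (R : realType) (n : nat).
Local Notation E := 'rV[R]_n.
Local Open Scope ereal_scope.
Context (d : measure_display) (T : measurableType d) (P : probability T R).
Variables (X : nat -> {RV P >-> E}) (kappa : nat -> {RV P >-> nat}).
Variables (Y : nat -> nat -> {RV P >-> E}).
Variables (lambda mu : R) (Q : probability E R).
Variables (L : {sigma_finite_measure set E -> \bar R}).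
Hypothesis LE : @lebesgue_rV R n = L.
Hypotheses (lambda_gt0 : (0 < lambda)%R) (mu_gt0 : (0 < mu)%R).
Hypothesis ppcp : PPCP X kappa Y lambda mu Q.
Context (d0 : measure_display) (T0 : measurableType d0) (P0 : probability T0 R).
Variables (Z : nat -> {RV P0 >-> E}).
Hypothesis palmZ : reduced_palm P (lambda * mu) (cluster_process X kappa Y)
  P0 (fun w => point_measure (fun i => Z i w)).

Lemma laplace_reduced_palm (f : E -> R) : measurable_fun setT f -> (forall x, 0 <= f x)%R ->
  \int[P0]_w expeN (point_sum (fun _ => cst true) (fun i => Z i : T0 -> E) f w) =
  \int[Q]_a expeN (palm_exponent lambda mu Q L true f (- a)%R).
Proof.
move=> mf f0.
have lambda_ge0 := ltW lambda_gt0; have mu_ge0 := ltW mu_gt0.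
have L_shift (c : E) (A : set E) : measurable A -> L ((fun x => x + c)%R @^-1` A) = L A.
  by move=> mA; rewrite -LE; exact: lebesgue_rV_shift.
have L_cube (c : nat) : L (@cube_rV R n c%:R) < +oo.
  by rewrite -LE; exact: lebesgue_cube_rV_lty.
have L_unit : L (@unit_cube R n) = 1 by rewrite -LE; exact: lebesgue_unit_cube.
have := palmZ (measurable_laplace_functional mf) (fun eta => expeN_ge0 _).
rewrite (eq_integral (fun w => expeN (point_sum (fun _ => cst true) (fun i => Z i : T0 -> E) f w))); last first.
  move=> w _.
  have := laplace_functional_measure mf f0 (mseries (fun k => \d_(Z k w)) 0).
  by rewrite integral_series_dirac//; exact/measurable_EFinP.
move=> ->.
pose g (y : E) : R := (\1_(@unit_cube R n) y * expR (f 0))%R.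
pose h (yz : E * E) : R := f (yz.2 - yz.1)%R.
have mg : measurable_fun setT g.
  apply: measurable_funM; last exact: measurable_cst.
  by apply: measurable_indic; exact: measurable_unit_cube.
have mh : measurable_fun setT h by apply: (measurableT_comp mf); exact: measurable_rV_sub.
have g0 y : (0 <= g y)%R by rewrite mulr_ge0 ?expR_ge0// indicE.
have h0 yz : (0 <= h yz)%R by exact: f0.
have lap (k : E -> R) : measurable_fun setT k -> (forall x, 0 <= k x)%R ->
    \int[P]_w expeN (point_sum (cluster_mark kappa) (cluster_point X Y) k w) =
    \int[Q]_a expeN (palm_exponent lambda mu Q L false k (- a)%R).
  move=> mk k0; rewrite (laplace_cluster_process LE lambda_ge0 mu_ge0 ppcp mk k0).
  rewrite (eq_integral (cst (expeN (process_exponent lambda mu Q L k)))); last first.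
    by move=> a _; rewrite /palm_exponent adde0.
  by rewrite integral_cst// [X in _ * X](_ : _ = 1); [rewrite mule1|exact: probability_setT].
have E1 := first_order_points lambda_ge0 mu_ge0 L_shift L_cube
  (measurable_cluster_mark kappa) (measurable_cluster_point X Y) lap mg mh g0 h0.
rewrite (palm_integral_unit_cube Q lambda_ge0 mu_ge0 L_shift L_unit mf f0) in E1.
rewrite [X in _ * X](_ : _ = (lambda * mu)%:E * \int[Q]_a expeN (palm_exponent lambda mu Q L true f (- a)%R)).
  by rewrite muleA -EFinM mulVf ?mul1e// mulf_neq0// gt_eqF.
rewrite -E1; apply: eq_integral => w _.
exact: (integral_seen_from X kappa Y mf f0 w).
Qed.

End reduced_palm_laplace.

Section exponential_variable.
Context d (T : measurableType d) (R : realType) (P : probability T R).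
Variables (H : T -> R) (mH : measurable_fun setT H).
Hypothesis lawH : forall V : set R, measurable V -> P (H @^-1` V) = exponential_prob 1 V.
Local Open Scope ereal_scope.

Let tail_fin (s : R) : (0 <= s)%R -> P [set w | (s < H w)%R] = (expR (- s))%:E.
Proof.
move=> s0.
have mneg : measurable (`]-oo, 0%R[%classic : set R) by exact: measurable_itv.
have mcc : measurable (`[0%R, s]%classic : set R) by exact: measurable_itv.
have mpre (V : set R) : measurable V -> measurable (H @^-1` V).
  by move=> mV; rewrite -[_ @^-1` _]setTI; exact: mH.
have neg : P (H @^-1` `]-oo, 0%R[%classic) = 0.
  rewrite lawH// /exponential_prob integral0_eq// => x; rewrite /= in_itv /= => x0.
  by rewrite lt0_exponential_pdf.
have cc : P (H @^-1` `[0%R, s]%classic) = 1 - (expR (- s))%:E.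
  rewrite lawH//; move: s0; rewrite le_eqVlt => /predU1P[<-|s0].
    rewrite oppr0 expR0 subee// /exponential_prob (@integral_Sset1 _ _ _ 0%R)// => x.
    by rewrite /= in_itv /= => /andP[x0 x0']; apply/le_anti/andP.
  by rewrite exponential_prob_itv0c// mulN1r.
have -> : [set w | (s < H w)%R] = ~` (H @^-1` `]-oo, 0%R[%classic `|` H @^-1` `[0%R, s]%classic).
  apply/seteqP; split => w /=; rewrite !in_itv /=.
    by move=> sw [|/andP[_]]; [rewrite ltNge (le_trans s0 (ltW sw))|rewrite leNgt sw].
  move=> /not_orP[/negP + /negP]; rewrite -leNgt => ->/=.
  by rewrite -ltNge.
rewrite probability_setC; last by apply: measurableU; exact: mpre.
rewrite measureU//; [|exact: mpre|exact: mpre|].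
  have -> : (P (H @^-1` `]-oo, 0%R[%classic) + P (H @^-1` `[0%R, s]%classic))%R =
      1 - (expR (- s))%:E by rewrite -[RHS]add0e -cc -neg.
  by rewrite oppeB// addeA subee// add0e.
apply/seteqP; split => w //=; rewrite !in_itv /= => -[w0 /andP[w0']].
by move: w0; rewrite ltNge w0'.
Qed.

Lemma exponential_tail (s : \bar R) : 0 <= s -> P [set w | s < (H w)%:E] = expeN s.
Proof.
case: s => [s|_|//]; first by rewrite lee_fin => s0; rewrite /expeN /= -tail_fin.
rewrite expeNy (_ : [set w | _] = set0) ?measure0//.
by apply/seteqP; split => w //=; rewrite ltNge leey.
Qed.

Lemma exponential_gt0 : {ae P, forall w, (0 < H w)%R}.
Proof.
have m0 : measurable [set w | (0 < H w)%R].
  by rewrite -[X in measurable X]setTI; exact: measurable_fun_ltr.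
apply/negligibleP.
- exact: measurableC.
- apply: (etrans (probability_setC P m0)).
  by have := exponential_tail (lexx 0); rewrite expeN0 => ->; rewrite subee.
Qed.

Lemma exponential_laplace (s : R) : (0 <= s)%R ->
  \int[P]_w expeN (s * Num.max (H w) 0)%:E = expeN (ln (1 + s))%:E.
Proof.
move=> s0; have s1 : (0 < 1 + s)%R by rewrite ltr_pwDl.
rewrite /expeN /= expRN lnK//.
move: s0; rewrite le_eqVlt => /predU1P[<-|s0].
  rewrite addr0 invr1 (eq_integral (cst 1)); last by move=> w _; rewrite mul0r oppr0 expR0.
  by rewrite integral_cst// mul1e; exact: probability_setT.
have pdf0 u : 0 <= (exponential_pdf s u)%:E by rewrite lee_fin exponential_pdf_ge0// ltW.
have mpdf : measurable_fun setT (fun u : measurableTypeR R => (exponential_pdf s u)%:E).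
  by apply/measurable_EFinP; exact: measurable_exponential_pdf.
pose ind (z : T * measurableTypeR R) : R := ((z.2 <= H z.1)%R : bool)%:R.
have mind : measurable_fun setT ind.
  apply: (measurableT_comp (f := fun c : bool => c%:R : R)) => //.
  apply: measurable_fun_ler; first exact: measurable_snd.
  exact: (measurableT_comp mH measurable_fst).
have mF : measurable_fun setT (fun z : T * measurableTypeR R => (ind z)%:E * (exponential_pdf s z.2)%:E).
  apply: emeasurable_funM; first exact/measurable_EFinP.
  exact: (measurableT_comp mpdf measurable_snd).
have F0 (z : T * measurableTypeR R) : 0 <= (ind z)%:E * (exponential_pdf s z.2)%:E.
  by apply: mule_ge0 => //; rewrite lee_fin.
have complementE w : (0 < H w)%R ->
    \int[lebesgue_measure]_u ((ind (w, u))%:E * (exponential_pdf s u)%:E) =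
    1 - expeN (s * Num.max (H w) 0)%:E.
  move=> Hw; rewrite max_l ?ltW//.
  rewrite /expeN /= -(mulNr s) -exponential_prob_itv0c// /exponential_prob [RHS]integral_mkcond.
  apply: eq_integral => u _; rewrite patchE /ind /=.
  rewrite mem_setE in_itv /=; case: (boolP (_ && _)) => [/andP[_ ->]|]; first by rewrite mul1e.
  rewrite negb_and -!ltNge => /orP[u0|Hu]; first by rewrite lt0_exponential_pdf// mule0.
  by rewrite leNgt Hu mul0e.
have atom0 u : P (H @^-1` [set u]) = 0 by rewrite lawH// /exponential_prob integral_set1.
have tailE u : (0 <= u)%R -> P [set w | (u <= H w)%R] = (expR (- u))%:E.
  move=> u0; rewrite -tail_fin//.
  rewrite (_ : [set w | (u <= H w)%R] = [set w | (u < H w)%R] `|` H @^-1` [set u]).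
    rewrite -[RHS]adde0 -(atom0 u); apply: measureU.
    - by rewrite -[X in measurable X]setTI; exact: measurable_fun_ltr.
    - by rewrite -[X in measurable X]setTI; exact: mH.
    - by apply/seteqP; split => w //= -[+ Hu]; rewrite Hu ltxx.
  apply/seteqP; split => w /=; rewrite le_eqVlt.
    by move=> /predU1P[->|]; [right|left].
  by move=> [->|->]; rewrite ?eqxx ?orbT.
have integralE : \int[P]_w \int[lebesgue_measure]_u ((ind (w, u))%:E * (exponential_pdf s u)%:E) =
    (s / (1 + s))%:E.
  rewrite (fubini_tonelli (fun z : T * measurableTypeR R => (ind z)%:E * (exponential_pdf s z.2)%:E))//.
  rewrite (eq_integral (fun u : measurableTypeR R => (s / (1 + s))%:E * (exponential_pdf (1 + s) u)%:E)).
    rewrite ge0_integralZl//.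
    - by rewrite integral_exponential_pdf// mule1.
    - by apply/measurable_EFinP; exact: measurable_exponential_pdf.
    - by move=> u _; rewrite lee_fin exponential_pdf_ge0// ltW.
    - by rewrite lee_fin divr_ge0// ltW.
  move=> u _; have [u0|u0] := ltP u 0%R.
    rewrite (lt0_exponential_pdf _ u0) mule0 integral0_eq// => w _.
    by rewrite /= lt0_exponential_pdf// mule0.
  have mindu : measurable_fun setT (fun w => (ind (w, u))%:E).
    apply/measurable_EFinP.
    exact: (measurableT_comp (f := ind) mind (measurable_fun_pair (@measurable_id _ _ _) (measurable_cst u))).
  transitivity ((\int[P]_w (ind (w, u))%:E) * (exponential_pdf s u)%:E).
    rewrite -ge0_integralZr//=; last by move=> w _; rewrite lee_fin.
  have -> : \int[P]_w (ind (w, u))%:E = (expR (- u))%:E.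
    rewrite -(tailE _ u0) -[X in P X]setIT -integral_indic//; last first.
      by rewrite -[X in measurable X]setTI; exact: measurable_fun_ler.
    apply: eq_integral => w _; rewrite indicE /ind /=; congr (_%:R%:E).
    by have [uH|uH] := boolP (u <= H w)%R; [rewrite mem_set|rewrite memNset//; exact/negP].
  rewrite !exponential_pdfE// -!EFinM; congr EFin.
  rewrite [RHS]mulrA divfK ?gt_eqF// mulrCA -expRD; congr (s * expR _)%R; ring.
have mexp : measurable_fun setT (fun w => expeN (s * Num.max (H w) 0)%:E).
  apply: (measurableT_comp (@measurable_expeN R)); apply/measurable_EFinP.
  apply: measurable_funM => //; exact: measurable_maxr.
have e0 w : 0 <= (s * Num.max (H w) 0)%:E.
  by rewrite lee_fin; apply: mulr_ge0; [exact: ltW|rewrite le_max lexx orbT].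
have sum1 : \int[P]_w (1 - expeN (s * Num.max (H w) 0)%:E) + \int[P]_w expeN (s * Num.max (H w) 0)%:E = 1.
  rewrite -ge0_integralD//.
  - rewrite (eq_integral (cst 1)); last by move=> w _; rewrite subeK// expeN_fin_num.
    by rewrite integral_cst// mul1e; exact: probability_setT.
  - by move=> w _; rewrite sube_ge0 ?expeN_fin_num// expeN_le1.
  - by apply: emeasurable_funB => //; exact: measurable_cst.
  - by move=> w _; exact: expeN_ge0.
have complement : \int[P]_w (1 - expeN (s * Num.max (H w) 0)%:E) = (s / (1 + s))%:E.
  rewrite -integralE; apply: ae_eq_integral => //.
  - by apply: emeasurable_funB => //; exact: measurable_cst.
  - exact: (@measurable_fun_fubini_tonelli_F _ _ _ (measurableTypeR R) _ lebesgue_measure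
      (fun z => (ind z)%:E * (exponential_pdf s z.2)%:E) mF F0).
  - by apply: filterS exponential_gt0 => w Hw _; rewrite complementE.
have -> : \int[P]_w (expR (- (s * Num.max (H w) 0)))%:E = 1 - (s / (1 + s))%:E.
  by rewrite -sum1 complement addeC addeK.
rewrite -EFinB; congr EFin; have s1' : (1 + s != 0)%R by rewrite gt_eqF.
by field.
Qed.

End exponential_variable.
Lemma measurable_fun_limn d (T : measurableType d) (R : realType) (u : nat -> T -> \bar R) :
  (forall k, measurable_fun setT (u k)) -> measurable_fun setT (fun w => limn (u ^~ w)).
Proof.
move=> mu.
have msup : measurable_fun setT (fun w => limn_esup (u ^~ w)) by exact: measurable_fun_limn_esup.
have minf : measurable_fun setT (fun w => limn_einf (u ^~ w)).
  apply: measurableT_comp => //; apply: measurable_fun_limn_esup => k.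
  exact: measurableT_comp.
rewrite (_ : (fun w => _) = fun w => if limn_einf (u ^~ w) == limn_esup (u ^~ w)
    then limn_esup (u ^~ w) else point); last first.
  apply/funext => w; case: eqP => [ue|ue]; last first.
    apply: dvgP => cu; apply: ue.
    by rewrite (is_cvg_limn_einfE cu) (is_cvg_limn_esupE cu).
  apply/cvg_lim => //; apply: (@squeeze_cvge _ _ _ _ (einfs (u ^~ w)) _ (esups (u ^~ w))).
  - apply: nearW => k; apply/andP; split.
      by apply: ereal_inf_lbound; exists k => /=.
    by apply: ereal_sup_ubound; exists k => /=.
  - rewrite -ue limn_einf_lim; exact: is_cvg_einfs.
  - rewrite limn_esup_lim; exact: is_cvg_esups.
apply: measurable_fun_ifT => //.
apply: (measurable_fun_bool true); rewrite setTI.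
rewrite (_ : _ @^-1` _ = [set w | limn_einf (u ^~ w) = limn_esup (u ^~ w)]).
  by rewrite -[X in measurable X]setTI; exact: measurable_eqe.
by apply/seteqP; split => w /eqP.
Qed.

Lemma measurable_invr (R : realType) : measurable_fun setT (fun x : measurableTypeR R => x^-1 : measurableTypeR R).
Proof.
rewrite (_ : (fun x => _) = fun x : R => if 0 < x then expR (- ln x) else
    if x < 0 then - expR (- ln (- x)) else 0); last first.
  apply/funext => x; case: ltgtP => x0.
  - by rewrite expRN lnK.
  - by rewrite expRN lnK ?invrN ?opprK// posrE oppr_gt0.
  - by rewrite -x0 invr0.
have mln := @measurable_ln R.
apply: measurable_fun_ifT; first exact: measurable_fun_ltr.
  apply: (measurableT_comp (@measurable_expR R)); exact: measurable_funN.
apply: measurable_fun_ifT => //; first exact: measurable_fun_ltr.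
apply: measurable_funN; apply: (measurableT_comp (@measurable_expR R)).
apply: measurable_funN; apply: (measurableT_comp mln); exact: measurable_funN.
Qed.

Lemma measurable_inve (R : realType) : measurable_fun setT (fun x : \bar R => x^-1)%E.
Proof.
have meq (c : \bar R) : measurable_fun setT (fun x : \bar R => x == c).
  apply: (measurable_fun_bool true); rewrite setTI.
  rewrite (_ : _ @^-1` _ = [set c]); first exact: emeasurable_set1.
  by apply/seteqP; split => x /eqP.
rewrite (_ : (fun x => _) = fun x : \bar R => if x == 0%E then +oo%E else
    if x == +oo%E then 0%E else if x == -oo%E then -oo%E else ((fine x)^-1)%:E); last first.
  by apply/funext => -[r| |] //=; rewrite inver eqe.
apply: measurable_fun_ifT => //; apply: measurable_fun_ifT => //; apply: measurable_fun_ifT => //.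
apply/measurable_EFinP.
apply: (measurableT_comp (@measurable_invr R)); exact: fine_measurable.
Qed.
Lemma measurable_bool_set d (T : measurableType d) (b : T -> bool) :
  measurable [set w | b w] -> measurable_fun setT b.
Proof.
move=> mb; apply: (measurable_fun_bool true); rewrite setTI.
by rewrite (_ : _ @^-1` _ = [set w | b w])//; apply/seteqP; split => w.
Qed.

Section nearest_transmitter.
Context (R : realType) (n : nat).
Local Notation E := 'rV[R]_n.

Definition is_nearest (y : nat -> E) (m : nat) : bool :=
  `[< forall j, j != m -> enorm (y m) < enorm (y j) >].

Lemma measurable_is_nearest d (T : measurableType d) (y : nat -> T -> E) (m : nat) :
  (forall j, measurable_fun setT (y j)) ->
  measurable_fun setT (fun w => is_nearest (y ^~ w) m).
Proof.
move=> my; apply: measurable_bool_set.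
rewrite (_ : [set w | _] = \bigcap_j [set w | j != m -> enorm (y m w) < enorm (y j w)]).
  apply: bigcapT_measurable => j; have [->|jm] := eqVneq j m.
    by rewrite (_ : [set w | _] = setT)//; apply/seteqP; split.
  rewrite (_ : [set w | _] = [set w | enorm (y m w) < enorm (y j w)]); last first.
    by apply/seteqP; split => [w /(_ isT)|w + _].
  rewrite -[X in measurable X]setTI; apply: measurable_fun_ltr => //.
  - exact: (measurableT_comp (@measurable_enorm R n) (my m)).
  - exact: (measurableT_comp (@measurable_enorm R n) (my j)).
by apply/seteqP; split => [w /asboolP near j _|w near]; [exact: near|apply/asboolP => j; exact: near].
Qed.

Definition noise_factor (ell : R -> R) (theta noise : R) (y : E) : R :=
  if ell (enorm y) == 0 then 0 else expR (- (theta * noise / ell (enorm y))).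

Variables (ell : R -> R) (noise theta : R).
Hypotheses (mell : measurable_fun setT ell) (ell_ge0 : forall r, 0 <= ell r).
Hypotheses (noise_ge0 : 0 <= noise) (theta_gt0 : 0 < theta).

Lemma noise_factor_ge0 y : 0 <= noise_factor ell theta noise y.
Proof. by rewrite /noise_factor; case: ifP => // _; exact: expR_ge0. Qed.

Lemma noise_factor_le1 y : noise_factor ell theta noise y <= 1.
Proof.
rewrite /noise_factor; case: ifP => // _; rewrite expR_le1 lerNl oppr0.
by apply: divr_ge0 => //; apply: mulr_ge0 => //; exact: ltW.
Qed.

Lemma measurable_noise_factor : measurable_fun setT (noise_factor ell theta noise).
Proof.
have ml : measurable_fun setT (fun y : 'rV[R]_n => ell (enorm y)).
  exact: (measurableT_comp mell (@measurable_enorm R n)).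
apply: measurable_fun_ifT => //.
  apply: measurable_bool_set; rewrite -[X in measurable X]setTI.
  rewrite (_ : [set w | _] = (fun y : 'rV[R]_n => ell (enorm y)) @^-1` [set 0]).
    by apply: ml.
  by apply/seteqP; split => y /eqP.
apply: (measurableT_comp (@measurable_expR R)); apply: measurable_funN.
apply: measurable_funM => //; exact: (measurableT_comp (@measurable_invr R) ml).
Qed.

End nearest_transmitter.

Section fading_coverage.
Context d (T : measurableType d) (R : realType) (P : probability T R) (n : nat).
Local Notation E := 'rV[R]_n.
Variables (H : nat -> {RV P >-> R}) (Y : nat -> {RV P >-> E}).
Hypothesis fadHY : fading H Y.
Variables (ell : R -> R) (noise theta : R).
Hypotheses (mell : measurable_fun setT ell) (ell_ge0 : forall r, 0 <= ell r).
Hypotheses (noise_ge0 : 0 <= noise) (theta_gt0 : 0 < theta).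
Local Open Scope ereal_scope.

Let lawH j (V : set R) : measurable V -> P (H j @^-1` V) = exponential_prob 1 V.
Proof. by move=> mV; have [h _] := fadHY; exact: h. Qed.

Let l j w : R := ell (enorm (Y j w)).
Let Hp j w : R := Num.max (H j w) 0%R.

Let l_ge0 j w : (0 <= l j w)%R.
Proof. exact: ell_ge0. Qed.

Let Hp_ge0 j w : (0 <= Hp j w)%R.
Proof. by rewrite /Hp le_max lexx orbT. Qed.

Lemma measurable_SINR m : measurable_fun setT (SINR ell noise H Y m).
Proof.
have ml j : measurable_fun setT (fun w => ell (enorm (Y j w))).
  apply: (measurableT_comp mell); exact: (measurableT_comp (@measurable_enorm R n)).
have mHl j : measurable_fun setT (fun w => (H j w * ell (enorm (Y j w)))%:E).
  by apply/measurable_EFinP; exact: measurable_funM.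
apply: emeasurable_funM => //.
apply: (measurableT_comp (@measurable_inve R)).
apply: emeasurable_funD; last exact: measurable_cst.
apply: measurable_fun_limn => k.
rewrite (_ : (fun w => _) = fun w => \sum_(0 <= j < k) if j != m then (H j w * ell (enorm (Y j w)))%:E else 0).
  by apply: emeasurable_sum => j; case: (j != m) => //; exact: measurable_cst.
by apply/funext => w; rewrite big_mkcond.
Qed.

Variable m : nat.

Let interference w : \bar R := \sum_(j <oo) if j != m then (Hp j w * l j w)%:E else 0.

Let interference_ge0 w : 0 <= interference w.
Proof. by apply: nneseries_ge0 => j _ _; case: ifP => // _; rewrite lee_fin mulr_ge0. Qed.

Lemma lt_SINR w : (forall j, 0 < H j w)%R ->
  (theta%:E < SINR ell noise H Y m w) =
  (l m w != 0%R) && ((theta / l m w)%:E * (interference w + noise%:E) < (H m w)%:E).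
Proof.
move=> H0; rewrite /SINR.
have -> : \sum_(0 <= j <oo | j != m) (H j w * ell (enorm (Y j w)))%:E = interference w.
  rewrite eseries_mkcond; apply: eq_eseriesr => j _.
  by rewrite /Hp max_l// ltW.
have [l0|l0] := eqVneq (l m w) 0%R.
  by rewrite /= [ell _]l0 mulr0 mul0e lte_fin ltNge ltW.
have lm0 : (0 < l m w)%R by rewrite lt_neqAle eq_sym l0 ell_ge0.
have D0 : 0 <= interference w + noise%:E by apply: adde_ge0; rewrite ?lee_fin.
rewrite /= -/(l m w); move: D0; case: (interference w + noise%:E) => [D|_|//]; last first.
  rewrite mule0 lte_fin ltNge ltW//=; rewrite mulry gtr0_sg ?divr_gt0// mul1e.
  by rewrite ltNge leey.
rewrite lee_fin le_eqVlt => /predU1P[<-|D0].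
  rewrite inve0 mulry gtr0_sg ?mulr_gt0// mul1e ltry mule0.
  by rewrite lte_fin H0.
rewrite inver gt_eqF// -!EFinM !lte_fin.
by rewrite ltr_pdivlMr// mulrAC ltr_pdivrMr.
Qed.

Let near w : bool := is_nearest (fun j => Y j w) m.


Let G (o : option nat) : set (set T) :=
  if o is Some j then g_sigma_algebra_preimage (H j : T -> R)
  else g_sigma_family setT (fun j => Y j : T -> E).

Let sG o : sigma_algebra setT (G o).
Proof.
case: o => [j|]; last exact: smallest_sigma_algebra.
by apply: sigma_algebra_preimage; exact: sigma_algebra_measurable.
Qed.

Let mG o : G o `<=` measurable.
Proof.
case: o => [j|].
  by move=> A [C mC <-]; exact: measurable_funPT.
apply: smallest_sub; first exact: sigma_algebra_measurable.
by move=> A [j _] [C mC <-]; exact: measurable_funPT.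
Qed.

Let mYG j : measurable_fun [set: g_sigma_algebraType (G None)] (Y j : T -> E).
Proof.
move=> _ C mC; apply: sub_sigma_algebra; apply: sub_sigma_algebra.
by exists j => //; exists C.
Qed.

Let mHG j : measurable_fun [set: g_sigma_algebraType (G (Some j))] (H j : T -> R).
Proof. by move=> _ C mC; apply: sub_sigma_algebra; exists C. Qed.

Let others : set (set T) := <<s \bigcup_(o in [set o | o <> Some m]) G o >>.

Let mothers o : o <> Some m -> G o `<=` others.
Proof. by move=> om A GA; apply: sub_sigma_algebra; exists o. Qed.

Let mYo j : measurable_fun [set: g_sigma_algebraType others] (Y j : T -> E).
Proof.
move=> _ C mC; apply: sub_sigma_algebra; apply: (@mothers None) => //.
by apply: sub_sigma_algebra; exists j => //; exists C.
Qed.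

Let mHo j : j != m -> measurable_fun [set: g_sigma_algebraType others] (H j : T -> R).
Proof.
move=> jm _ C mC; apply: sub_sigma_algebra; apply: (@mothers (Some j)).
  by move=> [/eqP]; rewrite (negbTE jm).
by exists C.
Qed.

Let mHG' : measurable_fun [set: g_sigma_algebraType (G (Some m))] (H m : T -> R).
Proof. exact: mHG. Qed.

Let ml d' (S : measurableType d') (y : S -> E) : measurable_fun setT y ->
  measurable_fun setT (fun w => ell (enorm (y w))).
Proof.
by move=> my; apply: (measurableT_comp mell); exact: (measurableT_comp (@measurable_enorm R n) my).
Qed.

Let sinr_event (w w' : T) : bool := [&& near w, l m w != 0%R &
  (theta / l m w)%:E * (interference w + noise%:E) < (H m w')%:E].

Let threshold_ge0 w : 0 <= (theta / l m w)%:E * (interference w + noise%:E).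
Proof.
by apply: mule_ge0; [rewrite lee_fin divr_ge0// ltW|apply: adde_ge0; rewrite ?lee_fin].
Qed.

Let measurable_sinr_event d' (S : measurableType d') (y : nat -> S -> E) (h : nat -> S -> R)
    (h' : S -> R) : (forall j, measurable_fun setT (y j)) ->
  (forall j, j != m -> measurable_fun setT (h j)) -> measurable_fun setT h' ->
  measurable_fun setT (fun s => [&& is_nearest (y ^~ s) m, ell (enorm (y m s)) != 0%R &
    (theta / ell (enorm (y m s)))%:E *
    (\sum_(j <oo) (if j != m then (Num.max (h j s) 0%R * ell (enorm (y j s)))%:E else 0) + noise%:E) <
    (h' s)%:E]).
Proof.
move=> my mh mh'.
have mly j := ml (my j).
apply: measurable_and; first exact: measurable_is_nearest.
apply: measurable_and.
  apply: measurable_bool_set; rewrite -[X in measurable X]setTI.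
  rewrite (_ : [set w | _] = (fun s => ell (enorm (y m s))) @^-1` (~` [set 0%R])).
    by apply: mly => //; exact: measurableC.
  by apply/seteqP; split => s /eqP.
apply: measurable_bool_set; rewrite -[X in measurable X]setTI; apply: measurable_lte => //.
- apply: emeasurable_funM.
    apply/measurable_EFinP; apply: measurable_funM => //.
    exact: (measurableT_comp (@measurable_invr R) (mly m)).
  apply: emeasurable_funD; last exact: measurable_cst.
  apply: ge0_emeasurable_sum.
    by move=> j s _ _; case: ifP => // _; rewrite lee_fin mulr_ge0// le_max lexx orbT.
  move=> j _; have [->|jm] := eqVneq j m; first exact: measurable_cst.
  apply/measurable_EFinP; apply: measurable_funM => //.
  by apply: measurable_maxr => //; exact: mh.
- exact/measurable_EFinP.
Qed.

Lemma measurable_coverage_event : measurable [set w | theta%:E < SINR ell noise H Y m w /\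
  forall j, j != m -> (enorm (Y m w) < enorm (Y j w))%R].
Proof.
set A := [set w | _].
have -> : A = [set w | theta%:E < SINR ell noise H Y m w] `&` [set w | near w].
  apply/seteqP; split => w [sw nw]; split => //; first exact/asboolP.
  by move/asboolP: nw.
apply: measurableI.
  by rewrite -[X in measurable X]setTI; apply: measurable_lte => //; exact: measurable_SINR.
have := @measurable_is_nearest R n _ _ (fun j => Y j : T -> E) m (fun j => measurable_funP (Y j)).
move=> /(_ measurableT [set true]); rewrite setTI => mn.
rewrite (_ : [set w | near w] = (fun w => near w) @^-1` [set true]); last by apply/seteqP; split.
exact: mn.
Qed.

Let coverage_event : P [set w | theta%:E < SINR ell noise H Y m w /\
             forall j, j != m -> (enorm (Y m w) < enorm (Y j w))%R] =
  \int[P]_w (sinr_event w w)%:R%:E.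
Proof.
set A := [set w | _]; have mA : measurable A by exact: measurable_coverage_event.
rewrite -[X in P X]setIT -integral_indic//; apply: ae_eq_integral => //.
- by apply/measurable_EFinP; exact: measurable_indic.
- apply/measurable_EFinP; apply: (measurableT_comp (f := fun c : bool => c%:R : R)) => //.
  exact: (@measurable_sinr_event _ T (fun j => Y j : T -> E) (fun j => H j : T -> R) (H m)).
- have : {ae P, forall w, forall j, (0 < H j w)%R}.
    apply: ae_foralln => j; exact: (exponential_gt0 (measurable_funP (H j)) (@lawH j)).
  apply: filterS => w Hw _; rewrite indicE; suff -> : (w \in A) = sinr_event w w by [].
  have -> : sinr_event w w = near w && (theta%:E < SINR ell noise H Y m w).
    by rewrite lt_SINR.
  have [wA|wA] := pselect (A w).
    by rewrite mem_set//; case: wA => -> nw; have -> : near w by exact/asboolP.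
  rewrite memNset//; apply/esym/negP => /andP[/asboolP nw sw].
  by apply: wA.
Qed.

Lemma fading_coverage :
  P [set w | theta%:E < SINR ell noise H Y m w /\
             forall j, j != m -> (enorm (Y m w) < enorm (Y j w))%R] =
  \int[P]_w (if is_nearest (fun j => Y j w) m then
    (noise_factor ell theta noise (Y m w))%:E *
    expeN (\sum_(j <oo) if j != m then (ln (1 + theta * (ell (enorm (Y j w)) / ell (enorm (Y m w)))))%:E else 0)
    else 0).
Proof.
rewrite coverage_event; have [_ indG] := fadHY.
pose phi (z : g_sigma_algebraType others * g_sigma_algebraType (G (Some m))) : \bar R :=
  (sinr_event z.1 z.2)%:R%:E.
have mphi : measurable_fun setT phi.
  apply/measurable_EFinP; apply: (measurableT_comp (f := fun c : bool => c%:R : R)) => //.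
  exact: (@measurable_sinr_event _ (g_sigma_algebraType others * g_sigma_algebraType (G (Some m)))%type
    (fun j z => Y j z.1) (fun j z => H j z.1) (fun z => H m z.2)
    (fun j => measurableT_comp (@mYo j) measurable_fst)
    (fun j jm => measurableT_comp (mHo jm) measurable_fst)
    (measurableT_comp mHG' measurable_snd)).
have phi0 z : 0 <= phi z by rewrite lee_fin.
have indm A B : others A -> G (Some m) B -> P (A `&` B) = P A * P B.
  by move=> oA GB; apply: (independent_grouping sG mG indG _ oA GB); exact.
rewrite (integral_diagonal (smallest_sigma_algebra _ _) (sG (Some m)) _ (@mG (Some m)) indm mphi phi0); last first.
  apply: smallest_sub; first exact: sigma_algebra_measurable.
  by move=> A [k _]; exact: mG.
pose g w : \bar R := if near w then (noise_factor ell theta noise (Y m w))%:E else 0.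
pose psi j (w w' : T) : \bar R := if j != m then (theta * (l j w / l m w) * Hp j w')%:E else 0.
pose psib j w : \bar R := if j != m then (ln (1 + theta * (l j w / l m w)))%:E else 0.
have ratio_ge0 j w : (0 <= theta * (l j w / l m w))%R.
  by apply: mulr_ge0; [exact: ltW|exact: divr_ge0].
transitivity (\int[P]_w (g w * expeN (\sum_(j <oo) psi j w w))).
  apply: eq_integral => w _; rewrite /phi /g /sinr_event /=.
  case: (boolP (near w)) => nw /=; last first.
    by rewrite mul0e integral0_eq// => w' _; rewrite (negbTE nw).
  rewrite /noise_factor -/(l m w); case: eqVneq => [l0|l0] /=.
    by rewrite mul0e integral0_eq// => w' _; rewrite nw l0 eqxx.
  transitivity (expeN ((theta / l m w)%:E * (interference w + noise%:E))).
    rewrite -(exponential_tail (measurable_funP (H m)) (@lawH m) (threshold_ge0 w)).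
    rewrite -[X in P X]setIT -integral_indic//; last first.
      rewrite -[X in measurable X]setTI; apply: measurable_lte => //.
      by apply/measurable_EFinP; exact: measurable_funP.
    apply: eq_integral => w' _; rewrite indicE.
    by have [tH|tH] := boolP (_ < _); [rewrite mem_set|rewrite memNset//; exact/negP].
  rewrite ge0_muleDr//.
  rewrite addeC expeND; last 2 first.
  - by rewrite lee_fin; apply: mulr_ge0 => //; apply: divr_ge0 => //; exact: ltW.
  - by apply: mule_ge0 => //; rewrite lee_fin; apply: divr_ge0 => //; exact: ltW.
  congr (_ * expeN _); first by rewrite /expeN /= mulrAC.
  rewrite -nneseriesZl; last first.
    by move=> j _; case: ifP => // _; rewrite lee_fin; exact: mulr_ge0.
  apply: eq_eseriesr => j _; rewrite /psi; case: ifP => _; last by rewrite mule0.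
  by rewrite -EFinM; congr EFin; ring.
rewrite (@integral_discount _ _ _ P G sG mG indG psi psib).
- by apply: eq_integral => w _; rewrite /g /near; case: (is_nearest _ m); rewrite ?mul0e.
- move=> j; rewrite /psi; case: (j != m); last exact: measurable_cst.
  apply/measurable_EFinP; apply: measurable_funM.
    apply: measurable_funM => //; apply: measurable_funM.
      exact: ml (measurableT_comp (@mYG j) measurable_fst).
    apply: (measurableT_comp (@measurable_invr R)).
    exact: ml (measurableT_comp (@mYG m) measurable_fst).
  apply: measurable_maxr => //; exact: (measurableT_comp (@mHG j) measurable_snd).
- move=> j; rewrite /psib; case: (j != m); last exact: measurable_cst.
  apply/measurable_EFinP; apply: (measurableT_comp (@measurable_ln R)).
  apply: measurable_funD => //; apply: measurable_funM => //; apply: measurable_funM.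
    exact: ml (@mYG j).
  by apply: (measurableT_comp (@measurable_invr R)); exact: ml (@mYG m).
- move=> j w w'; rewrite /psi; case: ifP => // _; rewrite lee_fin; exact: mulr_ge0.
- by move=> j w; rewrite /psib; case: ifP => // _; rewrite lee_fin ln_ge0// lerDl.
- move=> j w; rewrite /psi /psib; case: ifP => _.
    exact: (exponential_laplace (measurable_funP (H j)) (@lawH j) (ratio_ge0 j w)).
  rewrite expeN0 integral_cst// mul1e; exact: probability_setT.
- apply: measurable_fun_ifT => //.
    exact: (@measurable_is_nearest R n _ (g_sigma_algebraType (G None)) (fun j => Y j : T -> E) m
      (fun j => @mYG j)).
  apply/measurable_EFinP.
  apply: (measurableT_comp (f := noise_factor ell theta noise)); last exact: (@mYG m).
  exact: measurable_noise_factor.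
- move=> w; rewrite /g; case: ifP => _; last by rewrite lexx lee01.
  by rewrite !lee_fin noise_factor_ge0 noise_factor_le1.
Qed.

End fading_coverage.

Lemma nneseries_rem (R : realType) (i : nat) (f : nat -> \bar R) : (forall j, 0 <= f j)%E ->
  (\sum_(j <oo) f j = f i + \sum_(j <oo) if j != i then f j else 0)%E.
Proof.
by move=> f0; rewrite (@nneseriesD1 _ f i xpredT)//; congr (_ + _)%E; rewrite [LHS]eseries_mkcond.
Qed.

Section nearest_functional.
Context (R : realType) (n : nat).
Local Notation E := 'rV[R]_n.
Local Open Scope ereal_scope.
Variables (r : E -> R) (k : E * E -> R) (g : E -> R).
Hypotheses (mr : measurable_fun setT r) (mk : measurable_fun setT k) (mg : measurable_fun setT g).
Hypotheses (k_ge0 : forall z, (0 <= k z)%R) (g_ge0 : forall y, (0 <= g y)%R).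

Definition nearest_penalty (y z : E) : \bar R := if (r y < r z)%R then (k (y, z))%:E else +oo.

Definition nearest_sum (c : nat -> bool) (x : nat -> E) : \bar R :=
  \sum_(i <oo) if c i then (g (x i))%:E *
    expeN (\sum_(j <oo) if (j != i) && c j then nearest_penalty (x i) (x j) else 0) else 0.

Let point_process (c : nat -> bool) (x : nat -> E) : {measure set E -> \bar R} :=
  mseries (fun i => atom (c i) (x i)) 0.

Let outer (y z : E) : R := if (r y < r z)%R then k (y, z) else 0%R.

Let summand (eta : {measure set E -> \bar R}) (y : E) : \bar R :=
  if eta [set z | (r z <= r y)%R] <= 1 then
    (g y)%:E * expeN (\int[eta]_z (outer y z)%:E) else 0.

Let penalty_ge0 y z : 0 <= nearest_penalty y z.
Proof. by rewrite /nearest_penalty; case: ifP => // _; rewrite lee_fin. Qed.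

Let outer_ge0 y z : (0 <= outer y z)%R.
Proof. by rewrite /outer; case: ifP. Qed.

Let measurable_outer d (T : measurableType d) (y z : T -> E) :
  measurable_fun setT y -> measurable_fun setT z ->
  measurable_fun setT (fun w => outer (y w) (z w)).
Proof.
move=> my mz; apply: measurable_fun_ifT => //; last exact: (measurable_comp2 mk).
by apply: measurable_fun_ltr; exact: (measurableT_comp mr).
Qed.

Let point_processE c x B : point_process c x B = \sum_(i <oo) if c i then \d_(x i) B else 0.
Proof. by apply: eq_eseriesr => i _; rewrite /atom; case: ifP. Qed.

Let countE c x y : point_process c x [set z | (r z <= r y)%R] =
  \sum_(i <oo) if c i then ((r (x i) <= r y)%R : bool)%:R%:E else 0.
Proof.
rewrite point_processE; apply: eq_eseriesr => i _; case: ifP => // _.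
rewrite /dirac indicE; suff -> : (x i \in [set z | (r z <= r y)%R]) = (r (x i) <= r y)%R by [].
by apply/idP/idP; rewrite inE.
Qed.

Let outerE c x y : \int[point_process c x]_z (outer y z)%:E =
  \sum_(j <oo) if c j then (outer y (x j))%:E else 0.
Proof.
rewrite integral_series_atom//; last by move=> z; rewrite lee_fin.
by apply/measurable_EFinP; apply: measurable_outer.
Qed.

Let measurable_summand c x : measurable_fun setT (summand (point_process c x)).
Proof.
apply: measurable_fun_ifT.
- apply: measurable_bool_set; rewrite -[X in measurable X]setTI; apply: measurable_lee => //.
  rewrite (_ : (fun y => _) = fun y => \sum_(i <oo) if c i then ((r (x i) <= r y)%R : bool)%:R%:E else 0).
    apply: ge0_emeasurable_sum; first by move=> i y _ _; case: ifP => // _; rewrite lee_fin.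
    move=> i _; case: (c i) => //; apply/measurable_EFinP.
    apply: (measurableT_comp (f := fun b : bool => b%:R : R)) => //.
    by apply: measurable_fun_ler => //; exact: measurable_cst.
  by apply/funext => y; exact: countE.
- apply: emeasurable_funM; first exact/measurable_EFinP.
  apply: (measurableT_comp (@measurable_expeN R)).
  rewrite (_ : (fun y => _) = fun y => \sum_(j <oo) if c j then (outer y (x j))%:E else 0).
    apply: ge0_emeasurable_sum; first by move=> i y _ _; case: ifP => // _; rewrite lee_fin.
    move=> i _; case: (c i) => //; apply/measurable_EFinP.
    by apply: measurable_outer => //; exact: measurable_cst.
  by apply/funext => y; exact: outerE.
- exact: measurable_cst.
Qed.

Let nearest_sumE c x : nearest_sum c x = \int[point_process c x]_y summand (point_process c x) y.
Proof.
rewrite integral_series_atom; last 2 first.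
- exact: measurable_summand.
- move=> y; rewrite /summand; case: ifP => // _.
  by apply: mule_ge0; [rewrite lee_fin|exact: expeN_ge0].
apply: eq_eseriesr => i _; case: ifP => // ci; rewrite /summand countE outerE.
rewrite [X in X <= 1](nneseries_rem i); last by move=> j; case: ifP => // _; rewrite lee_fin.
rewrite ci lexx.
have term0 j : 0 <= if j != i then (if c j then ((r (x j) <= r (x i))%R : bool)%:R%:E else 0) else 0 :> \bar R.
  by case: ifP => // _; case: ifP => // _; rewrite lee_fin.
have [near|] := pselect (forall j, j != i -> c j -> (r (x i) < r (x j))%R).
  rewrite ifT; last first.
    rewrite eseries0 ?adde0// => j _ _; case: ifP => // ji; case: ifP => // cj.
    by rewrite leNgt near.
  rewrite [in RHS](nneseries_rem i); last by move=> j; case: ifP => // _; rewrite lee_fin.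
  rewrite ci /outer ltxx add0e; congr (_ * expeN _); apply: eq_eseriesr => j _.
  have [->|ji] //= := eqVneq j i; case: ifP => // cj.
  by rewrite /nearest_penalty near.
move=> /existsNP[j /not_implyP[ji /not_implyP[cj /negP]]]; rewrite -leNgt => xji.
rewrite ifF; last first.
  apply/negbTE; rewrite -ltNge (nneseries_rem j)// ji cj xji /=.
  apply: (@lt_le_trans _ _ (1 + 1)); first by rewrite -EFinD lte_fin ltrDl.
  apply: leeD => //; apply: leeDl; apply: nneseries_ge0 => m _ _.
  by case: ifP.
rewrite (nneseries_rem j); last by move=> m; case: ifP.
rewrite ji cj /= {1}/nearest_penalty ltNge xji /= addye.
  by rewrite expeNy mule0.
rewrite gt_eqF//; apply: (@lt_le_trans _ _ 0) => //.
by apply: nneseries_ge0 => m _ _; case: ifP => // _; case: ifP.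
Qed.

Lemma nearest_sum_congr c x c' x' :
  (forall B, measurable B -> \sum_(i <oo) (if c i then \d_(x i) B else 0) =
     \sum_(i <oo) (if c' i then \d_(x' i) B else 0) :> \bar R) ->
  nearest_sum c x = nearest_sum c' x'.
Proof.
move=> cx; have E B : measurable B -> point_process c x B = point_process c' x' B.
  by move=> mB; rewrite !point_processE cx.
rewrite !nearest_sumE (eq_measure_integral (point_process c' x')); last first.
  by move=> B mB _; exact: E.
apply: eq_integral => y _; rewrite /summand E; last first.
  by rewrite -[X in measurable X]setTI; apply: measurable_fun_ler => //; exact: measurable_cst.
case: ifP => // _; congr (_ * expeN _); apply: eq_measure_integral => B mB _; exact: E.
Qed.

End nearest_functional.

Lemma integral_bool d (T : measurableType d) (R : realType) (P : probability T R)
    (b : T -> bool) (p : R) (a c : \bar R) : measurable_fun setT b ->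
  P [set w | b w] = p%:E -> (0 <= a)%E -> (0 <= c)%E ->
  (\int[P]_w (if b w then a else c) = p%:E * a + (1 - p)%:E * c)%E.
Proof.
move=> mb Pb a0 c0.
have mB : measurable [set w | b w].
  rewrite (_ : [set w | b w] = b @^-1` [set true]); last by apply/seteqP; split.
  by rewrite -[X in measurable X]setTI; exact: mb.
have PC : P (~` [set w | b w]) = (1 - p)%:E.
  by apply: (etrans (probability_setC P mB)); rewrite Pb.
rewrite (eq_integral (fun w => (\1_[set w | b w] w)%:E * a + (\1_(~` [set w | b w]) w)%:E * c)%E); last first.
  move=> w _; rewrite !indicE; case: (boolP (b w)) => bw.
    by rewrite mem_set// memNset ?mul1e ?mul0e ?adde0//= => /(_ bw).
  by rewrite memNset ?mem_set ?mul1e ?mul0e ?add0e//=; exact/negP.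
have ge0_int (A : set T) (x : \bar R) : measurable A -> (0 <= x)%E ->
    (\int[P]_w ((\1_A w)%:E * x) = P A * x)%E.
  move=> mA x0; rewrite ge0_integralZr//.
  - by rewrite integral_indic// setIT.
  - by apply/measurable_EFinP; exact: measurable_indic.
rewrite ge0_integralD//.
- rewrite !ge0_int//; last exact: measurableC.
  by congr (_ * _ + _ * _)%E.
- by move=> w _; apply: mule_ge0 => //; rewrite lee_fin.
- apply: emeasurable_funM; last exact: measurable_cst.
  by apply/measurable_EFinP; exact: measurable_indic.
- by move=> w _; apply: mule_ge0 => //; rewrite lee_fin.
- apply: emeasurable_funM; last exact: measurable_cst.
  by apply/measurable_EFinP; apply: measurable_indic; exact: measurableC.
Qed.

Section thinned_nearest.
Context (R : realType) (n : nat).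
Local Notation E := 'rV[R]_n.
Local Open Scope ereal_scope.
Variables (r : E -> R) (k : E * E -> R) (g : E -> R).
Hypotheses (mr : measurable_fun setT r) (mk : measurable_fun setT k) (mg : measurable_fun setT g).
Hypotheses (k_ge0 : forall z, (0 <= k z)%R) (g_ge0 : forall y, (0 <= g y)%R).
Hypothesis g_le1 : forall y, (g y <= 1)%R.
Variable p : R.
Hypotheses (p_gt0 : (0 < p)%R) (p_lt1 : (p < 1)%R).

Local Notation penalty := (nearest_penalty r k).

Lemma nearest_penalty_ge0 y z : 0 <= penalty y z.
Proof. by rewrite /nearest_penalty; case: ifP => // _; rewrite lee_fin. Qed.

Lemma measurable_nearest_penalty d (T : measurableType d) (y z : T -> E) :
  measurable_fun setT y -> measurable_fun setT z ->
  measurable_fun setT (fun w => penalty (y w) (z w)).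
Proof.
move=> my mz; apply: measurable_fun_ifT => //.
  by apply: measurable_fun_ltr; exact: (measurableT_comp mr).
by apply/measurable_EFinP; exact: (measurable_comp2 mk).
Qed.

Lemma measurable_nearest_term d (T : measurableType d) (c : nat -> T -> bool) (x : nat -> T -> E) i :
  (forall j, measurable_fun setT (c j)) -> (forall j, measurable_fun setT (x j)) ->
  measurable_fun setT (fun w => if c i w then (g (x i w))%:E *
    expeN (\sum_(j <oo) if (j != i) && c j w then penalty (x i w) (x j w) else 0) else 0).
Proof.
move=> mc mx; apply: measurable_fun_ifT => //.
apply: emeasurable_funM; first by apply/measurable_EFinP; exact: (measurableT_comp mg).
apply: (measurableT_comp (@measurable_expeN R)).
apply: ge0_emeasurable_sum.
  by move=> j w _ _; case: ifP => // _; exact: nearest_penalty_ge0.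
move=> j _; case: (j != i) => //=; apply: measurable_fun_ifT => //.
exact: measurable_nearest_penalty.
Qed.

Lemma nearest_term_ge0 (c : nat -> bool) (x : nat -> E) i :
  0 <= if c i then (g (x i))%:E *
    expeN (\sum_(j <oo) if (j != i) && c j then penalty (x i) (x j) else 0) else 0.
Proof. by case: ifP => // _; apply: mule_ge0; [rewrite lee_fin|exact: expeN_ge0]. Qed.

Lemma integral_nearest_sum d (T : measurableType d) (m : {measure set T -> \bar R})
    (c : nat -> T -> bool) (x : nat -> T -> E) :
  (forall j, measurable_fun setT (c j)) -> (forall j, measurable_fun setT (x j)) ->
  \int[m]_w nearest_sum r k g (c ^~ w) (x ^~ w) =
  \sum_(i <oo) \int[m]_w (if c i w then (g (x i w))%:E *
    expeN (\sum_(j <oo) if (j != i) && c j w then penalty (x i w) (x j w) else 0) else 0).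
Proof.
move=> mc mx; rewrite integral_nneseries//.
- by move=> i; exact: measurable_nearest_term.
- by move=> i w _; exact: (nearest_term_ge0 (c ^~ w) (x ^~ w)).
Qed.

Lemma measurable_nearest_sum d (T : measurableType d)
    (c : nat -> T -> bool) (x : nat -> T -> E) :
  (forall j, measurable_fun setT (c j)) -> (forall j, measurable_fun setT (x j)) ->
  measurable_fun setT (fun w => nearest_sum r k g (c ^~ w) (x ^~ w)).
Proof.
move=> mc mx; apply: ge0_emeasurable_sum.
  by move=> i w _ _; exact: (nearest_term_ge0 (c ^~ w) (x ^~ w)).
by move=> i _; exact: measurable_nearest_term.
Qed.

Definition retention (yz : E * E) : R :=
  (1 - p + p * (if (r yz.1 < r yz.2)%R then expR (- k yz) else 0))%R.

Definition thinning_cost (yz : E * E) : R := (- ln (retention yz))%R.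

Lemma retention_gt0 yz : (0 < retention yz)%R.
Proof.
apply: ltr_pwDl; first by rewrite subr_gt0.
by apply: mulr_ge0; [exact: ltW|case: ifP => // _; exact: expR_ge0].
Qed.

Lemma retention_le1 yz : (retention yz <= 1)%R.
Proof.
rewrite /retention -addrA gerDl addrC subr_le0 -[leRHS]mulr1 ler_pM2l//.
by case: ifP => // _; rewrite expR_le1 lerNl oppr0.
Qed.

Lemma thinning_cost_ge0 yz : (0 <= thinning_cost yz)%R.
Proof. by rewrite lerNr oppr0 ln_le0// retention_le1. Qed.

Lemma measurable_thinning_cost : measurable_fun setT thinning_cost.
Proof.
apply: measurable_funN; apply: (measurableT_comp (@measurable_ln R)).
apply: measurable_funD => //; apply: measurable_funM => //.
apply: measurable_fun_ifT => //.
  by apply: measurable_fun_ltr; exact: (measurableT_comp mr).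
by apply: (measurableT_comp (@measurable_expR R)); exact: measurable_funN.
Qed.

Lemma expeN_thinning_cost yz : expeN (thinning_cost yz)%:E =
  p%:E * expeN (penalty yz.1 yz.2) + (1 - p)%:E.
Proof.
rewrite /thinning_cost /expeN /= opprK lnK; last by rewrite posrE retention_gt0.
rewrite /retention EFinD addeC EFinM; congr (_ * _ + _); rewrite /nearest_penalty.
by case: yz => y z /=; case: ifP => //= _; rewrite -/(expeN +oo) expeNy.
Qed.

Context d (T : measurableType d) (P : probability T R).
Variables (Z : nat -> {RV P >-> E}) (tx : nat -> {RV P >-> bool}).
Hypothesis tx_p : forall i, P [set w | tx i w] = p%:E.
Hypothesis indep_tx : mutually_independent P (fun o : option nat =>
  if o is Some i then g_sigma_algebra_preimage (tx i : T -> bool)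
  else g_sigma_family setT (fun i => Z i : T -> E)).

Let G (o : option nat) : set (set T) :=
  if o is Some i then g_sigma_algebra_preimage (tx i : T -> bool)
  else g_sigma_family setT (fun i => Z i : T -> E).

Let sG o : sigma_algebra setT (G o).
Proof.
case: o => [j|]; last exact: smallest_sigma_algebra.
by apply: sigma_algebra_preimage; exact: sigma_algebra_measurable.
Qed.

Let mG o : G o `<=` measurable.
Proof.
case: o => [j|].
  by move=> A [C mC <-]; exact: measurable_funPT.
apply: smallest_sub; first exact: sigma_algebra_measurable.
by move=> A [j _] [C mC <-]; exact: measurable_funPT.
Qed.

Let mZG j : measurable_fun [set: g_sigma_algebraType (G None)] (Z j : T -> E).
Proof.
move=> _ C mC; apply: sub_sigma_algebra; apply: sub_sigma_algebra.
by exists j => //; exists C.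
Qed.

Let mtxG j : measurable_fun [set: g_sigma_algebraType (G (Some j))] (tx j : T -> bool).
Proof. by move=> _ C mC; apply: sub_sigma_algebra; exists C. Qed.

Lemma integral_thinned_term i :
  \int[P]_w (if tx i w then (g (Z i w))%:E *
    expeN (\sum_(j <oo) if (j != i) && tx j w then penalty (Z i w) (Z j w) else 0) else 0) =
  (p / (1 - p))%:E * \int[P]_w ((g (Z i w))%:E *
    expeN (\sum_(j <oo) (thinning_cost (Z i w, Z j w))%:E)).
Proof.
have q_gt0 : (0 < 1 - p)%R by rewrite subr_gt0.
pose psi j (w w' : T) : \bar R := if j == i then (if tx i w' then 0 else +oo)
  else if tx j w' then penalty (Z i w) (Z j w) else 0.
pose psib j (w : T) : \bar R := if j == i then (- ln p)%:E else (thinning_cost (Z i w, Z j w))%:E.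
have lnp0 : (0 <= - ln p)%R by rewrite lerNr oppr0 ln_le0// ltW.
have psi0 j w w' : 0 <= psi j w w'.
  rewrite /psi; case: ifP => _; first by case: ifP.
  by case: ifP => // _; exact: nearest_penalty_ge0.
have psib0 j w : 0 <= psib j w.
  by rewrite /psib; case: ifP => _; rewrite lee_fin// thinning_cost_ge0.
transitivity (\int[P]_w ((g (Z i w))%:E * expeN (\sum_(j <oo) psi j w w))).
  apply: eq_integral => w _; rewrite [in RHS](nneseries_rem i); last by move=> j; exact: psi0.
  rewrite {1}/psi eqxx; case: ifP => txi; last first.
    rewrite addye; first by rewrite expeNy mule0.
    rewrite gt_eqF//; apply: (@lt_le_trans _ _ 0) => //.
    by apply: nneseries_ge0 => j _ _; case: ifP.
  rewrite add0e; congr (_ * expeN _); apply: eq_eseriesr => j _.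
  by rewrite /psi; case: eqVneq.
rewrite (@integral_discount _ _ _ P G sG mG indep_tx psi psib); first last.
- by move=> w; rewrite !lee_fin g_ge0 g_le1.
- apply/measurable_EFinP; apply: (measurableT_comp (f := g)) => //; exact: (@mZG i).
- move=> j w; rewrite /psi /psib; case: (j == i).
    rewrite (_ : (fun _ => _) = fun w' => if tx i w' then 1 else 0); last first.
      by apply/funext => w'; case: (tx i w'); rewrite ?expeN0 ?expeNy.
    rewrite (integral_bool (measurable_funP (tx i)) (tx_p i))// mule1 mule0 adde0.
    by rewrite /expeN /= opprK lnK.
  rewrite (_ : (fun _ => _) = fun w' => if tx j w' then expeN (penalty (Z i w) (Z j w)) else 1); last first.
    by apply/funext => w'; case: (tx j w'); rewrite ?expeN0.
  rewrite (integral_bool (measurable_funP (tx j)) (tx_p j))//; last exact: expeN_ge0.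
  by rewrite mule1 expeN_thinning_cost.
- exact: psib0.
- exact: psi0.
- move=> j; rewrite /psib; case: (j == i); first exact: measurable_cst.
  apply/measurable_EFinP.
  exact: (measurable_comp2 measurable_thinning_cost (@mZG i) (@mZG j)).
- move=> j; rewrite /psi; case: eqVneq => [->|ji].
    apply: measurable_fun_ifT => //; exact: (measurableT_comp (@mtxG i) measurable_snd).
  apply: measurable_fun_ifT => //; first exact: (measurableT_comp (@mtxG j) measurable_snd).
  apply: measurable_nearest_penalty; first exact: (measurableT_comp (@mZG i) measurable_fst).
  exact: (measurableT_comp (@mZG j) measurable_fst).
rewrite -ge0_integralZl//.
- apply: eq_integral => w _; rewrite muleCA; congr (_ * _).
  rewrite [in LHS](nneseries_rem i); last by move=> j; exact: psib0.
  rewrite [in RHS](nneseries_rem i); last by move=> j; rewrite lee_fin thinning_cost_ge0.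
  rewrite {1}/psib eqxx.
  rewrite (_ : \sum_(j <oo) (if j != i then psib j w else 0) =
      \sum_(j <oo) (if j != i then (thinning_cost (Z i w, Z j w))%:E else 0)); last first.
    by apply: eq_eseriesr => j _; rewrite /psib; case: eqVneq.
  have rest0 : 0 <= \sum_(j <oo) (if j != i then (thinning_cost (Z i w, Z j w))%:E else 0).
    by apply: nneseries_ge0 => j _ _; case: ifP => // _; rewrite lee_fin thinning_cost_ge0.
  rewrite !expeND//; last first.
  + by rewrite lee_fin thinning_cost_ge0.
  rewrite muleA; congr (_ * _).
  rewrite /thinning_cost /retention /= ltxx mulr0 addr0 /expeN /= !opprK !lnK//.
  by rewrite -EFinM divfK// gt_eqF.
- apply: emeasurable_funM; first by apply/measurable_EFinP; exact: (measurableT_comp mg).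
  apply: (measurableT_comp (@measurable_expeN R)).
  apply: ge0_emeasurable_sum; first by move=> j w _ _; rewrite lee_fin thinning_cost_ge0.
  move=> j _; apply/measurable_EFinP.
  exact: (measurable_comp2 measurable_thinning_cost).
- by move=> w _; apply: mule_ge0; [rewrite lee_fin|exact: expeN_ge0].
- by rewrite lee_fin divr_ge0// ltW.
Qed.

End thinned_nearest.

Section interference_cost.
Context (R : realType) (n : nat).
Local Notation E := 'rV[R]_n.
Variables (ell : R -> R) (theta : R).
Hypotheses (mell : measurable_fun setT ell) (ell_ge0 : forall r, 0 <= ell r).
Hypothesis theta_gt0 : 0 < theta.

Definition interference_cost (yz : E * E) : R :=
  ln (1 + theta * (ell (enorm yz.2) / ell (enorm yz.1))).

Lemma interference_ratio_ge0 (y z : E) : 0 <= theta * (ell (enorm z) / ell (enorm y)).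
Proof. by apply: mulr_ge0; [exact: ltW|exact: divr_ge0]. Qed.

Lemma interference_cost_ge0 yz : 0 <= interference_cost yz.
Proof. by rewrite ln_ge0// lerDl interference_ratio_ge0. Qed.

Lemma measurable_interference_cost : measurable_fun setT interference_cost.
Proof.
have ml : measurable_fun setT (fun y : E => ell (enorm y)).
  exact: (measurableT_comp mell (@measurable_enorm R n)).
apply: (measurableT_comp (@measurable_ln R)); apply: measurable_funD => //.
apply: measurable_funM => //; apply: measurable_funM.
  exact: (measurableT_comp ml measurable_snd).
apply: (measurableT_comp (@measurable_invr R)).
exact: (measurableT_comp ml measurable_fst).
Qed.

Lemma expR_interference_cost y z :
  expR (- interference_cost (y, z)) = (1 + theta * (ell (enorm z) / ell (enorm y)))^-1.
Proof.
by rewrite expRN lnK// posrE ltr_pwDl// interference_ratio_ge0.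
Qed.

End interference_cost.

Section coverage_palm_integral.
Context (R : realType) (n : nat).
Local Notation E := 'rV[R]_n.
Local Open Scope ereal_scope.
Context (d : measure_display) (T : measurableType d) (P : probability T R).
Variables (X : nat -> {RV P >-> E}) (kappa : nat -> {RV P >-> nat}).
Variables (Y : nat -> nat -> {RV P >-> E}).
Variables (lambda mu : R) (Q : probability E R).
Variables (L : {sigma_finite_measure set E -> \bar R}).
Hypothesis LE : @lebesgue_rV R n = L.
Hypotheses (lambda_gt0 : (0 < lambda)%R) (mu_gt0 : (0 < mu)%R).
Hypothesis ppcp : PPCP X kappa Y lambda mu Q.
Context (d0 : measure_display) (T0 : measurableType d0) (P0 : probability T0 R).
Variables (Z : nat -> {RV P0 >-> E}).
Hypothesis palmZ : reduced_palm P (lambda * mu) (cluster_process X kappa Y)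
  P0 (fun w => point_measure (fun i => Z i w)).
Variable p : R.
Hypotheses (p_gt0 : (0 < p)%R) (p_lt1 : (p < 1)%R).
Variables (tx : nat -> {RV P0 >-> bool}) (Y' : nat -> {RV P0 >-> E}).
Hypothesis thinZ : thinning p Z tx (fun w => point_measure (fun m => Y' m w)).
Variable H : nat -> {RV P0 >-> R}.
Hypothesis fadHY : fading H Y'.

Lemma palm_first_order (g : E -> R) (h : E * E -> R) :
  measurable_fun setT g -> measurable_fun setT h ->
  (forall y, (0 <= g y)%R) -> (forall z, (0 <= h z)%R) ->
  \int[P0]_w (\sum_(i <oo) (g (Z i w))%:E * expeN (\sum_(j <oo) (h (Z i w, Z j w))%:E)) =
  palm_integral lambda mu Q L true g h.
Proof.
move=> mg mh g0 h0.
have L_shift (c : E) (A : set E) : measurable A -> L ((fun x => x + c)%R @^-1` A) = L A.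
  by move=> mA; rewrite -LE; exact: lebesgue_rV_shift.
have L_cube (c : nat) : L (@cube_rV R n c%:R) < +oo.
  by rewrite -LE; exact: lebesgue_cube_rV_lty.
exact: (@first_order_points R n lambda mu Q L (ltW lambda_gt0) (ltW mu_gt0) L_shift L_cube
  _ T0 P0 (fun _ => cst true) (fun i => Z i : T0 -> E) (fun _ => measurable_cst true)
  (fun i => measurable_funP (Z i)) true
  (laplace_reduced_palm LE lambda_gt0 mu_gt0 ppcp palmZ) g h mg mh g0 h0).
Qed.

Variables (ell : R -> R) (noise theta : R).
Hypotheses (mell : measurable_fun setT ell) (ell_ge0 : forall r, (0 <= ell r)%R).
Hypotheses (noise_ge0 : (0 <= noise)%R) (theta_gt0 : (0 < theta)%R).

Local Notation g := (@noise_factor R n ell theta noise).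
Local Notation k := (@interference_cost R n ell theta).
Local Notation h := (thinning_cost (@enorm R n) k p).

Let mg : measurable_fun setT g.
Proof. exact: measurable_noise_factor. Qed.

Let mk : measurable_fun setT k.
Proof. exact: measurable_interference_cost. Qed.

Let g_ge0 y : (0 <= g y)%R. Proof. exact: noise_factor_ge0. Qed.

Let k_ge0 z : (0 <= k z)%R. Proof. exact: interference_cost_ge0. Qed.

Let menorm := @measurable_enorm R n.

Lemma coverage_probability_nearest_sum :
  coverage_probability p ell noise theta H Y' =
  (1 - p)%:E * \int[P0]_w nearest_sum (@enorm R n) k g (fun _ => true) (fun m => Y' m w).
Proof.
rewrite /coverage_probability; congr (_ * _).
rewrite (@integral_nearest_sum _ _ (@enorm R n) k g menorm mk mg k_ge0 g_ge0 _ T0 P0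
  (fun _ => cst true) (fun m => Y' m : T0 -> E) (fun _ => measurable_cst true)
  (fun m => measurable_funP (Y' m))).
apply: eq_eseriesr => m _; rewrite (fading_coverage fadHY mell ell_ge0 noise_ge0 theta_gt0).
apply: eq_integral => w _; rewrite /= /is_nearest.
case: asboolP => near.
  congr (_ * expeN _); apply: eq_eseriesr => j _; rewrite andbT.
  by case: ifP => // jm; rewrite /nearest_penalty near.
move: near => /existsNP[j /not_implyP[jm /negP]]; rewrite -leNgt => yjm.
rewrite (nneseries_rem j); last by move=> i; case: ifP => // _; exact: nearest_penalty_ge0.
rewrite jm /= {1}/nearest_penalty ltNge yjm /= addye.
  by rewrite expeNy mule0.
rewrite gt_eqF//; apply: (@lt_le_trans _ _ 0) => //.
apply: nneseries_ge0 => i _ _; case: ifP => // _; case: ifP => // _; exact: nearest_penalty_ge0.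
Qed.

Lemma coverage_palm_integral :
  coverage_probability p ell noise theta H Y' = p%:E * palm_integral lambda mu Q L true g h.
Proof.
have [tx_p indep_tx thinE] := thinZ.
rewrite coverage_probability_nearest_sum.
have -> : \int[P0]_w nearest_sum (@enorm R n) k g (fun _ => true) (fun m => Y' m w) =
    \int[P0]_w nearest_sum (@enorm R n) k g (fun i => tx i w) (fun i => Z i w).
  apply: ae_eq_integral => //.
  - exact: (@measurable_nearest_sum _ _ (@enorm R n) k g menorm mk mg k_ge0 g_ge0 _ T0
      (fun _ => cst true) (fun m => Y' m : T0 -> E) (fun _ => measurable_cst true)
      (fun m => measurable_funP (Y' m))).
  - exact: (@measurable_nearest_sum _ _ (@enorm R n) k g menorm mk mg k_ge0 g_ge0 _ T0
      (fun i => tx i : T0 -> bool) (fun i => Z i : T0 -> E) (fun i => measurable_funP (tx i))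
      (fun i => measurable_funP (Z i))).
  - apply: filterS thinE => w thinEw _.
    apply: nearest_sum_congr => // B mB; have := thinEw B mB.
    by rewrite [X in _ = X -> _]eseries_mkcond.
rewrite (@integral_nearest_sum _ _ (@enorm R n) k g menorm mk mg k_ge0 g_ge0 _ T0 P0
  (fun i => tx i : T0 -> bool) (fun i => Z i : T0 -> E) (fun i => measurable_funP (tx i))
  (fun i => measurable_funP (Z i))).
have h_ge0 z : (0 <= h z)%R by exact: thinning_cost_ge0.
have mh : measurable_fun setT h by exact: measurable_thinning_cost.
rewrite (eq_eseriesr (g := fun i => (p / (1 - p))%:E * \int[P0]_w ((g (Z i w))%:E *
    expeN (\sum_(j <oo) (h (Z i w, Z j w))%:E)))); last first.
  move=> i _; apply: (integral_thinned_term menorm mk mg k_ge0 g_ge0 _ p_gt0 p_lt1 tx_p indep_tx).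
  by move=> y; exact: noise_factor_le1.
rewrite nneseriesZl; last first.
  move=> i _; apply: integral_ge0 => w _; apply: mule_ge0; [by rewrite lee_fin|exact: expeN_ge0].
rewrite muleA -EFinM mulrC divfK; last by rewrite gt_eqF// subr_gt0.
congr (_ * _); rewrite -(palm_first_order mg mh g_ge0 h_ge0) integral_nneseries//.
- move=> i; apply: emeasurable_funM; first by apply/measurable_EFinP; exact: (measurableT_comp mg).
  apply: (measurableT_comp (@measurable_expeN R)).
  apply: ge0_emeasurable_sum; first by move=> j w _ _; rewrite lee_fin.
  move=> j _; apply/measurable_EFinP; exact: (measurable_comp2 mh).
- by move=> i w _; apply: mule_ge0; [rewrite lee_fin|exact: expeN_ge0].
Qed.

End coverage_palm_integral.

Section coverage_formula.
Context (R : realType) (n : nat).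
Local Notation E := 'rV[R]_n.
Local Open Scope ereal_scope.
Variables (lambda mu : R) (Q : probability E R).
Variables (L : {sigma_finite_measure set E -> \bar R}).
Hypothesis LE : @lebesgue_rV R n = L.
Hypotheses (lambda_gt0 : (0 < lambda)%R) (mu_gt0 : (0 < mu)%R).
Variable p : R.
Hypotheses (p_gt0 : (0 < p)%R) (p_lt1 : (p < 1)%R).
Variables (ell : R -> R) (noise theta : R).
Hypotheses (mell : measurable_fun setT ell) (ell_ge0 : forall r, (0 <= ell r)%R).
Hypotheses (noise_ge0 : (0 <= noise)%R) (theta_gt0 : (0 < theta)%R).

Local Notation g := (@noise_factor R n ell theta noise).
Local Notation k := (@interference_cost R n ell theta).
Local Notation h := (thinning_cost (@enorm R n) k p).
Local Notation C := (@C_theta R n mu p Q ell theta).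
Local Notation Eth := (@E_theta R n lambda mu p Q ell theta).

Let menorm := @measurable_enorm R n.
Let lambda_ge0 := ltW lambda_gt0.
Let mu_ge0 := ltW mu_gt0.

Let mg : measurable_fun setT g.
Proof. exact: measurable_noise_factor. Qed.

Let mk : measurable_fun setT k.
Proof. exact: measurable_interference_cost. Qed.

Let g_ge0 y : (0 <= g y)%R. Proof. exact: noise_factor_ge0. Qed.

Let k_ge0 z : (0 <= k z)%R. Proof. exact: interference_cost_ge0. Qed.

Let h_ge0 z : (0 <= h z)%R. Proof. exact: thinning_cost_ge0. Qed.

Let mh : measurable_fun setT h. Proof. exact: measurable_thinning_cost. Qed.

Let visible (y z : E) : R := if (enorm y < enorm z)%R then expR (- k (y, z)) else 0%R.

Let visible_ge0 y z : (0 <= visible y z)%R.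
Proof. by rewrite /visible; case: ifP => // _; exact: expR_ge0. Qed.

Let visible_le1 y z : (visible y z <= 1)%R.
Proof. by rewrite /visible; case: ifP => // _; rewrite expR_le1 lerNl oppr0. Qed.

Let measurable_visible y : measurable_fun setT (visible y).
Proof.
apply: measurable_fun_ifT => //.
  by apply: measurable_fun_ltr => //; exact: measurable_cst.
apply: (measurableT_comp (@measurable_expR R)); apply: measurable_funN.
exact: (measurable_comp2 mk (measurable_cst y) (@measurable_id _ _ _)).
Qed.

Let integral_translate_in (x : E) (A : set E) (f : E -> \bar R) : measurable A ->
  measurable_fun setT f -> (forall y, 0 <= f y) ->
  \int[translate x Q]_(y in A) f y = \int[Q]_c (f \_ A) (c + x)%R.
Proof.
move=> mA mf f0.
have mx : measurable_fun setT (fun c : E => c + x)%R.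
  by apply: measurable_rV_add => //; exact: measurable_cst.
have := @ge0_integral_pushforward _ _ _ _ _ _ mx Q A f mA (measurable_funTS mf) (fun y _ => f0 y).
move=> ->; rewrite integral_mkcond; apply: eq_integral => c _.
by rewrite !patchE.
Qed.

Lemma integral_translate (x : E) (f : E -> \bar R) : measurable_fun setT f ->
  (forall y, 0 <= f y) -> \int[translate x Q]_y f y = \int[Q]_c f (c + x)%R.
Proof. by move=> mf f0; rewrite integral_translate_in// patch_setT. Qed.

Lemma expeN_cluster_exponent_C y x :
  expeN (cluster_exponent mu Q (slice h y) x) = (C y x)%:E.
Proof.
pose V := \int[Q]_c (visible y (x + c)%R)%:E.
have mvis : measurable_fun setT (fun c => visible y (x + c)%R).
  exact: measurable_shift_cst.
have V0 : 0 <= V by apply: integral_ge0 => c _; rewrite lee_fin.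
have V1 : V <= 1.
  apply: (@le_trans _ _ (\int[Q]_c cst 1 c)).
    apply: ge0_le_integral => //.
    - by move=> c _; rewrite lee_fin.
    - exact/measurable_EFinP.
    - by move=> c _; rewrite lee_fin.
  by rewrite integral_cst// mul1e; rewrite [X in X <= _](_ : _ = 1)//; exact: probability_setT.
have Vfin : V \is a fin_num by rewrite ge0_fin_numE// (le_lt_trans V1)// ltry.
have -> : C y x = expR (- (p * mu * (1 - fine V))).
  rewrite /C_theta; congr (expR (- (_ * (1 - fine _)))).
  rewrite integral_translate_in.
  - apply: eq_integral => c _; rewrite patchE /visible [(x + c)%R]addrC.
    have [yz|yz] := boolP (enorm y < enorm (c + x))%R; first by rewrite mem_set// expR_interference_cost.
    by rewrite memNset//; exact/negP.
  - by rewrite -[X in measurable X]setTI; apply: measurable_fun_ltr => //; exact: measurable_cst.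
  - rewrite (_ : (fun z => _) = fun z => (expR (- k (y, z)))%:E); last first.
      by apply/funext => z; rewrite expR_interference_cost.
    apply/measurable_EFinP; apply: (measurableT_comp (@measurable_expR R)).
    apply: measurable_funN.
    exact: (measurable_comp2 mk (measurable_cst y) (@measurable_id _ _ _)).
  - by move=> z; rewrite lee_fin invr_ge0 addr_ge0// interference_ratio_ge0.
have -> : cluster_exponent mu Q (slice h y) x = (p * mu * (1 - fine V))%:E.
  rewrite /cluster_exponent.
  have m1v : measurable_fun setT (fun c : E => (1 - visible y (x + c)%R)%:E).
    by apply/measurable_EFinP; apply: measurable_funB => //; exact: measurable_cst.
  have v01 c : 0 <= (1 - visible y (x + c)%R)%:E by rewrite lee_fin subr_ge0.
  rewrite (eq_integral (fun c : E => p%:E * (1 - visible y (x + c)%R)%:E)); last first.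
    move=> c _; rewrite -EFinM; congr EFin.
    rewrite /slice /thinning_cost opprK lnK; last by rewrite posrE retention_gt0.
    by rewrite /retention /= -/(visible y _); ring.
  rewrite ge0_integralZl//; last by rewrite lee_fin ltW.
  have sum1 : \int[Q]_c (1 - visible y (x + c)%R)%:E + V = 1.
    rewrite /V -ge0_integralD//.
    - rewrite (eq_integral (cst 1)); last by move=> c _; rewrite -EFinD subrK.
      by rewrite integral_cst// mul1e; exact: probability_setT.
    - by move=> c _; rewrite lee_fin.
    - exact/measurable_EFinP.
  have -> : \int[Q]_c (1 - visible y (x + c)%R)%:E = (1 - fine V)%:E.
    by rewrite EFinB fineK// -sum1 addeK.
  by rewrite -!EFinM mulrCA mulrA.
by [].
Qed.

Lemma process_exponent_E y : expeN (process_exponent lambda mu Q L (slice h y)) = Eth y.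
Proof.
rewrite /E_theta LE /process_exponent.
have -> : \int[L]_x (1 - expeN (cluster_exponent mu Q (slice h y) x)) =
    \int[L]_x (1 - C y x)%:E; last by [].
by apply: eq_integral => x _; rewrite expeN_cluster_exponent_C.
Qed.

Definition own_integrand (y t : E) : \bar R :=
  if ell (enorm y) == 0%R then 0 else
  (expR (- (theta * noise / ell (enorm y))) * C y t)%:E * Eth y.

Definition other_integrand (y t x : E) : \bar R :=
  if ell (enorm y) == 0%R then 0 else
  (expR (- (theta * noise / ell (enorm y))) * C y t * C y x)%:E * Eth y.

Let D y t := diagonal_discount lambda mu Q L true h y t.

Let alpha_ge0 y : 0 <= process_exponent lambda mu Q L (slice h y).
Proof. by apply: process_exponent_ge0 => // z; exact: h_ge0. Qed.

Let beta_ge0 y x : 0 <= cluster_exponent mu Q (slice h y) x.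
Proof. by apply: cluster_exponent_ge0 => // z; exact: h_ge0. Qed.

Let expeN_D y t : expeN (D y t) = (1 - p)%:E * ((C y t)%:E * Eth y).
Proof.
rewrite /D /diagonal_discount expeND; last 2 first.
- by rewrite lee_fin.
- by apply: adde_ge0.
have -> : expeN (h (y, y))%:E = (1 - p)%:E.
  rewrite expeN_thinning_cost// /nearest_penalty /= ltxx expeNy mule0 add0e//.
rewrite /palm_exponent expeND// process_exponent_E expeN_cluster_exponent_C.
by rewrite [Eth y * _]muleC.
Qed.

Let own_integrandE y t : (g y)%:E * expeN (D y t) = (1 - p)%:E * own_integrand y t.
Proof.
rewrite expeN_D /noise_factor /own_integrand; case: ifP => _; first by rewrite mul0e mule0.
by rewrite muleCA EFinM -muleA.
Qed.

Let other_integrandE y t x :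
  (g y)%:E * expeN (D y t + cluster_exponent mu Q (slice h y) x) =
  (1 - p)%:E * other_integrand y t x.
Proof.
rewrite expeND//; last by apply: adde_ge0; [rewrite lee_fin|apply: adde_ge0].
rewrite expeN_D expeN_cluster_exponent_C /noise_factor /other_integrand.
case: ifP => _; first by rewrite mul0e mule0.
rewrite !EFinM -!muleA [LHS]muleCA; congr (_ * (_ * (_ * _))).
by rewrite muleC.
Qed.


Let q_neq0 : (1 - p != 0)%R.
Proof. by rewrite gt_eqF// subr_gt0. Qed.

Let scaled (x y : \bar R) : x = (1 - p)%:E * y -> y = ((1 - p)^-1)%:E * x.
Proof. by move=> ->; rewrite muleA -EFinM mulVf// mul1e. Qed.

Let measurable_at_opp (J : E -> \bar R) : measurable_fun setT J ->
  measurable_fun setT (fun a : E => J (- a)%R).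
Proof. by move=> mJ; apply: (measurableT_comp mJ); exact: measurable_rV_opp. Qed.

Let qV_ge0 : 0 <= ((1 - p)^-1)%:E.
Proof. by rewrite lee_fin invr_ge0 subr_ge0 ltW. Qed.

Let integral_reflection_sum (f1 f2 : E -> \bar R) :
  measurable_fun setT f1 -> measurable_fun setT f2 ->
  (forall t, 0 <= f1 t) -> (forall t, 0 <= f2 t) ->
  p%:E * ((lambda * mu)%:E * \int[Q]_a f2 (- a)%R + mu%:E * \int[Q]_a f1 (- a)%R) =
  ((1 - p) * p * mu)%:E * \int[reflection Q]_t (((1 - p)^-1)%:E * (f1 t + lambda%:E * f2 t)).
Proof.
move=> m1 m2 f10 f20.
have mopp : measurable_fun setT (fun t : E => - t)%R by exact: measurable_rV_opp.
have mf : measurable_fun setT (fun t => ((1 - p)^-1)%:E * (f1 t + lambda%:E * f2 t)).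
  by apply: measurable_funeM; apply: emeasurable_funD => //; exact: measurable_funeM.
have lf2 t : 0 <= lambda%:E * f2 t by apply: mule_ge0; rewrite ?lee_fin.
have f0 t : 0 <= ((1 - p)^-1)%:E * (f1 t + lambda%:E * f2 t).
  by apply: mule_ge0 => //; exact: adde_ge0.
have -> := @ge0_integral_pushforward _ _ _ _ _ _ mopp Q setT _ measurableT mf (fun y _ => f0 y).
rewrite preimage_setT /= ge0_integralZl//; last 2 first.
- exact: (measurable_at_opp (J := fun t => f1 t + lambda%:E * f2 t)
    (emeasurable_funD m1 (measurable_funeM _ m2))).
- by move=> a _; exact: adde_ge0.
rewrite muleA -EFinM.
rewrite ge0_integralD//; last 2 first.
- exact: measurable_at_opp.
- by apply: measurable_funeM; exact: measurable_at_opp.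
rewrite ge0_integralZl//; last exact: measurable_at_opp.
have -> : ((1 - p) * p * mu / (1 - p) = p * mu)%R by field.
have i1 : 0 <= \int[Q]_a f1 (- a)%R by exact: integral_ge0.
have i2 : 0 <= \int[Q]_a f2 (- a)%R by exact: integral_ge0.
move: i1 i2; move: (\int[Q]_a f1 (- a)%R) (\int[Q]_a f2 (- a)%R) => x1 x2 i1 i2.
have lx2 : 0 <= (lambda * mu)%:E * x2 by apply: mule_ge0; rewrite ?lee_fin// mulr_ge0.
have mx1 : 0 <= mu%:E * x1 by apply: mule_ge0; rewrite ?lee_fin.
have lx2' : 0 <= lambda%:E * x2 by apply: mule_ge0; rewrite ?lee_fin.
rewrite [in RHS]addeC ge0_muleDr// ge0_muleDr//.
rewrite !muleA -!EFinM; congr (_%:E * _ + _).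
by rewrite -mulrA [(mu * lambda)%R]mulrC.
Qed.

Let J1 (t : E) : \bar R := \int[Q]_c ((g (c + t)%R)%:E * expeN (D (c + t)%R t)).

Let J2 (t : E) : \bar R := \int[L]_x \int[Q]_c ((g (c + x)%R)%:E *
  expeN (D (c + x)%R t + cluster_exponent mu Q (slice h (c + x)%R) x)).

Let measurable_own d (T : measurableType d) (y t : T -> E) :
  measurable_fun setT y -> measurable_fun setT t ->
  measurable_fun setT (fun w => (g (y w))%:E * expeN (D (y w) (t w))).
Proof.
move=> my mt; apply: emeasurable_funM.
  by apply/measurable_EFinP; exact: (measurableT_comp mg).
apply: (measurableT_comp (@measurable_expeN R)).
apply: (measurable_comp2 (f := fun yt => D yt.1 yt.2)) => //.
exact: measurable_diagonal_discount.
Qed.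

Let measurable_other d (T : measurableType d) (y t x : T -> E) :
  measurable_fun setT y -> measurable_fun setT t -> measurable_fun setT x ->
  measurable_fun setT (fun w => (g (y w))%:E *
    expeN (D (y w) (t w) + cluster_exponent mu Q (slice h (y w)) (x w))).
Proof.
move=> my mt mx; apply: emeasurable_funM.
  by apply/measurable_EFinP; exact: (measurableT_comp mg).
apply: (measurableT_comp (@measurable_expeN R)); apply: emeasurable_funD.
  apply: (measurable_comp2 (f := fun yt => D yt.1 yt.2)) => //.
  exact: measurable_diagonal_discount.
apply: (measurable_comp2 (f := fun yx => cluster_exponent mu Q (slice h yx.1) yx.2)) => //.
exact: measurable_slice_cluster_exponent.
Qed.

Let weight_ge0 y (e : \bar R) : 0 <= (g y)%:E * expeN e.
Proof. by apply: mule_ge0; [rewrite lee_fin|exact: expeN_ge0]. Qed.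

Lemma measurable_I1_integrand (t : E) : measurable_fun setT (fun y : E => own_integrand y t).
Proof.
rewrite (_ : (fun y : E => own_integrand y t) = fun y => ((1 - p)^-1)%:E * ((g y)%:E * expeN (D y t))); last first.
  by apply/funext => y; exact: (scaled (own_integrandE y t)).
apply: measurable_funeM; apply: (measurable_own (y := id)) => //; exact: measurable_cst.
Qed.

Lemma measurable_I2_integrand (t x : E) : measurable_fun setT (fun y : E => other_integrand y t x).
Proof.
rewrite (_ : (fun y => _) = fun y => ((1 - p)^-1)%:E * ((g y)%:E *
    expeN (D y t + cluster_exponent mu Q (slice h y) x))); last first.
  by apply/funext => y; exact: (scaled (other_integrandE y t x)).
apply: measurable_funeM.
exact: (measurable_other (y := id) (@measurable_id _ _ _) (measurable_cst t) (measurable_cst x)).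
Qed.

Let scale_integral d (T : measurableType d) (m : {measure set T -> \bar R}) (c : \bar R) (f : T -> \bar R) :
  0 <= c -> measurable_fun setT f -> (forall x, 0 <= f x) ->
  \int[m]_x (c * f x) = c * \int[m]_x f x.
Proof. by move=> c0 mf f0; rewrite ge0_integralZl. Qed.

Let measurable_shift (t : E) : measurable_fun setT (fun c : E => c + t)%R.
Proof. by apply: measurable_rV_add => //; exact: measurable_cst. Qed.

Let I1_J1 t : I1_theta lambda mu p Q ell noise theta t = ((1 - p)^-1)%:E * J1 t.
Proof.
rewrite /I1_theta (_ : (fun y => _) = fun y => ((1 - p)^-1)%:E * ((g y)%:E * expeN (D y t))); last first.
  by apply/funext => y; exact: (scaled (own_integrandE y t)).
have mo : measurable_fun setT (fun y => (g y)%:E * expeN (D y t)).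
  by apply: (measurable_own (y := id)) => //; exact: measurable_cst.
rewrite integral_translate; last 2 first.
- exact: measurable_funeM.
- by move=> y; exact: mule_ge0.
exact: (scale_integral Q qV_ge0 (measurable_own (measurable_shift t) (measurable_cst t))
  (fun c => weight_ge0 _ _)).
Qed.

Let measurable_other_shift (t : E) : measurable_fun setT (fun xc : E * E =>
  (g (xc.2 + xc.1)%R)%:E *
    expeN (D (xc.2 + xc.1)%R t + cluster_exponent mu Q (slice h (xc.2 + xc.1)%R) xc.1)).
Proof.
have ms : measurable_fun setT (fun xc : E * E => xc.2 + xc.1)%R by exact: measurable_rV_add.
exact: (measurable_other ms (measurable_cst t) measurable_fst).
Qed.

Let I2_J2 t : I2_theta lambda mu p Q ell noise theta t = (lambda * (1 - p)^-1)%:E * J2 t.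
Proof.
rewrite /I2_theta LE EFinM -muleA.
suff -> : \int[L]_x \int[translate x Q]_y other_integrand y t x = ((1 - p)^-1)%:E * J2 t by [].
pose inner x := \int[Q]_c ((g (c + x)%R)%:E *
  expeN (D (c + x)%R t + cluster_exponent mu Q (slice h (c + x)%R) x)).
have minner : measurable_fun setT inner.
  exact: (@measurable_fun_fubini_tonelli_F _ _ _ _ _ Q _ (measurable_other_shift t)
    (fun xc => weight_ge0 _ _)).
have inner0 x : 0 <= inner x by apply: integral_ge0 => c _; exact: weight_ge0.
rewrite (eq_integral (fun x => ((1 - p)^-1)%:E * inner x)).
  exact: (scale_integral L qV_ge0 minner inner0).
move=> x _.
rewrite (_ : (fun y => _) = fun y => ((1 - p)^-1)%:E * ((g y)%:E *
    expeN (D y t + cluster_exponent mu Q (slice h y) x))); last first.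
  by apply/funext => y; exact: (scaled (other_integrandE y t x)).
have mo : measurable_fun setT (fun y => (g y)%:E * expeN (D y t + cluster_exponent mu Q (slice h y) x)).
  exact: (measurable_other (y := id) (@measurable_id _ _ _) (measurable_cst t) (measurable_cst x)).
rewrite integral_translate; last 2 first.
- exact: measurable_funeM.
- by move=> y; exact: mule_ge0.
exact: (scale_integral Q qV_ge0
  (measurable_other (measurable_shift x) (measurable_cst t) (measurable_cst x))
  (fun c => weight_ge0 _ _)).
Qed.


Let measurable_J1 : measurable_fun setT J1.
Proof.
have ms : measurable_fun setT (fun tc : E * E => tc.2 + tc.1)%R by exact: measurable_rV_add.
exact: (@measurable_fun_fubini_tonelli_F _ _ _ _ _ Q _ (measurable_own ms measurable_fst)
  (fun tc => weight_ge0 _ _)).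
Qed.

Let inner2 (tx : E * E) : \bar R := \int[Q]_c ((g (c + tx.2)%R)%:E *
  expeN (D (c + tx.2)%R tx.1 + cluster_exponent mu Q (slice h (c + tx.2)%R) tx.2)).

Let inner2_ge0 tx : 0 <= inner2 tx.
Proof. by apply: integral_ge0 => c _; exact: weight_ge0. Qed.

Let measurable_inner2 : measurable_fun setT inner2.
Proof.
have m1 : measurable_fun setT (fun z : (E * E) * E => z.2 + z.1.2)%R.
  by apply: measurable_rV_add => //; exact: (measurableT_comp measurable_snd measurable_fst).
exact: (@measurable_fun_fubini_tonelli_F _ _ _ _ _ Q _
  (measurable_other m1 (measurableT_comp measurable_fst measurable_fst)
    (measurableT_comp measurable_snd measurable_fst))
  (fun z => weight_ge0 _ _)).
Qed.

Let measurable_J2 : measurable_fun setT J2.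
Proof. exact: (@measurable_fun_fubini_tonelli_F _ _ _ _ _ L _ measurable_inner2 inner2_ge0). Qed.

Let J1_ge0 t : 0 <= J1 t.
Proof. by apply: integral_ge0 => c _; exact: weight_ge0. Qed.

Let J2_ge0 t : 0 <= J2 t.
Proof. by apply: integral_ge0 => x _; exact: (inner2_ge0 (t, x)). Qed.

Let own_J1 : own_cluster_integral lambda mu Q L true g h = \int[Q]_a J1 (- a)%R.
Proof. by rewrite own_cluster_integralE. Qed.

Let other_J2 : other_cluster_integral lambda mu Q L true g h = \int[Q]_a J2 (- a)%R.
Proof.
rewrite other_cluster_integralE; [|exact: mu_ge0|exact: mg|exact: mh|exact: g_ge0|exact: h_ge0].
have mi : measurable_fun setT (fun xa : E * E => inner2 (- xa.2, xa.1)%R).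
  apply: (measurableT_comp measurable_inner2).
  apply/measurable_fun_pairP; split; last exact: measurable_fst.
  by apply: measurable_rV_opp; exact: measurable_snd.
have E1 := @fubini_tonelli _ _ E E R L Q (fun xa => inner2 (- xa.2, xa.1)%R) mi
  (fun xa => inner2_ge0 _).
apply: etrans E1.
apply: eq_integral => x _; apply: eq_integral => a _; apply: eq_integral => c _.
by rewrite [(x + c)%R]addrC.
Qed.

Lemma palm_integral_formula :
  p%:E * palm_integral lambda mu Q L true g h =
  ((1 - p) * p * mu)%:E * \int[reflection Q]_t
    (I1_theta lambda mu p Q ell noise theta t + I2_theta lambda mu p Q ell noise theta t).
Proof.
have -> : (fun t => I1_theta lambda mu p Q ell noise theta t + I2_theta lambda mu p Q ell noise theta t) =
    (fun t => ((1 - p)^-1)%:E * (J1 t + lambda%:E * J2 t)).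
  apply/funext => t; rewrite I1_J1 I2_J2.
  move: (J1_ge0 t) (J2_ge0 t); move: (J1 t) (J2 t) => x1 x2 x10 x20.
  rewrite ge0_muleDr//; last by apply: mule_ge0; rewrite ?lee_fin.
  by rewrite mulrC EFinM -muleA.
rewrite /palm_integral other_J2 own_J1.
exact: (integral_reflection_sum measurable_J1 measurable_J2 J1_ge0 J2_ge0).
Qed.

End coverage_formula.

Section path_loss_at_zero.
Context (R : realType) (n : nat).
Local Notation E := 'rV[R]_n.
Local Open Scope ereal_scope.

Lemma enorm_gt0 (x : E) : x != 0%R -> (0 < enorm x)%R.
Proof.
move=> x0; rewrite lt_neqAle enorm_ge0 andbT eq_sym.
by apply: contra x0 => /eqP/enorm_eq0 ->.
Qed.

Lemma measurable_path_loss_extension (ell : R -> R) (c : R) :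
  measurable_fun (`]0%R, +oo[ : set R) ell ->
  measurable_fun setT (fun r : R => if (0 < r)%R then ell r else if r == 0%R then c else 0%R).
Proof.
move=> mell.
have m1 : measurable_fun setT (ell \_ (`]0%R, +oo[ : set R)).
  by apply/(measurable_restrict ell) => //; rewrite setTI.
rewrite (_ : (fun r : R => _) = fun r : R => if r == 0%R then c else (ell \_ (`]0%R, +oo[ : set R)) r).
  apply: measurable_fun_ifT => //.
  by apply: (measurable_fun_bool true); rewrite setTI (_ : _ @^-1` _ = [set 0%R])//;
    apply/seteqP; split => r /= /eqP.
apply/funext => r; rewrite patchE; have [r0|r0] := ltP 0%R r.
  by rewrite gt_eqF// mem_set//= in_itv/= r0.
by rewrite memNset//= in_itv/= andbT ltNge r0.
Qed.

Section formula_at_nonzero.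
Variables (lambda mu p : R) (Q : probability E R) (ell ell' : R -> R) (noise theta : R).
Hypothesis agree : forall r, (0 < r)%R -> ell r = ell' r.

Lemma C_theta_agree (y x : E) : y != 0%R ->
  C_theta mu p Q ell theta y x = C_theta mu p Q ell' theta y x.
Proof.
move=> /enorm_gt0 y0; rewrite /C_theta; congr (expR (- (_ * (1 - fine _)))).
have mx : measurable_fun setT (fun c : E => c + x)%R.
  by apply: measurable_rV_add => //; exact: measurable_cst.
apply: (@eq_integral _ _ _ (image_measure Q mx)) => z; rewrite inE/= => yz.
by rewrite !agree//; exact: lt_trans yz.
Qed.

Lemma E_theta_agree (y : E) : y != 0%R ->
  E_theta lambda mu p Q ell theta y = E_theta lambda mu p Q ell' theta y.
Proof.
move=> y0; rewrite /E_theta.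
have -> // : (fun w : E => (1 - C_theta mu p Q ell theta y w)%:E) =
  fun w => (1 - C_theta mu p Q ell' theta y w)%:E.
by apply/funext => w; rewrite C_theta_agree.
Qed.

Lemma own_integrand_agree (y t : E) : y != 0%R ->
  own_integrand lambda mu Q p ell noise theta y t = own_integrand lambda mu Q p ell' noise theta y t.
Proof.
by move=> y0; rewrite /own_integrand (agree (enorm_gt0 y0)) (C_theta_agree t y0) (E_theta_agree y0).
Qed.

Lemma other_integrand_agree (y t x : E) : y != 0%R ->
  other_integrand lambda mu Q p ell noise theta y t x =
  other_integrand lambda mu Q p ell' noise theta y t x.
Proof.
move=> y0; rewrite /other_integrand (agree (enorm_gt0 y0)) (C_theta_agree t y0).
by rewrite (C_theta_agree x y0) (E_theta_agree y0).
Qed.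

Hypothesis Q_diffuse : forall x, Q [set x] = 0.

Lemma integral_translate_agree (x : E) (F F' : E -> \bar R) :
  measurable_fun setT F' -> (forall y, y != 0%R -> F y = F' y) ->
  \int[translate x Q]_y F y = \int[translate x Q]_y F' y.
Proof.
move=> mF' FF'.
have mx : measurable_fun setT (fun c : E => c + x)%R.
  by apply: measurable_rV_add => //; exact: measurable_cst.
have -> : F = fun y => if y == 0%R then F 0%R else F' y.
  by apply/funext => y; have [->|/FF'] := eqVneq y 0%R.
apply: (@ae_eq_integral _ _ _ (image_measure Q mx)) => //.
- apply: measurable_fun_ifT => //.
  apply: (measurable_fun_bool true); rewrite setTI (_ : _ @^-1` _ = [set 0%R]).
    exact: measurable_rV_set1.
  by apply/seteqP; split => r /= /eqP.
- exists [set 0%R]; split; first exact: measurable_rV_set1.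
    have -> // : image_measure Q mx [set 0%R] = Q [set (- x)%R].
    rewrite /= /pushforward; congr (Q _); apply/seteqP; split => y /=.
      by move=> yx; apply/eqP; rewrite -addr_eq0 yx.
    by move=> ->; rewrite addNr.
  move=> y /= ney; apply: contrapT => /eqP y0; apply: ney => _.
  by rewrite (negbTE y0).
Qed.

End formula_at_nonzero.
End path_loss_at_zero.
Section diffuse_offspring.
Context (R : realType) (n : nat).
Local Notation E := 'rV[R]_n.
Local Open Scope ereal_scope.
Variable Q : probability E R.
Hypothesis Q_diffuse : forall x, Q [set x] = 0.

Lemma integral_off_point (a : E) (F : E -> \bar R) :
  (forall c, c != a -> F c = 0) -> \int[Q]_c F c = 0.
Proof.
move=> F0.
have -> : F = fun c => if c == a then F a else 0.
  by apply/funext => c; have [->|/F0] := eqVneq c a.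
transitivity (\int[Q]_c cst (0 : \bar R) c); last exact: integral0.
apply: ae_eq_integral => //.
- apply: measurable_fun_ifT => //.
  apply: (measurable_fun_bool true); rewrite setTI (_ : _ @^-1` _ = [set a]).
    exact: measurable_rV_set1.
  by apply/seteqP; split => r /= /eqP.
- exists [set a]; split; [exact: measurable_rV_set1|exact: Q_diffuse|].
  move=> y /= ney; apply: contrapT => /eqP y0; apply: ney => _.
  by rewrite (negbTE y0).
Qed.

Let at_origin (y : E) : R := \1_[set 0%R] y.

Let at_origin_neq0 y : y != 0%R -> at_origin y = 0%R.
Proof. by move=> y0; rewrite /at_origin indicE memNset//; exact/eqP. Qed.

Variables (lambda mu : R) (L : {sigma_finite_measure set E -> \bar R}).
Hypotheses (lambda_gt0 : (0 < lambda)%R) (mu_gt0 : (0 < mu)%R).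

Lemma palm_integral_origin : palm_integral lambda mu Q L true at_origin (cst 0%R) = 0.
Proof.
have mg : measurable_fun setT at_origin.
  by apply: measurable_indic; exact: measurable_rV_set1.
have mh : measurable_fun setT (cst 0%R : E * E -> R) by exact: measurable_cst.
have g0 y : (0 <= at_origin y)%R by rewrite /at_origin indicE.
have h0 (z : E * E) : (0 <= (cst 0 z : R))%R by [].
rewrite /palm_integral.
have -> : own_cluster_integral lambda mu Q L true at_origin (cst 0%R) = 0.
  apply: (etrans (own_cluster_integralE lambda Q L (ltW mu_gt0) true mg mh g0 h0)).
  apply: integral0_eq => a _; apply: (@integral_off_point a) => c ca.
  by rewrite at_origin_neq0 ?mul0e// subr_eq0.
have -> : other_cluster_integral lambda mu Q L true at_origin (cst 0%R) = 0.
  apply: (etrans (other_cluster_integralE lambda Q L (ltW mu_gt0) true mg mh g0 h0)).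
  apply: integral0_eq => x _; apply: integral0_eq => a _; apply: (@integral_off_point (- x)%R) => c cx.
  by rewrite at_origin_neq0 ?mul0e// addrC addr_eq0.
by rewrite !mule0 adde0.
Qed.

Section palm_points.
Hypothesis LE : @lebesgue_rV R n = L.
Context (d : measure_display) (T : measurableType d) (P : probability T R).
Variables (X : nat -> {RV P >-> E}) (kappa : nat -> {RV P >-> nat}).
Variables (Y : nat -> nat -> {RV P >-> E}).
Hypothesis ppcp : PPCP X kappa Y lambda mu Q.
Context (d0 : measure_display) (T0 : measurableType d0) (P0 : probability T0 R).
Variables (Z : nat -> {RV P0 >-> E}).
Hypothesis palmZ : reduced_palm P (lambda * mu) (cluster_process X kappa Y)
  P0 (fun w => point_measure (fun i => Z i w)).

Lemma ae_palm_points_neq0 : {ae P0, forall w, forall i, Z i w != 0%R}.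
Proof.
have mg : measurable_fun setT at_origin.
  by apply: measurable_indic; exact: measurable_rV_set1.
have g0 y : (0 <= at_origin y)%R by rewrite /at_origin indicE.
have h0 (z : E * E) : (0 <= (cst 0 z : R))%R by [].
have mZ0 i : measurable [set w | Z i w = 0%R].
  by rewrite -[X in measurable X]setTI; exact: (measurable_funP (Z i) measurableT _ (measurable_rV_set1 0%R)).
have mh : measurable_fun setT (cst 0%R : E * E -> R) by exact: measurable_cst.
have := palm_first_order LE lambda_gt0 mu_gt0 ppcp palmZ mg mh g0 h0.
rewrite palm_integral_origin.
have -> : (fun w => \sum_(i <oo) (at_origin (Z i w))%:E *
    expeN (\sum_(j <oo) ((cst 0%R : E * E -> R) (Z i w, Z j w))%:E)) =
    fun w => \sum_(i <oo) (\1_[set w | Z i w = 0%R] w)%:E.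
  apply/funext => w; apply: eq_eseriesr => i _.
  by rewrite eseries0// expeN0 mule1.
rewrite integral_nneseries//; last first.
  by move=> i; apply/measurable_EFinP; apply: measurable_indic.
move=> sum0; apply: ae_foralln => i.
exists [set w | Z i w = 0%R]; split => //; last by move=> w /= /negP/negPn/eqP.
have f0 j : 0 <= \int[P0]_w (\1_[set w | Z j w = 0%R] w)%:E.
  by apply: integral_ge0 => w _; rewrite lee_fin.
have := sum0; rewrite (nneseries_rem i)// integral_indic// setIT => s0.
apply/eqP; rewrite eq_le measure_ge0 andbT -s0 leeDl//.
by apply: nneseries_ge0 => j _ _; case: (j != i).
Qed.

Variable p : R.
Variables (tx : nat -> {RV P0 >-> bool}) (Y' : nat -> {RV P0 >-> E}).
Hypothesis thinZ : thinning p Z tx (fun w => point_measure (fun m => Y' m w)).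

Lemma ae_thinned_points_neq0 : {ae P0, forall w, forall m, Y' m w != 0%R}.
Proof.
have [_ _ thinE] := thinZ.
apply: filterS2 ae_palm_points_neq0 thinE => w Zn0 /(_ _ (measurable_rV_set1 0%R)).
rewrite [X in _ = X -> _]eseries0; last first.
  by move=> i _ _; rewrite diracE memNset//=; exact/eqP.
move=> Y0 m; apply/negP => /eqP Ym0.
have : \d_(Y' m w) [set 0%R : E] <= point_measure (fun m => Y' m w) [set 0%R].
  rewrite /point_measure /mseries (nneseries_rem m)// leeDl//.
  by apply: nneseries_ge0 => j _ _; case: (j != m).
by rewrite Y0 diracE mem_set//= lee_fin ler10.
Qed.

Lemma coverage_probability_agree (H : nat -> {RV P0 >-> R}) (ell ell' : R -> R) (noise theta : R) :
  measurable_fun (`]0%R, +oo[ : set R) ell -> measurable_fun setT ell' ->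
  (forall r, (0 < r)%R -> ell r = ell' r) ->
  coverage_probability p ell noise theta H Y' = coverage_probability p ell' noise theta H Y'.
Proof.
move=> mell mell' agree.
pose ell0 (r : R) : R := if (0 < r)%R then ell r else if r == 0%R then ell 0%R else 0%R.
have ell0E (x : E) : ell (enorm x) = ell0 (enorm x).
  rewrite /ell0; have [->|/enorm_gt0 ->//] := eqVneq x 0%R.
  by rewrite enorm0 ltxx eqxx.
rewrite /coverage_probability; congr (_ * _); apply: eq_eseriesr => m _.
set A := [set w | _]; set B := [set w | _].
have mA : measurable A.
  have -> : A = [set w | theta%:E < SINR ell0 noise H Y' m w /\
      forall j, j != m -> (enorm (Y' m w) < enorm (Y' j w))%R].
    rewrite /A /SINR; apply/seteqP; split => w /= [sw nw]; split => //; move: sw.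
      by rewrite ell0E; under eq_eseriesr do rewrite ell0E.
    by rewrite ell0E; under [X in _ -> theta%:E < _ / (X + _)]eq_eseriesr do rewrite ell0E.
  exact: (measurable_coverage_event H Y' noise theta (measurable_path_loss_extension _ mell)).
have mB : measurable B by exact: (measurable_coverage_event H Y' noise theta mell').
rewrite -[A]setIT -[B]setIT -!integral_indic//; apply: ae_eq_integral => //.
- by apply/measurable_EFinP; exact: measurable_indic.
- by apply/measurable_EFinP; exact: measurable_indic.
apply: filterS ae_thinned_points_neq0 => w Yn0 _.
rewrite !indicE; suff -> : (w \in A) = (w \in B) by [].
have SE : SINR ell noise H Y' m w = SINR ell' noise H Y' m w.
  rewrite /SINR agree ?enorm_gt0//; congr (_ / (_ + _)).
  by apply: eq_eseriesr => j _; rewrite agree ?enorm_gt0.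
by apply/idP/idP; rewrite !inE /A /B /= SE.
Qed.

End palm_points.
End diffuse_offspring.

Theorem theorem2 (R : realType) (d : nat) (d_ge2 : (2 <= d)%N)
    (lambda mu : R) (lambda_gt0 : 0 < lambda) (mu_gt0 : 0 < mu)
    (Q : probability 'rV[R]_d R) (Q_diffuse : forall x, Q [set x] = 0%E)
    (disp : measure_display) (Omega : measurableType disp)
    (P : probability Omega R)
    (X : nat -> {RV P >-> 'rV[R]_d}) (kappa : nat -> {RV P >-> nat})
    (Y : nat -> nat -> {RV P >-> 'rV[R]_d})
    (Psi_PPCP : PPCP X kappa Y lambda mu Q)
    (disp0 : measure_display) (Omega0 : measurableType disp0)
    (P0 : probability Omega0 R)
    (Z : nat -> {RV P0 >-> 'rV[R]_d})
    (Z_palm : reduced_palm P (lambda * mu) (cluster_process X kappa Y)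
                P0 (fun w => point_measure (fun i => Z i w)))
    (p : R) (p_gt0 : 0 < p) (p_lt1 : p < 1)
    (tx : nat -> {RV P0 >-> bool}) (Y' : nat -> {RV P0 >-> 'rV[R]_d})
    (Y'_thinning : thinning p Z tx (fun w => point_measure (fun m => Y' m w)))
    (H : nat -> {RV P0 >-> R}) (H_fading : fading H Y')
    (ell : R -> R) (ell_path_loss : path_loss d ell)
    (noise : R) (noise_ge0 : 0 <= noise) (theta : R) (theta_gt0 : 0 < theta) :
  coverage_probability p ell noise theta H Y' =
  (((1 - p) * p * mu)%:E *
   \int[reflection Q]_t
     (I1_theta lambda mu p Q ell noise theta t +
      I2_theta lambda mu p Q ell noise theta t))%E.
Proof.
have [mell ell_ge0 _] := ell_path_loss.
have [L LE] := @lebesgue_rV_is_measure R d.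
pose ell' (r : R) : R := if 0 < r then ell r else if r == 0 then 0 else 0.
have mell' : measurable_fun setT ell' by exact: measurable_path_loss_extension.
have ell'_ge0 r : 0 <= ell' r.
  by rewrite /ell'; case: (ltP 0 r) => [/ell_ge0|_] //; case: (r == 0).
have agree r : 0 < r -> ell r = ell' r by rewrite /ell' => ->.
rewrite (coverage_probability_agree Q_diffuse lambda_gt0 mu_gt0 LE Psi_PPCP Z_palm
  Y'_thinning H noise theta mell mell' agree).
rewrite (coverage_palm_integral LE lambda_gt0 mu_gt0 Psi_PPCP Z_palm p_gt0 p_lt1
  Y'_thinning H_fading mell' ell'_ge0 noise_ge0 theta_gt0).
rewrite (palm_integral_formula Q LE lambda_gt0 mu_gt0 p_gt0 p_lt1 noise mell' ell'_ge0 theta_gt0).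
have I1E t : I1_theta lambda mu p Q ell noise theta t = I1_theta lambda mu p Q ell' noise theta t.
  apply: (integral_translate_agree Q_diffuse t
    (measurable_I1_integrand Q LE lambda_gt0 mu_gt0 p_gt0 p_lt1 noise mell' ell'_ge0 theta_gt0 t)).
  move=> y y0; exact: own_integrand_agree.
have I2E t : I2_theta lambda mu p Q ell noise theta t = I2_theta lambda mu p Q ell' noise theta t.
  rewrite /I2_theta LE; apply: congr1; apply: eq_integral => x _.
  apply: (integral_translate_agree Q_diffuse x
    (measurable_I2_integrand Q LE lambda_gt0 mu_gt0 p_gt0 p_lt1 noise mell' ell'_ge0 theta_gt0 t x)).
  move=> y y0; exact: other_integrand_agree.
apply: congr1.
apply: (@etrans _ _ (\int[reflection Q]_t (I1_theta lambda mu p Q ell' noise theta t +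
  I2_theta lambda mu p Q ell' noise theta t))%E); first exact: erefl.
apply: congr1; apply/funext => t; exact: (esym (congr2 adde (I1E t) (I2E t))).
Qed.
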